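(* Let $\mathfrak{h}$ be a finite-dimensional complex vector space with a nondegenerate symmetric bilinear form $\langle\cdot,\cdot\rangle$, let $L$ be an additive subgroup of $\mathfrak{h}$ with $\langle\alpha,\alpha\rangle\in2\mathbb{Z}$ for all $\alpha\in L$, equipped with $\varepsilon:L\times L\to\mathbb{C}^\times$ satisfying, for $\alpha,\beta,\gamma\in L$, $\varepsilon(\alpha,0)=\varepsilon(0,\alpha)=1$, $\varepsilon(\alpha,\beta+\gamma)\varepsilon(\beta,\gamma)=\varepsilon(\alpha+\beta,\gamma)\varepsilon(\alpha,\beta)$ and $\varepsilon(\alpha,\beta)\varepsilon(\beta,\alpha)^{-1}=(-1)^{\langle\alpha,\beta\rangle}$. Let $W$ be an irreducible $V_{(\mathfrak{h},L)}$-module on which $\mathfrak{u}(0)=\mathbb{C}u_1(0)\oplus\cdots\oplus\mathbb{C}u_s(0)$ acts semisimply. Then $W$ is isomorphic to $V_{(\mathfrak{h},L)}(\lambda,U_1)$ for some $\lambda\in L^o$ and some irreducible restricted $\mathcal{L}_1$-module $U_1$ of level $1$.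
   Context: Everything is over $\mathbb{C}$. $\hat{\mathfrak{h}}=\mathfrak{h}\otimes\mathbb{C}[t,t^{-1}]\oplus\mathbb{C}\mathbf{k}$ is the Lie algebra with $\mathbf{k}$ central and $[u(m),v(n)]=m\langle u,v\rangle\delta_{m+n,0}\mathbf{k}$, where $h(n)=h\otimes t^n$; $\mathfrak{h}(n)=\{h(n)\mid h\in\mathfrak{h}\}$. Level $\ell$ means $\mathbf{k}$ acts as the scalar $\ell$; an $\hat{\mathfrak{h}}$-module $W$ is restricted if for every $w\in W$, $\mathfrak{h}(n)w=0$ for $n$ sufficiently large. $M(1)=U(\hat{\mathfrak{h}})\otimes_{U(\mathfrak{h}\otimes\mathbb{C}[t]+\mathbb{C}\mathbf{k})}\mathbb{C}_1$ ($\mathfrak{h}\otimes\mathbb{C}[t]$ acting trivially and $\mathbf{k}$ as $1$ on $\mathbb{C}_1=\mathbb{C}$), $\mathbf{1}=1\otimes1$, $\mathfrak{h}\subset M(1)$ via $h\mapsto h(-1)\mathbf{1}$; it is a vertex algebra with vacuum $\mathbf{1}$ and $Y(h,x)=h(x)=\sum_nh(n)x^{-n-1}$ for $h\in\mathfrak{h}$, and every restricted $\hat{\mathfrak{h}}$-module $U$ of level $1$ has a unique $M(1)$-module structure $Y_U$ with $Y_U(h,x)=h(x)$. Condition $C_L$ for an $\hat{\mathfrak{h}}$-module $U$: $U$ is restricted of level $1$ and for every $\alpha\in L$, $\alpha(0)$ is semisimple with only integer eigenvalues and $\alpha(n)$ is locally nilpotent for all $n\ge1$. For $\alpha\in\mathfrak{h}$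 let $E^{\pm}(\alpha,x)=\exp\left(\sum_{n\ge1}\frac{\alpha(\pm n)}{\pm n}x^{\mp n}\right)$ and $\bar\Delta(\alpha,x)=(-x)^{\alpha(0)}E^+(-\alpha,-x)$. For $U$ satisfying Condition $C_L$, $V_{(\mathfrak{h},L)}(U)=\mathbb{C}[L]\otimes U$ with $$Y_W(e^\alpha\otimes v,x)(e^\beta\otimes w)=\varepsilon(\alpha,\beta)e^{\alpha+\beta}\otimes x^{\langle\alpha,\beta\rangle}E^-(-\alpha,x)Y_U(\bar\Delta(\beta,x)v,x)\bar\Delta(\alpha,-x)w$$ for $\alpha,\beta\in L$, $v\in M(1)$, $w\in U$. With $U=M(1)$ this gives the vertex algebra $V_{(\mathfrak{h},L)}=\mathbb{C}[L]\otimes M(1)$ with vacuum $e^0\otimes\mathbf{1}$, containing $M(1)$ via $v\mapsto e^0\otimes v$, and $V_{(\mathfrak{h},L)}(U)$ is a $V_{(\mathfrak{h},L)}$-module. On any $V_{(\mathfrak{h},L)}$-module $(W,Y_W)$, $h(n)$ acts by $Y_W(h,x)=\sum_nh(n)x^{-n-1}$. Fix $\alpha_1,\dots,\alpha_r\in L$ forming a basis of the subspace $\mathbb{C}L$ spanned by $L$, extend to a basis $\{\alpha_1,\dots,\alpha_r,u_1,\dots,u_s\}$ of $\mathfrak{h}$, and let $\{\beta_1,\dots,\beta_r,v_1,\dots,v_s\}$ be the dual basis with respect to $\langle\cdot,\cdot\rangle$. Set $L^o=\{\lambda\in\mathfrak{h}\mid\langle\alpha,\lambda\rangle\in\mathbb{Z}\text{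 for all }\alpha\in L\}$, $\mathcal{L}_0=\sum_{i=1}^r\sum_{n\ge1}(\mathbb{C}\alpha_i(n)+\mathbb{C}\beta_i(-n))+\mathbb{C}\mathbf{k}$, $\mathcal{L}_1=\sum_{j=1}^s\sum_{n\ge1}(\mathbb{C}u_j(n)+\mathbb{C}v_j(-n))+\mathbb{C}\mathbf{k}$. Then $\hat{\mathfrak{h}}=(\mathcal{L}_0+\mathcal{L}_1)\oplus\mathfrak{h}(0)$ with the three subalgebras mutually commuting. $M_0(1)=\mathbb{C}[\beta_i(-n)\mid1\le i\le r,\,n\ge1]$ is the canonical irreducible $\mathcal{L}_0$-module of level $1$ on which all $\alpha_i(n)$, $n\ge1$, act locally nilpotently. An $\mathcal{L}_1$-module $U_1$ is restricted if for every $w\in U_1$ and $1\le j\le s$, $u_j(n)w=0$ for $n$ sufficiently large. For $\lambda\in L^o$ and an irreducible restricted $\mathcal{L}_1$-module $U_1$ of level $1$, $M(1,\lambda,U_1)=\mathbb{C}e^\lambda\otimes U_1\otimes M_0(1)$ is the $\hat{\mathfrak{h}}$-module of level $1$ with $h(0)$ acting as $\langle\lambda,h\rangle$, $\mathcal{L}_1$ acting on $U_1$ and $\mathcal{L}_0$ on $M_0(1)$; it satisfies Condition $C_L$. Finally $V_{(\mathfrak{h},L)}(\lambda,U_1)=V_{(\mathfrak{h},L)}(M(1,\lambda,U_1))$. *)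

(* Defs.v *)
From HB Require Import structures.
From mathcomp Require Import all_boot all_order all_algebra generic_quotient.
From mathcomp Require Import finmap multiset.
From mathcomp Require Import boolp classical_sets functions cardinality fsbigop.
From mathcomp Require Import reals complex.

Set Implicit Arguments.
Unset Strict Implicit.
Unset Printing Implicit Defensive.

Import GRing.Theory.
Local Open Scope ring_scope.
Local Open Scope classical_set_scope.

(** Infinite sums [\sum_(i \in [set: I]) F i] are those of mathcomp's
    [fsbigop]: the sum of the nonzero terms if there are finitely many of them
    (and 0 otherwise).  A formal series over a space [W] is handled through its
    coefficients, and a vertex operator [Y(v,x) = sum_n v_n x^(-n-1)] through
    its modes: [Y v n w] is [v_n w]. *)

(** [ffs K U] is [K^(U)], i.e. [C[K] (x) U], with [single k w] for [e^k (x) w]. *)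
Section FinitelySupported.
Variables (C : fieldType) (K : choiceType) (U : lmodType C).

Definition fin_supp : {pred K -> U} :=
  fun f => `[< finite_set [set k | f k != 0] >].

Lemma fin_supp_closed : submod_closed fin_supp.
Proof.
split=> [|a f g].
  apply/asboolP; have -> : [set k | (0 : K -> U) k != 0] = set0; last by [].
  by rewrite -subset0 => k /=; rewrite eqxx.
move=> /asboolP ff /asboolP gf; apply/asboolP.
apply: (@sub_finite_set _ _ ([set k | f k != 0] `|` [set k | g k != 0])).
  move=> k /=; case: (eqVneq (f k) 0) => [fk0|]; last by left.
  case: (eqVneq (g k) 0) => [gk0|]; last by right.
  by rewrite /GRing.add /= /GRing.scale /= fk0 gk0 scaler0 addr0 eqxx.
by rewrite finite_setU; split.
Qed.

HB.instance Definition _ :=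
  GRing.isSubmodClosed.Build C (K -> U) fin_supp fin_supp_closed.

Record ffs := Ffs { ffs_val :> K -> U; _ : ffs_val \in fin_supp }.

HB.instance Definition _ := [isSub for ffs_val].
HB.instance Definition _ := [Choice of ffs by <:].
HB.instance Definition _ := [SubChoice_isSubLmodule of ffs by <:].

(** [mk_ffs f] is [f] when [f] has finite support (the only case in use). *)
Definition mk_ffs (f : K -> U) : ffs := insubd 0 f.

Definition single (k : K) (w : U) : ffs :=
  mk_ffs (fun k' => if k' == k then w else 0).

End FinitelySupported.

Arguments ffs {C} K U.

Section LinearAlgebra.
Variable C : fieldType.

(** Meaningful when [z] is an integer and [C] has characteristic 0. *)
Definition int_of (z : C) : int := xget 0 [set k : int | z = k%:~R].

Definition binomz (l : int) (i : nat) : C :=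
  (\prod_(j < i) (l - j%:Z)%:~R) / (i`!)%:R.

Variable W : lmodType C.

Definition irreducible (T : set (W -> W)) : Prop :=
  (exists w : W, w != 0) /\
  forall P : {pred W}, submod_closed P ->
    (forall t, T t -> forall w, w \in P -> t w \in P) ->
    P =i pred1 0 \/ P =i predT.

(** [W] is spanned by common eigenvectors of the operators [T i]. *)
Definition acts_semisimply (I : Type) (T : I -> W -> W) : Prop :=
  forall w : W, exists (n : nat) (e : 'I_n -> W),
    w = \sum_(k < n) e k /\
    forall k, exists chi : I -> C, forall i, T i (e k) = chi i *: e k.

(** For [A] semisimple with integer eigenvalues, [eigen_comp A m w] is the
    component of [w] in the eigenspace of eigenvalue [m], which is the
    coefficient of [x^m] in [x^A w]. *)
Definition eigen_comp (A : W -> W) (m : int) (w : W) : W :=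
  xget (fun=> 0) [set c : int -> W |
    [/\ finite_set [set j | c j != 0],
        forall j, A (c j) = j%:~R *: c j &
        \sum_(j \in [set: int]) c j = w]] m.

(** Coefficient of [z^N] in [S^k w], resp. [exp(S) w], for the series without
    constant term [S = sum_(i >= 1) a_i z^i] (so [S^k] only contributes to
    [z^N] when [k <= N]). *)
Fixpoint ser_pow (a : nat -> W -> W) (k N : nat) (w : W) : W :=
  if k is k'.+1 then \sum_(1 <= i < N.+1) a i (ser_pow a k' (N - i) w)
  else if N == 0%N then w else 0.

Definition ser_exp (a : nat -> W -> W) (N : nat) (w : W) : W :=
  \sum_(k < N.+1) (k`!%:R : C)^-1 *: ser_pow a k N w.

End LinearAlgebra.

Section VertexAlgebra.
Variables (C : fieldType) (V : lmodType C) (vac : V) (Y : V -> int -> V -> V).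

(** The last clause is the Jacobi identity, in components. *)
Definition is_va_module (W : lmodType C) (YW : V -> int -> W -> W) : Prop :=
  (forall v n, linear (YW v n)) /\
  (forall n w, linear (fun v => YW v n w)) /\
  (forall v w, exists N : int, forall n, N <= n -> YW v n w = 0) /\
  (forall n w, YW vac n w = if n == -1 then w else 0) /\
  (forall (u v : V) (w : W) (l m n : int),
    \sum_(i \in [set: nat])
       binomz C m i *: YW (Y u (l + i%:Z) v) (m + n - i%:Z) w =
    \sum_(i \in [set: nat]) ((-1) ^+ i * binomz C l i) *:
       (YW u (m + l - i%:Z) (YW v (n + i%:Z) w)
        - (-1) ^ l *: YW v (n + l - i%:Z) (YW u (m + i%:Z) w))).

Definition is_vertex_algebra : Prop :=
  is_va_module Y /\
  forall v, (forall n : int, 0 <= n -> Y v n vac = 0) /\ Y v (-1) vac = v.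

Definition va_module_irreducible (W : lmodType C) (YW : V -> int -> W -> W) :=
  irreducible [set YW p.1 p.2 | p in [set: V * int]].

Definition va_module_iso (W1 W2 : lmodType C)
    (Y1 : V -> int -> W1 -> W1) (Y2 : V -> int -> W2 -> W2) : Prop :=
  exists f : W1 -> W2, [/\ linear f, bijective f &
    forall v n w, f (Y1 v n w) = Y2 v n (f w)].

End VertexAlgebra.

(** Level-one modules for the Heisenberg algebra are given by the operators
    [act h n], the action of [h(n)]. *)

Section Heisenberg.
Variables (C : fieldType) (h : vectType C) (form : {symmetric h}).

(** [M(1)] is the tensor algebra on the symbols [h(n)], i.e. the space with
    basis the words in the letters [(h,n)], modulo the subspace [M1_rel]
    spanned by the relations of [U(h^)/(k-1)] (linearity of [h -> h(n)], in a
    two-sided context, and the commutation relations) and by the left ideal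
    generated by the [h(n)], [n >= 0]. *)
Definition words := ffs (seq (h * int)%type) C^o.

Definition word (s : seq (h * int)) : words := single s (1 : C^o).

Definition M1_relator (f : words) : Prop :=
  (exists s t (a : C) (u v : h) (n : int),
     f = word (s ++ (a *: u + v, n) :: t)
         - a *: word (s ++ (u, n) :: t) - word (s ++ (v, n) :: t)) \/
  (exists s t (u v : h) (m n : int),
     f = word (s ++ (u, m) :: (v, n) :: t) - word (s ++ (v, n) :: (u, m) :: t)
         - (if m + n == 0 then m%:~R * form u v else 0) *: word (s ++ t)) \/
  (exists s (u : h) (n : int), 0 <= n /\ f = word (rcons s (u, n))).

Definition M1_rel : {pred words} := fun f =>
  `[< forall S : {pred words}, submod_closed S ->
        (forall g, M1_relator g -> g \in S) -> f \in S >].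

Lemma M1_rel_submod : submod_closed M1_rel.
Proof.
split=> [|a f g /asboolP fP /asboolP gP]; apply/asboolP=> S subS relS.
  by case: subS.
by have [_ SS] := subS; apply: SS; [exact: (fP S)|exact: (gP S)].
Qed.

Lemma M1_rel_zmod : zmod_closed M1_rel.
Proof.
have [S0 SS] := M1_rel_submod; split=> // x y xS yS.
by rewrite addrC -scaleN1r SS.
Qed.

HB.instance Definition _ := GRing.isZmodClosed.Build words M1_rel M1_rel_zmod.

Definition M1 := Quotient.quot M1_rel.

HB.instance Definition _ := GRing.Zmodule.on M1.

Local Open Scope quotient_scope.

Definition M1_pi (f : words) : M1 := \pi_(Quotient.quot M1_rel) f.
Definition M1_repr (x : M1) : words := repr (x : Quotient.quot M1_rel).

Definition M1_scale (a : C) (x : M1) : M1 := M1_pi (a *: M1_repr x).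

Lemma M1_piK x : M1_pi (M1_repr x) = x.
Proof. exact: reprK. Qed.

Lemma M1_piE f g : (M1_pi f == M1_pi g) = (f - g \in M1_rel).
Proof. by rewrite Quotient.idealrBE. Qed.

Lemma M1_piD f g : M1_pi (f + g) = M1_pi f + M1_pi g.
Proof. by rewrite /M1_pi Quotient.pi_add. Qed.

Lemma M1_piZ a f : M1_pi (a *: f) = M1_scale a (M1_pi f).
Proof.
apply/eqP; rewrite M1_piE -scalerBr -[_ *: _]addr0.
have [S0 SS] := M1_rel_submod; apply: SS => //.
by rewrite -M1_piE M1_piK.
Qed.

Fact M1_scaleA a b x : M1_scale a (M1_scale b x) = M1_scale (a * b) x.
Proof. by rewrite -[x]M1_piK -!M1_piZ scalerA. Qed.
Fact M1_scale1 x : M1_scale 1 x = x.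
Proof. by rewrite /M1_scale scale1r M1_piK. Qed.
Fact M1_scaleDr a x y : M1_scale a (x + y) = M1_scale a x + M1_scale a y.
Proof.
by rewrite -[x]M1_piK -[y]M1_piK -M1_piD -!M1_piZ scalerDr M1_piD.
Qed.
Fact M1_scaleDl x a b : M1_scale (a + b) x = M1_scale a x + M1_scale b x.
Proof. by rewrite -[x]M1_piK -!M1_piZ scalerDl M1_piD. Qed.

HB.instance Definition _ := GRing.Zmodule_isLmodule.Build C M1
  M1_scaleA M1_scale1 M1_scaleDr M1_scaleDl.

Definition M1_vac : M1 := M1_pi (word [::]).

(** The word [s] goes to the word [(u,n) :: s], linearly. *)
Definition M1_act (u : h) (n : int) (x : M1) : M1 :=
  M1_pi (mk_ffs (fun s => if s is p :: s' then
                            if p == (u, n) then M1_repr x s' else 0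
                          else 0)).

Definition M1_of (u : h) : M1 := M1_act u (-1) M1_vac.

(** The properties determining the vertex algebra [M(1)], resp. the
    [M(1)]-module structure on a restricted Heisenberg module of level one. *)
Definition is_M1_va (YM : M1 -> int -> M1 -> M1) : Prop :=
  is_vertex_algebra M1_vac YM /\
  forall (u : h) (n : int) (x : M1), YM (M1_of u) n x = M1_act u n x.

Definition is_M1_module_of (YM : M1 -> int -> M1 -> M1) (U : lmodType C)
    (act : h -> int -> U -> U) (YU : M1 -> int -> U -> U) : Prop :=
  is_va_module M1_vac YM YU /\
  forall (u : h) (n : int) (w : U), YU (M1_of u) n w = act u n w.

(** Coefficient of [x^k] in [E^+(u,x) w], [E^-(u,x) w] and [Delta(u,x) w], where
    [Delta(u,x) = (-x)^(u(0)) E^+(-u,-x)]. *)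
Section Exponentials.
Variables (U : lmodType C) (act : h -> int -> U -> U).

Definition Eplus (u : h) (k : int) (w : U) : U :=
  if k <= 0 then ser_exp (fun n w => (n%:R : C)^-1 *: act u n%:Z w) `|k|%N w
  else 0.

Definition Eminus (u : h) (k : int) (w : U) : U :=
  if 0 <= k then
    ser_exp (fun n w => (- n%:R : C)^-1 *: act u (- n%:Z) w) `|k|%N w
  else 0.

Definition Delta (u : h) (k : int) (w : U) : U :=
  \sum_(m \in [set: int])
    (-1) ^ m *: eigen_comp (act u 0) m
                  ((-1) ^ (k - m) *: Eplus (- u) (k - m) w).

End Exponentials.

Record lat (L : zmodClosed h) := Lat { lat_val : h; _ : lat_val \in L }.

HB.instance Definition _ (L : zmodClosed h) := [isSub for @lat_val L].
HB.instance Definition _ (L : zmodClosed h) := [Choice of lat L by <:].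
HB.instance Definition _ (L : zmodClosed h) :=
  [SubChoice_isSubZmodule of lat L by <:].

Section Lattice.
Variable L : zmodClosed h.

Definition even_lattice : Prop :=
  forall a : lat L, exists k : int, form (lat_val a) (lat_val a) = (2 * k)%:~R.

Definition is_cocycle (eps : lat L -> lat L -> C) : Prop :=
  (forall a b, eps a b != 0) /\
  (forall a, eps a 0 = 1 /\ eps 0 a = 1) /\
  (forall a b c, eps a (b + c) * eps b c = eps (a + b) c * eps a b) /\
  (forall a b, eps a b / eps b a = (-1) ^ int_of (form (lat_val a) (lat_val b))).

Definition dual_lattice (lam : h) : Prop :=
  forall a : lat L, exists k : int, form (lat_val a) lam = k%:~R.

Variable eps : lat L -> lat L -> C.

Definition latV (U : lmodType C) : lmodType C := ffs (lat L) U.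

Section VertexOperator.
Variables (U : lmodType C) (act : h -> int -> U -> U) (YU : M1 -> int -> U -> U).

(** Coefficient of [x^k] in
    [x^<a,b> E^-(-a,x) Y_U(Delta(b,x)v,x) Delta(a,-x)w]; the summand collects
    the coefficients of [x^i], [x^j], [x^m] in [E^-(-a,x)], [Delta(b,x)v] and
    [Delta(a,-x)w], and [Y_U] contributes the remaining power [x^l].  All the
    sums are finite when [U] is restricted of level one, each [a(0)] is
    semisimple with integer eigenvalues and each [a(n)], [n >= 1], is locally
    nilpotent, for [a] in [L]. *)
Definition lat_coef (a b : lat L) (v : M1) (w : U) (k : int) : U :=
  \sum_(p \in [set: int * int * int])
    let: (i, j, m) := p in
    let l := k - int_of (form (lat_val a) (lat_val b)) - i - j - m in
    Eminus act (- lat_val a) i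
      (YU (Delta M1_act (lat_val b) j v) (- l - 1)
          ((-1) ^ m *: Delta act (lat_val a) m w)).

Definition latY (f : latV M1) (n : int) (g : latV U) : latV U :=
  \sum_(p \in [set: lat L * lat L])
    single (p.1 + p.2)
      (eps p.1 p.2 *: lat_coef p.1 p.2 (f p.1) (g p.2) (- n - 1)).

End VertexOperator.

Definition latV_vac : latV M1 := single 0 M1_vac.

Definition latV_of (u : h) : latV M1 := single 0 (M1_of u).

Definition is_lat_module (YM : M1 -> int -> M1 -> M1)
    (W : lmodType C) (YW : latV M1 -> int -> W -> W) : Prop :=
  is_va_module latV_vac (latY M1_act YM) YW.

(** [al] is a basis of the span of [L], [al ++ us] a basis of [h], and
    [be ++ vs] the dual basis. *)
Definition adapted_bases (r s : nat) (al be : r.-tuple h) (us vs : s.-tuple h) :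
    Prop :=
  [/\ all [in L] al,
      forall a : lat L, lat_val a \in <<al>>%VS,
      basis_of fullv (al ++ us) &
      [/\ forall i j, form (tnth al i) (tnth be j) = (i == j)%:R,
          forall i j, form (tnth al i) (tnth vs j) = 0,
          forall i j, form (tnth us i) (tnth be j) = 0 &
          forall i j, form (tnth us i) (tnth vs j) = (i == j)%:R]].

End Lattice.

(** An [L_1]-module is given by the action [opu j n] of [u_j(n)] and [opv j n]
    of [v_j(-n)]; only [n >= 1] is meaningful. *)
Section L1Modules.
Variables (s : nat) (U1 : lmodType C) (opu opv : 'I_s -> nat -> U1 -> U1).

Definition is_L1_module (level : C) : Prop :=
  [/\ forall j n, (0 < n)%N -> linear (opu j n) /\ linear (opv j n),
      forall i j m n w, (0 < m)%N -> (0 < n)%N ->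
        opu i m (opu j n w) = opu j n (opu i m w),
      forall i j m n w, (0 < m)%N -> (0 < n)%N ->
        opv i m (opv j n w) = opv j n (opv i m w) &
      forall i j m n w, (0 < m)%N -> (0 < n)%N ->
        opu i m (opv j n w) - opv j n (opu i m w) =
        (if (i == j) && (m == n) then m%:R * level else 0) *: w].

Definition L1_restricted : Prop :=
  forall w j, exists N : nat, forall n, (N <= n)%N -> opu j n w = 0.

Definition L1_irreducible : Prop :=
  irreducible [set t | exists j n, (0 < n)%N /\ (t = opu j n \/ t = opv j n)].

End L1Modules.

Section M1LambdaU1.
Variables (r s : nat) (al be : r.-tuple h) (us vs : s.-tuple h) (lam : h).
Variables (U1 : lmodType C) (opu opv : 'I_s -> nat -> U1 -> U1).

(** [C e^lam (x) U_1 (x) M_0(1)]: polynomials with coefficients in [U_1] in the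
    variables [be_i(-n-1)], encoded as [(i,n)]; a monomial is the multiset of
    its variables. *)
Definition M1lam : lmodType C := ffs {mset 'I_r * nat}%mset U1.

Definition var_mul (x : 'I_r * nat) (f : M1lam) : M1lam :=
  mk_ffs (fun m : {mset 'I_r * nat}%mset =>
            if x \in m then f (m `\ x)%mset else 0).

Definition var_deriv (x : 'I_r * nat) (f : M1lam) : M1lam :=
  mk_ffs (fun m : {mset 'I_r * nat}%mset => f (x +` m)%mset *+ (m x).+1).

Definition on_coefs (t : U1 -> U1) (f : M1lam) : M1lam :=
  mk_ffs (fun m : {mset 'I_r * nat}%mset => t (f m)).

(** [al_i(n)] acts as [n d/d(be_i(-n))], [be_i(-n)] as multiplication, and the
    action of [u(n)] is obtained by expanding [u] in the basis [al ++ us] when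
    [n > 0] and in the basis [be ++ vs] when [n < 0]. *)
Definition M1lam_act (u : h) (n : int) (f : M1lam) : M1lam :=
  match n with
  | Posz 0 => form lam u *: f
  | Posz p.+1 =>
      \sum_(i < r) form u (tnth be i) *: (var_deriv (i, p) f *+ p.+1) +
      \sum_(j < s) form u (tnth vs j) *: on_coefs (opu j p.+1) f
  | Negz p =>
      \sum_(i < r) form u (tnth al i) *: var_mul (i, p) f +
      \sum_(j < s) form u (tnth us j) *: on_coefs (opv j p.+1) f
  end.

End M1LambdaU1.

End Heisenberg.

(* Main.v *)
(** Write [h(n)] and [e^a_n] for the modes of [h] and [e^a] on [W].  For [w <> 0]
    let [K] be maximal with [w1 = e^a_(K-1) w <> 0].  The identity
    [d/dx Y(e^a,x) = :a(x) Y(e^a,x):] shows that if [a(i) w = 0] for all [i > N],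
    where [N >= 1], then moreover [a(N) w1 = 0], and that if [a(i) w = 0] for all
    [i >= 1] then [w1] is an eigenvector of [a(0)].  As [w1] inherits what is known
    of [w], iterating over the [al_i] turns a common eigenvector of the [u_j(0)]
    into a nonzero vacuum vector: it is killed by all [al_i(n)], [n >= 1], and
    [h(0)] acts on it as a scalar [<lam,h>], where [<lam,a>] is an integer because
    it is determined by [K].

    On the space [U_1] of these vacuum vectors the same identity is a differential
    equation whose solution is [Y(e^a,x) w = x^<lam,a> E^-(-a,x) Z_a w], and the
    Jacobi identity gives [Z_a Z_b = eps(a,b) Z_(a+b)].  Hence
    [e^a (x) p (x) w |-> p(be_i(-n)) Z_a w] maps [C[L] (x) M_0(1) (x) U_1] to [W].
    It is injective, since the weights [lam + a] are distinct and the [al_i(n)] act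
    as derivations, and it is surjective, since its image is a submodule.  That it
    intertwines [Y(e^a (x) v, x)] is shown by induction on [v] in [M(1)] through
    the iterate formula, and for [v = 1] by induction on [p].  The [M(1)]-module
    structure of [M(1,lam,U_1)] is obtained by transport from [W]. *)

Require Import Defs.
From HB Require Import structures.
From mathcomp Require Import all_boot all_order all_algebra generic_quotient.
From mathcomp Require Import finmap multiset.
From mathcomp Require Import boolp classical_sets functions cardinality fsbigop.
From mathcomp Require Import reals complex.
From mathcomp Require Import zify ring.

Set Implicit Arguments.
Unset Strict Implicit.
Unset Printing Implicit Defensive.

Import Order.TTheory GRing.Theory Num.Theory.
Local Open Scope ring_scope.

(** * Linear maps and finite sums *)

(** The operators of the lattice construction are triple series indexed by [int], and a sum of
    infinite support defaults to 0; so identities between them are proved on a finite box of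
    indices, with one cutoff shared by all the sums of an argument.

    The Jacobi identity on W is applied only at indices where one side collapses. In particular l =
    -<a,b> - 1 is the last mode at which e^a_l e^b is nonzero, and there it equals eps(a,b) e^(a+b).
    The resulting relations are collected in [lat_rep], from which the vacuum vectors and the map to
    W are obtained.

    The injectivity of that map on the summand of e^0 also serves as a device: M_0(1) (x) U_1 embeds
    in W compatibly with all Heisenberg modes, so the Heisenberg relations and the M(1)-action with
    its Jacobi identity are pulled back from W instead of being checked on polynomials. In the same
    way the L_1-relations on U_1 are read off in W. *)

Section Linear.
Variables (C : fieldType) (U V : lmodType C) (f : U -> V).
Hypothesis f_lin : linear f.

Lemma linD u v : f (u + v) = f u + f v.
Proof. by have := f_lin 1 u v; rewrite !scale1r. Qed.

Lemma lin0 : f 0 = 0.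
Proof. by apply: (addrI (f 0)); rewrite -linD !addr0. Qed.

Lemma linZ a u : f (a *: u) = a *: f u.
Proof. by have := f_lin a u 0; rewrite !addr0 lin0 addr0. Qed.

Lemma linN u : f (- u) = - f u.
Proof. by rewrite -scaleN1r linZ scaleN1r. Qed.

Lemma linB u v : f (u - v) = f u - f v.
Proof. by rewrite linD linN. Qed.

Lemma linMn u n : f (u *+ n) = f u *+ n.
Proof. by elim: n => [|n IH]; rewrite ?mulr0n ?lin0 // !mulrS linD IH. Qed.

Lemma lin_sum I (r : seq I) (P : pred I) (F : I -> U) :
  f (\sum_(i <- r | P i) F i) = \sum_(i <- r | P i) f (F i).
Proof. exact: (big_morph f linD lin0). Qed.

End Linear.

Section SubmodClosed.
Variables (C : fieldType) (U : lmodType C) (S : {pred U}).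
Hypothesis S_sub : submod_closed S.

Lemma smc0 : 0 \in S. Proof. by case: S_sub. Qed.

Lemma smcZ a u : u \in S -> a *: u \in S.
Proof. by case: S_sub => S0 SS uS; rewrite -[_ *: _]addr0; apply: SS. Qed.

Lemma smcD u v : u \in S -> v \in S -> u + v \in S.
Proof.
by case: S_sub => _ SS uS vS; rewrite -[u]scale1r; apply: SS.
Qed.

Lemma smcN u : u \in S -> - u \in S.
Proof. by move=> uS; rewrite -scaleN1r; apply: smcZ. Qed.

Lemma smcB u v : u \in S -> v \in S -> u - v \in S.
Proof. by move=> uS vS; apply: smcD => //; apply: smcN. Qed.

Lemma smc_sum I (r : seq I) (P : pred I) (F : I -> U) :
  (forall i, P i -> F i \in S) -> \sum_(i <- r | P i) F i \in S.
Proof.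
move=> FS; elim/big_rec: _ => [|i x Pi xS]; first exact: smc0.
by apply: smcD; rewrite ?FS.
Qed.

End SubmodClosed.

(** Sums over infinite index sets are cut off at a bound that several truncation conditions must
    share. [ev_and] merges such conditions and [ev_witness] picks a bound, so that bounds seldom
    have to be written out. *)
Definition ev (P : nat -> Prop) := exists N, forall n, (N <= n)%N -> P n.

Lemma ev_and P Q : ev P -> ev Q -> ev (fun n => P n /\ Q n).
Proof.
move=> [M PM] [N QN]; exists (maxn M N) => n; rewrite geq_max => /andP[Mn Nn].
by split; [apply: PM|apply: QN].
Qed.

Lemma ev_imp (P Q : nat -> Prop) : (forall n, P n -> Q n) -> ev P -> ev Q.
Proof. by move=> PQ [N PN]; exists N => n /PN/PQ. Qed.

Lemma ev_all_lt S (P : nat -> nat -> Prop) :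
  (forall s, ev (P s)) -> ev (fun n => forall s, (s < S)%N -> P s n).
Proof.
move=> evP; elim: S => [|S IH]; first by exists 0%N.
have [N PN] := ev_and IH (evP S).
exists N => n /PN[Pn PSn] s; rewrite ltnS leq_eqVlt => /predU1P[->//|].
exact: Pn.
Qed.

Lemma ev_ge N : ev (fun n => (N <= n)%N).
Proof. by exists N. Qed.

Lemma ev_witness P : ev P -> exists n, P n.
Proof. by move=> [N PN]; exists N; apply: PN. Qed.

Lemma ev_shift k (P : nat -> Prop) : ev P -> ev (fun n => P (n - k)%N).
Proof. by move=> [N PN]; exists (N + k)%N => n Nn; apply: PN; lia. Qed.

Section FiniteSums.
Local Open Scope classical_set_scope.

Lemma fsum_seq (U : nmodType) (I : choiceType) (r : seq I) (F : I -> U) :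
  uniq r -> (forall i, i \notin r -> F i = 0) ->
  \sum_(i \in [set: I]) F i = \sum_(i <- r) F i.
Proof.
move=> r_uniq F0; rewrite (fsbigE r) //=; last by move=> i _ /F0.
by apply: eq_bigl => i; rewrite in_setT.
Qed.

Lemma fsum_nat (U : nmodType) (F : nat -> U) N :
  (forall i, (N <= i)%N -> F i = 0) ->
  \sum_(i \in [set: nat]) F i = \sum_(i < N) F i.
Proof.
move=> F0; rewrite (@fsum_seq _ _ (iota 0 N)) ?iota_uniq.
- by rewrite -(big_mkord xpredT) /index_iota subn0.
- by [].
by move=> i; rewrite mem_iota add0n leq0n -leqNgt; apply: F0.
Qed.

Lemma fsum_one (U : nmodType) (I : choiceType) (i0 : I) (F : I -> U) :
  (forall i, i != i0 -> F i = 0) -> \sum_(i \in [set: I]) F i = F i0.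
Proof.
move=> F0; rewrite (@fsum_seq _ _ [:: i0]) ?big_seq1 // => i.
by rewrite inE; apply: F0.
Qed.

End FiniteSums.

Lemma sum_ord_widen (U : nmodType) (F : nat -> U) N M :
  (N <= M)%N -> (forall i, (N <= i)%N -> F i = 0) ->
  \sum_(i < M) F i = \sum_(i < N) F i.
Proof.
move=> NM F0; rewrite -!(big_mkord xpredT F) (big_cat_nat (leq0n N) NM) /=.
rewrite -[RHS]addr0; congr (_ + _).
rewrite big_nat_cond big1 // => i /andP[/andP[Ni _] _].
exact: F0.
Qed.

(** * Finitely supported functions and their universal property *)

Section FinitelySupported.
Variables (C : fieldType) (K : choiceType) (U : lmodType C).
Implicit Types (f g : ffs K U) (k : K) (w : U).
Local Open Scope classical_set_scope.

Lemma ffs_ext f g : f =1 g -> f = g.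
Proof. by move=> fg; apply/val_inj/funext. Qed.

Lemma ffs0E k : (0 : ffs K U) k = 0.
Proof. by []. Qed.

Lemma ffsDE f g k : (f + g) k = f k + g k.
Proof. by []. Qed.

Lemma ffsZE a f k : (a *: f) k = a *: f k.
Proof. by []. Qed.

Lemma ffsMnE f k n : (f *+ n) k = f k *+ n.
Proof. by elim: n => [|n IH]; rewrite ?mulr0n ?ffs0E // !mulrS ffsDE IH. Qed.

Lemma ffs_sumE I (r : seq I) (P : pred I) (F : I -> ffs K U) k :
  (\sum_(i <- r | P i) F i) k = \sum_(i <- r | P i) F i k.
Proof. by apply: (big_morph (fun f : ffs K U => f k)). Qed.

(** [mk_ffs] silently returns 0 on a function of infinite support; the list [r] is the certificate
    that rules this out. *)
Lemma mk_ffsE (f : K -> U) (r : seq K) k :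
  (forall k', k' \notin r -> f k' = 0) -> mk_ffs f k = f k.
Proof.
move=> f0; rewrite /mk_ffs.
have fP : f \in @fin_supp C K U.
  apply/asboolP; apply: (@sub_finite_set _ _ [set` r]); last exact: finite_seq.
  move=> k' /= fk'; apply: contraT => /negP/negP k'r.
  by rewrite f0 ?eqxx in fk'.
by have := congr1 (fun g : K -> U => g k) (insubdK (0 : ffs K U) fP).
Qed.

Lemma singleE k w k' : single k w k' = if k' == k then w else 0.
Proof.
rewrite /single (@mk_ffsE _ [:: k]) // => i; rewrite inE.
by case: eqP.
Qed.

Lemma single_lin k : linear (@single C K U k).
Proof.
move=> a u v; apply: ffs_ext => k'; rewrite ffsDE ffsZE !singleE.
by case: eqP; rewrite // scaler0 addr0.
Qed.

Lemma single0 k : single k (0 : U) = 0.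
Proof. exact: lin0 (single_lin k). Qed.

Lemma ffs_supp f : exists r : seq K, uniq r /\ forall k, k \notin r -> f k = 0.
Proof.
have /asboolP/finite_fsetP[X XE] := valP f.
exists (enum_fset X); split; first exact: fset_uniq.
move=> k kX; apply/eqP; apply: contraNT kX => fk0.
suff : [set k | val f k != 0] k by rewrite XE.
by [].
Qed.

Lemma ffs_decomp f (r : seq K) :
  uniq r -> (forall k, k \notin r -> f k = 0) ->
  f = \sum_(k <- r) single k (f k).
Proof.
move=> r_uniq f0; apply: ffs_ext => k; rewrite ffs_sumE.
have [kr|/[dup] kr /f0 ->] := boolP (k \in r).
  rewrite (bigD1_seq k) //= singleE eqxx big1 ?addr0 // => i ik.
  by rewrite singleE eq_sym (negPf ik).
rewrite big_seq big1 // => i ir; rewrite singleE; case: eqP => // ki.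
by rewrite -ki (negPf kr) in ir.
Qed.

(** Unlike in [ffs_ind], only the coefficients [f k] that actually occur have to be treated; this
    keeps track of elements whose coefficients lie in a given subspace. *)
Lemma ffs_ind_coef (P : ffs K U -> Prop) f :
  P 0 -> (forall f g, P f -> P g -> P (f + g)) ->
  (forall k, P (single k (f k))) -> P f.
Proof.
move=> P0 PD P1; have [r [r_uniq f0]] := ffs_supp f.
rewrite (ffs_decomp r_uniq f0); elim/big_rec: _ => // k g _ Pg.
by apply: PD.
Qed.

Lemma ffs_ind (P : ffs K U -> Prop) f :
  P 0 -> (forall f g, P f -> P g -> P (f + g)) ->
  (forall k w, P (single k w)) -> P f.
Proof. by move=> P0 PD P1; apply: ffs_ind_coef. Qed.

Variables (W : lmodType C).

Lemma ffs_lin_ext (s t : ffs K U -> W) :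
  linear s -> linear t -> (forall k w, s (single k w) = t (single k w)) ->
  s =1 t.
Proof.
move=> s_lin t_lin st f; elim/ffs_ind: f => [|f g sf sg|//].
  by rewrite !lin0.
by rewrite !linD // sf sg.
Qed.

(** The universal property of a direct sum of copies of [U]. Once each [t k] is linear, the sum has
    finite support. *)
Definition ffs_lift (t : K -> U -> W) (f : ffs K U) : W :=
  \sum_(k \in [set: K]) t k (f k).

Variable t : K -> U -> W.
Hypothesis t_lin : forall k, linear (t k).

Lemma ffs_lift_seq f (r : seq K) :
  uniq r -> (forall k, k \notin r -> f k = 0) ->
  ffs_lift t f = \sum_(k <- r) t k (f k).
Proof.
by move=> r_uniq f0; apply: fsum_seq => // k /f0 ->; apply: lin0.
Qed.

Lemma ffs_lift_single k w : ffs_lift t (single k w) = t k w.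
Proof.
rewrite (@ffs_lift_seq _ [:: k]) ?big_seq1 ?singleE ?eqxx // => i.
by rewrite inE singleE => /negPf ->.
Qed.

Lemma ffs_lift_lin : linear (ffs_lift t).
Proof.
move=> a f g; have [r [r_uniq f0]] := ffs_supp f.
have [r' [r'_uniq g0]] := ffs_supp g.
have sup k : k \notin undup (r ++ r') -> f k = 0 /\ g k = 0.
  by rewrite mem_undup mem_cat negb_or => /andP[/f0 -> /g0 ->].
have liftE (F : ffs K U) : (forall k, k \notin undup (r ++ r') -> F k = 0) ->
    ffs_lift t F = \sum_(k <- undup (r ++ r')) t k (F k).
  by move=> F0; apply: ffs_lift_seq; rewrite ?undup_uniq.
rewrite !liftE; try by move=> k /sup[fk gk]; rewrite // ffsDE ffsZE fk gk scaler0 addr0.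
rewrite scaler_sumr -big_split /=; apply: eq_bigr => k _.
exact: t_lin.
Qed.

End FinitelySupported.

Section Scalars.
Variable C : numFieldType.

Lemma int_of_intr (k : int) : int_of (k%:~R : C) = k.
Proof.
rewrite /int_of; case: xgetP => [j _ /= /eqP|/(_ k)/(_ erefl)//].
by rewrite eqr_int => /eqP.
Qed.

Lemma int_of0 : int_of (0 : C) = 0.
Proof. by have := int_of_intr 0. Qed.

Lemma binomz_l0 l : binomz C l 0 = 1.
Proof. by rewrite /binomz big_ord0 fact0 divr1. Qed.

Lemma binomz_l1 l : binomz C l 1 = l%:~R.
Proof. by rewrite /binomz big_ord1 subr0 divr1. Qed.

Lemma binomz_0S i : binomz C 0 i.+1 = 0.
Proof. by rewrite /binomz big_ord_recl subrr mul0r mul0r. Qed.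

Lemma binomzN1 i : binomz C (-1) i = (-1) ^+ i.
Proof.
rewrite /binomz; have -> : \prod_(j < i) ((-1 - j%:Z)%:~R : C) = (-1) ^+ i * (i`!)%:R.
  elim: i => [|i IH]; first by rewrite big_ord0 mul1r.
  rewrite big_ord_recr /= IH factS natrM exprS -opprD intrN intrD /=.
  by rewrite -[i.+1%:R]natr1; ring.
by rewrite mulfK // pnatr_eq0 -lt0n fact_gt0.
Qed.

Lemma exprz_sign (m : int) : ((-1) ^ m * (-1) ^ m : C) = 1.
Proof.
rewrite -expfzDr ?oppr_eq0 ?oner_eq0 // (_ : m + m = 2 * m); last by lia.
by rewrite -exprz_exp -exprnP sqrrN expr1n exp1rz.
Qed.

Local Open Scope classical_set_scope.

(** [eigen_comp] chooses some decomposition into eigenvectors. If [A] is the scalar [m0], every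
    decomposition is concentrated at [m0], so the choice is forced. *)
Lemma eigen_comp_scalar (W : lmodType C) (A : W -> W) (m0 m : int) w :
  (forall v, A v = m0%:~R *: v) ->
  eigen_comp A m w = if m == m0 then w else 0.
Proof.
move=> AE; rewrite /eigen_comp.
have c0P (c : int -> W) : (forall j, A (c j) = j%:~R *: c j) ->
    forall j, j != m0 -> c j = 0.
  move=> cP j jm; have /eqP := cP j.
  rewrite AE -subr_eq0 -scalerBl scaler_eq0 -intrB intr_eq0 subr_eq0 eq_sym.
  by rewrite (negPf jm) => /eqP.
case: xgetP => [c _ /= [_ cP <-]|/(_ (fun j => if j == m0 then w else 0))[]].
  rewrite (fsum_one (i0 := m0)); last exact: c0P.
  by case: eqP => [->//|/eqP/c0P->].
split.
- apply: (@sub_finite_set _ _ [set m0]) => [j /=|]; last exact: finite_set1.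
  by case: (eqVneq j m0) => [->//|_]; rewrite eqxx.
- by move=> j; rewrite AE; case: eqP => [->//|]; rewrite !scaler0.
by rewrite (fsum_one (i0 := m0)) ?eqxx // => j /negPf ->.
Qed.

End Scalars.

(** * Exponentials of formal series of operators *)

Lemma inv_factS (C : numFieldType) k :
  ((k.+1)`!%:R : C)^-1 * k.+1%:R = (k`!%:R)^-1.
Proof. by rewrite factS natrM invfM mulrAC mulVf ?mul1r // pnatr_eq0. Qed.

Section SerExp.
Variables (C : numFieldType) (W : lmodType C) (a : nat -> W -> W).
Hypothesis a_lin : forall i, linear (a i).

Lemma ser_pow_lin k N : linear (ser_pow a k N).
Proof.
elim: k N => [|k IH] N c u v /=.
  by case: eqP; rewrite // scaler0 addr0.
rewrite scaler_sumr -big_split /=; apply: eq_bigr => i _.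
by rewrite IH a_lin.
Qed.

Lemma ser_exp_lin N : linear (ser_exp a N).
Proof.
move=> c u v; rewrite /ser_exp scaler_sumr -big_split /=.
by apply: eq_bigr => i _; rewrite ser_pow_lin scalerDr !scalerA mulrC.
Qed.

Lemma ser_pow_gt k N w : (N < k)%N -> ser_pow a k N w = 0.
Proof.
elim: k N => // k IH N Nk /=; rewrite big_nat big1 // => i /andP[i1 iN].
by rewrite IH ?(lin0 (a_lin i)) //; lia.
Qed.

Lemma ser_exp_widen M N w : (N < M)%N ->
  ser_exp a N w = \sum_(k < M) (k`!%:R : C)^-1 *: ser_pow a k N w.
Proof.
move=> NM; symmetry.
apply: (sum_ord_widen (F := fun k => (k`!%:R : C)^-1 *: ser_pow a k N w)) => //.
by move=> i Ni; rewrite ser_pow_gt // scaler0.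
Qed.

Lemma ser_exp0 w : ser_exp a 0 w = w.
Proof. by rewrite /ser_exp big_ord1 /= fact0 invr1 scale1r. Qed.

Lemma ser_exp_vac N w : (forall i, (0 < i)%N -> a i w = 0) ->
  ser_exp a N w = if N == 0%N then w else 0.
Proof.
move=> aw0; have sp0 k M : ser_pow a k.+1 M w = 0.
  elim: k M => [|k IH] M /=; rewrite big_nat big1 // => i /andP[i1 iM].
    by case: eqP => _ /=; rewrite ?aw0 ?(lin0 (a_lin i)).
  have := IH (M - i)%N => /= ->; exact: lin0.
rewrite /ser_exp big_ord_recl fact0 invr1 scale1r big1 ?addr0 // => k _.
by rewrite lift0 sp0 scaler0.
Qed.

Lemma ser_exp_closed (S : {pred W}) N w : submod_closed S ->
  (forall i v, (0 < i)%N -> v \in S -> a i v \in S) ->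
  w \in S -> ser_exp a N w \in S.
Proof.
move=> S_sub aS wS; apply: smc_sum => // k _; apply: smcZ => //.
case: k => k /= _; elim: k N => [|k IH] N /=.
  by case: eqP => // _; apply: smc0.
rewrite big_nat; apply: smc_sum => // i /andP[i1 _]; exact: aS.
Qed.

Lemma ser_exp_intertwine (W' : lmodType C) (a' : nat -> W' -> W') (f : W -> W') N w :
  linear f -> (forall i v, (0 < i)%N -> f (a i v) = a' i (f v)) ->
  f (ser_exp a N w) = ser_exp a' N (f w).
Proof.
move=> f_lin fa; rewrite /ser_exp (lin_sum f_lin).
apply: eq_bigr => k _; rewrite (linZ f_lin); congr (_ *: _).
case: k => k /= _; elim: k N => [|k IH] N /=.
  by case: eqP => // _; apply: lin0.
rewrite (lin_sum f_lin); apply: eq_big_nat => i /andP[i1 _].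
by rewrite fa // IH.
Qed.

Section Commutator.
Variables (D : W -> W) (n : nat) (c : C).
Hypothesis D_lin : linear D.
Hypothesis Da : forall i w, (0 < i)%N ->
  D (a i w) = a i (D w) + (if i == n then c *: w else 0).
Hypothesis n_gt0 : (0 < n)%N.

(** Write S for the series. The hypotheses say [D, S] = c z^n with c a scalar, hence [D, S^k] = k c
    z^n S^(k-1). *)
Let ser_pow_comm k N w : D (ser_pow a k N w) =
  ser_pow a k N (D w) +
  (if (n <= N)%N then (k%:R * c) *: ser_pow a k.-1 (N - n) w else 0).
Proof.
elim: k N => [|k IH] N.
  rewrite /= mul0r scale0r if_same addr0.
  by case: eqP => // _; rewrite (lin0 D_lin).
rewrite [ser_pow a k.+1 N w]/= (lin_sum D_lin).
rewrite (eq_big_nat _ _ (F2 := fun i => a i (ser_pow a k (N - i) (D w)) +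
  (a i (if (n <= N - i)%N then (k%:R * c) *: ser_pow a k.-1 (N - i - n) w else 0)
   + (if i == n then c *: ser_pow a k (N - i) w else 0)))); last first.
  by move=> i /andP[i1 _]; rewrite Da // IH (linD (a_lin i)) -addrA.
rewrite big_split /=; congr (_ + _).
rewrite big_split /=; case: ifPn => [nN|]; last first.
  rewrite -ltnNge => Nn; rewrite !big_nat !big1 ?addr0 // => i /andP[i1 iN].
    by case: eqP => // ?; lia.
  rewrite ifF ?(lin0 (a_lin i)) //; apply/negbTE; lia.
(* Of the k + 1 copies, k come from the induction hypothesis and one from commuting [D] past the
   outermost factor. *)
rewrite -[k.+1%:R]natr1 mulrDl mul1r scalerDl; congr (_ + _); last first.
  rewrite (bigD1_seq n) ?iota_uniq ?mem_index_iota ?n_gt0 //=.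
  by rewrite eqxx big1 ?addr0 // => i /negPf ->.
case: k IH => [|k] IH.
  rewrite mul0r scale0r big1 // => i _.
  by rewrite scale0r if_same (lin0 (a_lin i)).
rewrite [k.+1.-1]/= [ser_pow a k.+1 _ w]/= scaler_sumr.
rewrite (big_cat_nat (n := (N - n).+1)) //=; last by lia.
rewrite -[RHS]addr0; congr (_ + _); last first.
  rewrite big_nat big1 // => i /andP[i1 iN].
  rewrite ifF ?(lin0 (a_lin i)) //.
  by apply/negbTE; lia.
apply: eq_big_nat => i /andP[i1 iN].
rewrite ifT; last by lia.
by rewrite (linZ (a_lin i)) -subnDA addnC subnDA.
Qed.

(** D exp(S) = exp(S) (D + c z^n): dividing by k! turns the factor k into the previous term of the
    exponential. *)
Lemma ser_exp_comm N w : D (ser_exp a N w) =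
  ser_exp a N (D w) + (if (n <= N)%N then c *: ser_exp a (N - n) w else 0).
Proof.
rewrite /ser_exp (lin_sum D_lin).
under eq_bigr => k _ do rewrite (linZ D_lin) ser_pow_comm scalerDr.
rewrite big_split /=; congr (_ + _); case: ifPn => nN; last first.
  by rewrite big1 // => i _; rewrite scaler0.
rewrite big_ord_recl mul0r scale0r scaler0 add0r -/(ser_exp _ _ _).
rewrite (@ser_exp_widen N); last by lia.
rewrite scaler_sumr; apply: eq_bigr => k _.
by rewrite !scalerA lift0 mulrA inv_factS mulrC.
Qed.

End Commutator.

Section Euler.
Hypothesis aC : forall i j w, (0 < i)%N -> (0 < j)%N -> a i (a j w) = a j (a i w).

Let triangle (F : nat -> nat -> W) N :
  \sum_(1 <= i < N.+1) \sum_(1 <= j < (N - i).+1) F i j =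
  \sum_(1 <= j < N.+1) \sum_(1 <= i < (N - j).+1) F i j.
Proof.
have widen (G : nat -> W) i : (1 <= i)%N ->
    \sum_(1 <= j < (N - i).+1) G j = \sum_(1 <= j < N.+1 | (i + j <= N)%N) G j.
  move=> i1; rewrite (big_nat_widen _ _ N.+1); last by lia.
  rewrite big_nat_cond [RHS]big_nat_cond; apply: eq_bigl => j /=.
  by apply/idP/idP; lia.
rewrite (eq_big_nat _ _ (F2 := fun i => \sum_(1 <= j < N.+1 | (i + j <= N)%N) F i j));
  last first.
  by move=> i /andP[i1 _]; rewrite widen.
rewrite [RHS](eq_big_nat _ _ (F2 := fun j =>
  \sum_(1 <= i < N.+1 | (i + j <= N)%N) F i j)); last first.
  move=> j /andP[j1 _]; rewrite (widen (F^~ j)) //; apply: eq_bigl => i.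
  by rewrite addnC.
by rewrite (exchange_big_dep xpredT).
Qed.

(** The Euler operator on a power: z d/dz S^k = k (z S') S^(k-1), because the coefficients of S
    commute. *)
Let ser_pow_euler k N w : N%:R *: ser_pow a k N w =
  k%:R *: \sum_(1 <= i < N.+1) i%:R *: a i (ser_pow a k.-1 (N - i) w).
Proof.
elim: k N => [|k IH] N.
  by rewrite /= scale0r; case: eqP => [->|_]; rewrite ?scale0r ?scaler0.
rewrite [ser_pow a k.+1 N w]/= [LHS]scaler_sumr.
rewrite (eq_big_nat _ _ (F2 := fun i => i%:R *: a i (ser_pow a k (N - i) w) +
  k%:R *: \sum_(1 <= j < (N - i).+1)
     a i (j%:R *: a j (ser_pow a k.-1 (N - i - j) w)))); last first.
  move=> i /andP[i1 iN]; rewrite -(lin_sum (a_lin i)) -[k%:R *: a i _](linZ (a_lin i))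
    -IH.
  by rewrite (linZ (a_lin i)) -scalerDl -natrD subnKC //; lia.
rewrite big_split /= -[k.+1%:R]nat1r scalerDl scale1r; congr (_ + _).
rewrite -scaler_sumr triangle; case: k IH => [|k] IH; first by rewrite !scale0r.
congr (_ *: _); apply: eq_big_nat => j /andP[j1 jN].
rewrite [ser_pow a k.+1 _ w]/= (lin_sum (a_lin j)) scaler_sumr.
apply: eq_big_nat => i /andP[i1 iN].
by rewrite (linZ (a_lin i)) aC // subnAC.
Qed.

(** z d/dz exp(S) = (z S') exp(S). In characteristic zero this recursion determines all coefficients
    from the constant one. *)
Lemma ser_exp_euler N w : N%:R *: ser_exp a N w =
  \sum_(1 <= i < N.+1) i%:R *: a i (ser_exp a (N - i) w).
Proof.
rewrite [RHS](eq_big_nat _ _ (F2 := fun i => \sum_(k < N)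
    i%:R *: ((k`!%:R : C)^-1 *: a i (ser_pow a k (N - i) w)))); last first.
  move=> i /andP[i1 iN]; rewrite (@ser_exp_widen N); last by lia.
  rewrite (lin_sum (a_lin i)) scaler_sumr.
  by apply: eq_bigr => k _; rewrite (linZ (a_lin i)).
rewrite /ser_exp scaler_sumr exchange_big /=.
under eq_bigr => k _ do rewrite scalerA mulrC -scalerA ser_pow_euler.
rewrite big_ord_recl scale0r scaler0 add0r; apply: eq_bigr => k _.
rewrite lift0 scalerA inv_factS scaler_sumr; apply: eq_bigr => i _.
by rewrite /= !scalerA mulrC.
Qed.

End Euler.
End SerExp.

(** * Heisenberg modules and [M(1)] *)

Section HeisenbergModules.
Variables (C : numFieldType) (h : vectType C) (form : {symmetric h}).

Lemma form_linl v : linear (fun u => form u v : C^o).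
Proof. by move=> a x y /=; rewrite linearPl. Qed.

Lemma formC u v : form u v = form v u.
Proof. by rewrite hermC expr0 mul1r. Qed.

Lemma formDl u v w : form (u + v) w = form u w + form v w.
Proof. exact: (linD (form_linl w)). Qed.

Lemma formZl a u w : form (a *: u) w = a * form u w.
Proof. exact: (linZ (form_linl w)). Qed.

Lemma formNl u w : form (- u) w = - form u w.
Proof. exact: (linN (form_linl w)). Qed.

Lemma form0l w : form 0 w = 0.
Proof. exact: (lin0 (form_linl w)). Qed.

Lemma formDr u v w : form w (u + v) = form w u + form w v.
Proof. by rewrite !(formC w) formDl. Qed.

Lemma formNr u w : form w (- u) = - form w u.
Proof. by rewrite !(formC w) formNl. Qed.

Lemma form0r w : form w 0 = 0.
Proof. by rewrite formC form0l. Qed.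

Definition heis (U : lmodType C) (act : h -> int -> U -> U) : Prop :=
  [/\ forall u n, linear (act u n), forall n w, linear (fun u => act u n w) &
      forall u v m n w, act u m (act v n w) = act v n (act u m w) +
        (if m + n == 0 then m%:~R * form u v else 0) *: w].

Variables (U : lmodType C) (act : h -> int -> U -> U).
Hypothesis act_heis : heis act.

Lemma act_lin u n : linear (act u n).
Proof. by case: act_heis. Qed.

Lemma act_linl n w : linear (fun u => act u n w).
Proof. by case: act_heis. Qed.

Lemma actC u v m n w : act u m (act v n w) = act v n (act u m w) +
        (if m + n == 0 then m%:~R * form u v else 0) *: w.
Proof. by case: act_heis. Qed.

Lemma actC0 u v m n w : m + n != 0 -> act u m (act v n w) = act v n (act u m w).
Proof. by move=> mn; rewrite actC (negPf mn) scale0r addr0. Qed.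

Lemma actNl u n w : act (- u) n w = - act u n w.
Proof. exact: (linN (act_linl n w)). Qed.

Lemma act0l n w : act 0 n w = 0.
Proof. exact: (lin0 (act_linl n w)). Qed.

Lemma act0 u n : act u n 0 = 0.
Proof. exact: lin0 (act_lin u n). Qed.

Let cm (a : h) (n : nat) (w : U) : U := (- n%:R : C)^-1 *: act a (- n%:Z) w.
Let cp (a : h) (n : nat) (w : U) : U := (n%:R : C)^-1 *: act a n%:Z w.

Let scale_act_lin (c : C) a m : linear (fun w => c *: act a m w).
Proof. by move=> k x y; rewrite act_lin scalerDr !scalerA mulrC. Qed.

Let cm_lin a n : linear (cm a n). Proof. exact: scale_act_lin. Qed.
Let cp_lin a n : linear (cp a n). Proof. exact: scale_act_lin. Qed.

Lemma Eminus_lin a k : linear (Eminus act a k).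
Proof.
move=> c x y; rewrite /Eminus; case: ifP => _; first exact: (ser_exp_lin (cm_lin a)).
by rewrite scaler0 addr0.
Qed.

Lemma Eplus_lin a k : linear (Eplus act a k).
Proof.
move=> c x y; rewrite /Eplus; case: ifP => _; first exact: (ser_exp_lin (cp_lin a)).
by rewrite scaler0 addr0.
Qed.

Lemma Eminus_lt0 a k w : k < 0 -> Eminus act a k w = 0.
Proof. by rewrite /Eminus ltNge => /negPf ->. Qed.

Lemma Eplus_gt0 a k w : 0 < k -> Eplus act a k w = 0.
Proof. by rewrite /Eplus ltNge => /negPf ->. Qed.

Lemma Eminus0 a w : Eminus act a 0 w = w.
Proof. exact: ser_exp0. Qed.

Lemma Eplus0 a w : Eplus act a 0 w = w.
Proof. exact: ser_exp0. Qed.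

Lemma Eminus_act_le0 a k v m w : m <= 0 ->
  act v m (Eminus act a k w) = Eminus act a k (act v m w).
Proof.
move=> m0; rewrite /Eminus; case: ifP => _; last exact: act0.
apply: ser_exp_intertwine => [|i w' i0]; first exact: act_lin.
by rewrite (linZ (act_lin v m)) actC0 //; apply/eqP; lia.
Qed.

Lemma Eplus_act_ge0 a k v m w : 0 <= m ->
  act v m (Eplus act a k w) = Eplus act a k (act v m w).
Proof.
move=> m0; rewrite /Eplus; case: ifP => _; last exact: act0.
apply: ser_exp_intertwine => [|i w' i0]; first exact: act_lin.
by rewrite (linZ (act_lin v m)) actC0 //; apply/eqP; lia.
Qed.

(** The exponent S of E^+(-a,x) satisfies [v(-m), S] = <v,a> x^(-m), so v(-m) passes through with
    the correction <v,a> x^(-m) E^+(-a,x). *)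
Lemma Eplus_act a k v (m : nat) w : (0 < m)%N ->
  act v (- m%:Z) (Eplus act (- a) k w) =
  Eplus act (- a) k (act v (- m%:Z) w) +
  form v a *: Eplus act (- a) (k + m%:Z) w.
Proof.
move=> m0; have [k0|k0] := boolP (k <= 0); last first.
  by rewrite !Eplus_gt0 ?act0 ?scaler0 ?addr0 //; lia.
rewrite /Eplus k0 (ser_exp_comm (cp_lin (- a)) (n := m) (c := form v a)) //.
- congr (_ + _); rewrite (_ : (m <= `|k|)%N = (k + m%:Z <= 0)); last by lia.
  case: ifP => km; rewrite ?scaler0 //; congr (_ *: ser_exp _ _ _); lia.
- exact: act_lin.
move=> i w' i0; rewrite /cp (linZ (act_lin v _)) actC scalerDr; congr (_ + _).
rewrite (_ : (- m%:Z + i%:Z == 0) = (i == m)); last by apply/eqP/eqP; lia.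
case: eqP => [->|]; last by rewrite scale0r scaler0.
rewrite scalerA formNr; congr (_ *: _).
by rewrite intrN -pmulrn; field; rewrite pnatr_eq0; lia.
Qed.

Lemma Eplus_vac a k w : (forall i : nat, (0 < i)%N -> act a i w = 0) ->
  Eplus act (- a) k w = if k == 0 then w else 0.
Proof.
move=> aw0; rewrite /Eplus; case: ifPn => [k0|]; last by case: eqP => [->|].
rewrite ser_exp_vac; first by rewrite absz_eq0.
  exact: cp_lin.
by move=> i i0; rewrite actNl aw0 // oppr0 scaler0.
Qed.

Lemma Eminus_eq0 k w : Eminus act (- 0) k w = if k == 0 then w else 0.
Proof.
rewrite /Eminus; case: ifPn => [k0|]; last by case: eqP => [->|].
rewrite ser_exp_vac; first by rewrite absz_eq0.
  exact: cm_lin.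
by move=> i i0; rewrite oppr0 act0l scaler0.
Qed.

(** The exponent of E^-(-a,x) is the sum of a(-n) x^n / n, whose image under x d/dx is the sum of
    a(-n) x^n. *)
Lemma Eminus_euler a (N : nat) w : N%:R *: Eminus act (- a) N w =
  \sum_(1 <= i < N.+1) act a (- i%:Z) (Eminus act (- a) (N - i)%N w).
Proof.
rewrite /Eminus lez_nat leq0n /=.
rewrite (ser_exp_euler (cm_lin (- a))); last first.
  move=> i j w' i0 j0; rewrite /cm !(linZ (act_lin _ _)) actC0; last by apply/eqP; lia.
  by rewrite !scalerA mulrC.
apply: eq_big_nat => i /andP[i1 iN]; rewrite /cm actNl.
rewrite !scalerN scalerA -scaleNr -[RHS]scale1r; congr (_ *: _).
by field; rewrite pnatr_eq0; lia.
Qed.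

Lemma Eminus_closed (S : {pred U}) a k w : submod_closed S ->
  (forall m v, m < 0 -> v \in S -> act a m v \in S) ->
  w \in S -> Eminus act a k w \in S.
Proof.
move=> S_sub aS wS; rewrite /Eminus; case: ifP => _; last exact: smc0.
apply: ser_exp_closed => // i v i0 vS; apply: smcZ => //; apply: aS => //; lia.
Qed.

End HeisenbergModules.

Lemma Eminus_intertwine (C : numFieldType) (h : vectType C) (U U' : lmodType C)
  (act : h -> int -> U -> U) (act' : h -> int -> U' -> U') (f : U -> U') a k w :
  linear f -> (forall m v, m < 0 -> f (act a m v) = act' a m (f v)) ->
  f (Eminus act a k w) = Eminus act' a k (f w).
Proof.
move=> f_lin fa; rewrite /Eminus; case: ifP => _; last exact: lin0.
apply: ser_exp_intertwine => // i v i0; rewrite (linZ f_lin) fa //; lia.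
Qed.

Section EplusFinite.
Variables (C : numFieldType) (h : vectType C) (form : {symmetric h}).
Variables (U : lmodType C) (act : h -> int -> U -> U).
Hypothesis act_heis : heis form act.
Variable a : h.

(** What the construction uses of local nilpotency: E^+(-a,x) w is a polynomial in x^(-1). In this
    form the condition cuts out a subspace stable under creation operators, so it can be checked on
    generators. *)
Definition Eplus_finite : {pred U} :=
  fun w => `[< ev (fun j => Eplus act (- a) (- j%:Z) w = 0) >].

Lemma Eplus_finite_submod : submod_closed Eplus_finite.
Proof.
split=> [|c u v /asboolP evu /asboolP evv]; apply/asboolP.
  by exists 0%N => j _; exact: (lin0 (Eplus_lin act_heis _ _)).
apply: ev_imp (ev_and evu evv) => j [uj vj].
by rewrite (Eplus_lin act_heis) uj vj scaler0 addr0.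
Qed.

Lemma Eplus_finite_act v (m : int) w : m < 0 ->
  w \in Eplus_finite -> act v m w \in Eplus_finite.
Proof.
move=> m0 /asboolP evw; apply/asboolP.
apply: ev_imp (ev_and (ev_shift `|m| evw) (ev_and (ev_ge `|m|) evw)).
move=> j [w1 [mj w2]].
(* By this identity the coefficient -j on the new vector involves only the coefficients -j and -(j -
   |m|) on [w]. *)
have := Eplus_act act_heis a (- j%:Z) v w (m := `|m|%N).
rewrite (_ : - `|m|%N%:Z = m); last by lia.
rewrite w2 (act0 act_heis) => /(_ ltac:(lia))/esym/eqP.
rewrite (_ : - j%:Z + `|m|%N = - (j - `|m|)%N%:Z) ?w1; last by lia.
by rewrite scaler0 addr0 => /eqP.
Qed.

End EplusFinite.

Section M1Theory.
Variables (C : numFieldType) (h : vectType C) (form : {symmetric h}).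
Local Notation M1 := (M1 form).
Local Notation M1_act := (@M1_act C h form).
Local Notation words := (words h).
Local Notation pi := (@M1_pi C h form).

Definition consw u n (f : words) : words :=
  mk_ffs (fun s => if s is p :: s' then if p == (u, n) then f s' else 0 else 0).

Lemma conswE u n (f : words) s : consw u n f s =
  if s is p :: s' then if p == (u, n) then f s' else 0 else 0.
Proof.
have [r [_ f0]] := ffs_supp f.
rewrite /consw (@mk_ffsE _ _ _ _ (map (cons (u, n)) r)) //.
move=> [//|p s'] sr; case: eqP => // pE; apply: f0.
by apply: contraNN sr => s'r; rewrite pE map_f.
Qed.

Lemma consw_lin u n : linear (consw u n).
Proof.
move=> a f g; apply: ffs_ext => s; rewrite ffsDE ffsZE !conswE.
case: s => [|p s]; first by rewrite scaler0 addr0.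
by case: eqP; rewrite // scaler0 addr0.
Qed.

Lemma consw_word u n s : consw u n (word s) = word ((u, n) :: s).
Proof.
apply: ffs_ext => -[|p s']; rewrite conswE singleE // singleE.
by rewrite eqseq_cons; case: eqP.
Qed.

Lemma pi_lin : linear pi.
Proof. by move=> a f g; rewrite M1_piD M1_piZ. Qed.

Lemma pi_eq0 f : (pi f = 0) <-> (f \in M1_rel form).
Proof.
rewrite -[X in _ = X](lin0 pi_lin); split=> [/eqP|fR]; first by rewrite M1_piE subr0.
by apply/eqP; rewrite M1_piE subr0.
Qed.

Lemma M1_rel_relator f : M1_relator form f -> f \in M1_rel form.
Proof. by move=> fR; apply/asboolP => S _; apply. Qed.

(** Relators of the first two kinds allow any left context, and those of the third kind constrain
    only the last letter; hence prefixing a letter descends to the quotient. *)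
Lemma M1_rel_cons u n f : f \in M1_rel form -> consw u n f \in M1_rel form.
Proof.
move=> /asboolP fR.
apply: (fR (fun g => consw u n g \in M1_rel form)).
  have R_sub := M1_rel_submod form; split=> [|a f1 f2 R1 R2].
    by rewrite -topredE /= (lin0 (consw_lin u n)); apply: smc0.
  rewrite -topredE /= consw_lin; apply: smcD => //; exact: smcZ.
move=> g gR; apply: M1_rel_relator; have cD := consw_lin u n.
case: gR => [[s [t [a [v [w [m ->]]]]]]|[[s [t [v [w [k [m ->]]]]]]|]].
- left; exists ((u, n) :: s), t, a, v, w, m.
  by rewrite !(linB cD) (linZ cD) !consw_word.
- right; left; exists ((u, n) :: s), t, v, w, k, m.
  by rewrite !(linB cD) (linZ cD) !consw_word.
move=> [s [v [m [m0 ->]]]]; right; right; exists ((u, n) :: s), v, m.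
by rewrite consw_word.
Qed.

Lemma M1_act_pi u n f : M1_act u n (pi f) = pi (consw u n f).
Proof.
apply/eqP; rewrite M1_piE -(linB (consw_lin u n)); apply: M1_rel_cons.
by rewrite -M1_piE M1_piK.
Qed.

Lemma M1_word_ind (S : {pred M1}) : submod_closed S ->
  (forall s, pi (word s) \in S) -> forall x, x \in S.
Proof.
move=> S_sub Sw x; rewrite -(M1_piK x).
elim/ffs_ind: (M1_repr x) => [|f g fS gS|s c].
- by rewrite (lin0 pi_lin); apply: smc0.
- by rewrite (linD pi_lin); apply: smcD.
rewrite (_ : single s c = c *: word s).
  by rewrite (linZ pi_lin); apply: smcZ.
by rewrite -(linZ (@single_lin _ _ _ s)) /GRing.scale /= mulr1.
Qed.

Lemma M1_act_word u n s : M1_act u n (pi (word s)) = pi (word ((u, n) :: s)).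
Proof. by rewrite M1_act_pi consw_word. Qed.

Lemma M1_lin u n : linear (M1_act u n).
Proof.
move=> a x y; rewrite -(M1_piK x) -(M1_piK y) -pi_lin !M1_act_pi.
by rewrite consw_lin pi_lin.
Qed.

Lemma M1_heis : heis form M1_act.
Proof.
have ML := M1_lin; split=> // [n x a u v|u v m n x].
  pose S : {pred M1} := fun x =>
    M1_act (a *: u + v) n x == a *: M1_act u n x + M1_act v n x.
  suff : x \in S by move/eqP.
  apply: M1_word_ind => [|s].
    split=> [|c y z /eqP yS /eqP zS]; apply/eqP.
      by rewrite !(lin0 (ML _ _)) scaler0 addr0.
    by rewrite !ML yS zS !scalerDr !scalerA mulrC addrACA.
  apply/eqP; rewrite !M1_act_word -(linZ pi_lin) -(linD pi_lin).
  apply/eqP; rewrite M1_piE opprD addrA.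
  by apply: M1_rel_relator; left; exists [::], s, a, u, v, n.
set c := if _ then _ else _.
pose S : {pred M1} := fun x =>
  M1_act u m (M1_act v n x) == M1_act v n (M1_act u m x) + c *: x.
suff : x \in S by move/eqP.
apply: M1_word_ind => [|s].
  split=> [|b y z /eqP yS /eqP zS]; apply/eqP.
    by rewrite !(lin0 (ML _ _)) scaler0 addr0.
  by rewrite !ML yS zS !scalerDr !scalerA mulrC addrACA.
apply/eqP; rewrite !M1_act_word -(linZ pi_lin) -(linD pi_lin).
apply/eqP; rewrite M1_piE opprD addrA; apply: M1_rel_relator; right; left.
by exists [::], s, u, v, m, n.
Qed.

Lemma M1_act_vac u n : 0 <= n -> M1_act u n (M1_vac form) = 0.
Proof.
move=> n0; rewrite /M1_vac M1_act_word; apply/pi_eq0.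
by apply: M1_rel_relator; right; right; exists [::], u, n.
Qed.

(** The spanning half of Poincare-Birkhoff-Witt: the span of creation operators applied to the
    vacuum is also stable under the nonnegative modes, so it contains all words. *)
Lemma M1_ind (S : {pred M1}) : submod_closed S -> M1_vac form \in S ->
  (forall u n x, n < 0 -> x \in S -> M1_act u n x \in S) -> forall x, x \in S.
Proof.
move=> S_sub vacS actS.
(* [S] itself is not known to be stable under nonnegative modes, so the argument runs with the
   smallest subspace satisfying the same hypotheses. *)
pose span : {pred M1} := fun x => `[< forall S : {pred M1}, submod_closed S ->
  M1_vac form \in S ->
  (forall u n x, n < 0 -> x \in S -> M1_act u n x \in S) -> x \in S >].
suff spanT x : x \in span by move=> x; have /asboolP := spanT x; apply.
have span_sub : submod_closed span.
  split=> [|a y z /asboolP yP /asboolP zP]; apply/asboolP=> T T_sub Tv Ta.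
    exact: smc0.
  by apply: smcD => //; [apply: smcZ => //; apply: yP|apply: zP].
have span_vac : M1_vac form \in span by apply/asboolP.
have span_neg u n y : n < 0 -> y \in span -> M1_act u n y \in span.
  move=> n0 /asboolP yP; apply/asboolP=> T T_sub Tv Ta.
  by apply: (Ta) => //; apply: yP.
have span_nneg u n y : 0 <= n -> y \in span -> M1_act u n y \in span.
  move=> n0 /asboolP yP.
  (* Both properties are carried at once: commuting a nonnegative mode past v(k) leaves a scalar
     multiple of the vector itself. *)
  pose T : {pred M1} := fun y => (y \in span) &&
     `[< forall u n, 0 <= n -> M1_act u n y \in span >].
  suff /andP[_ /asboolP] : y \in T by apply.
  apply: yP => [||v k z k0 /andP[zs /asboolP zP]].
  - split=> [|a z z' /andP[zs /asboolP zP] /andP[z's /asboolP z'P]]; apply/andP.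
      split; first exact: smc0.
      by apply/asboolP => v k _; rewrite (lin0 (M1_lin v k)); apply: smc0.
    split; first by apply: smcD => //; apply: smcZ.
    apply/asboolP => v k k0; rewrite M1_lin.
    by apply: smcD; rewrite ?z'P //; apply: smcZ; rewrite ?zP.
  - apply/andP; split=> //; apply/asboolP => v k k0.
    by rewrite M1_act_vac //; apply: smc0.
  apply/andP; split; first exact: span_neg.
  apply/asboolP => w l l0; rewrite (actC M1_heis).
  apply: smcD => //; last exact: smcZ.
  by apply: span_neg => //; apply: zP.
apply: (M1_word_ind span_sub) => s; elim: s => [|[u n] s IH]; first exact: span_vac.
rewrite -M1_act_word; have [n0|n0] := ltP n 0; [exact: span_neg|exact: span_nneg].
Qed.

Lemma M1_act0 u x : M1_act u 0 x = 0.
Proof.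
pose S : {pred M1} := fun x => M1_act u 0 x == 0.
suff : x \in S by move/eqP.
apply: M1_ind => [||v n y n0 /eqP yS].
- split=> [|a y z /eqP yS /eqP zS]; apply/eqP; first exact: lin0 (M1_lin _ _).
  by rewrite M1_lin yS zS scaler0 addr0.
- by apply/eqP; apply: M1_act_vac.
apply/eqP; rewrite (actC0 M1_heis) ?yS ?(lin0 (M1_lin _ _)) //.
by apply/eqP; lia.
Qed.

Lemma M1_Eplus_finite a x : x \in Eplus_finite M1_act a.
Proof.
apply: M1_ind => [||v n y n0]; first exact: (Eplus_finite_submod M1_heis).
  apply/asboolP; exists 1%N => j j1; rewrite (Eplus_vac M1_heis).
    by rewrite ifF //; apply/negbTE/eqP; lia.
  by move=> i _; apply: M1_act_vac.
exact: (Eplus_finite_act M1_heis).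
Qed.

End M1Theory.

(** * Vertex modules and the lattice vertex operators *)

Section VertexModules.
Variables (C : numFieldType) (V : lmodType C) (vac : V) (Y : V -> int -> V -> V).
Variables (W : lmodType C) (YW : V -> int -> W -> W).
Hypothesis YW_mod : is_va_module vac Y YW.

Lemma vm_lin v n : linear (YW v n).
Proof. by case: YW_mod. Qed.

Lemma vm_linl n w : linear (fun v => YW v n w).
Proof. by case: YW_mod => _ []. Qed.

Lemma vm_trunc v w : exists N : int, forall n, N <= n -> YW v n w = 0.
Proof. by case: YW_mod => _ [_ []]. Qed.

Lemma vm_trunc_ev v w (m : int) : ev (fun N => forall n : int,
  m + N%:Z <= n -> YW v n w = 0).
Proof.
have [M M0] := vm_trunc v w; exists (`|M - m|)%N => N NM n mn.
by apply: M0; lia.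
Qed.

Lemma vm_vac n w : YW vac n w = if n == -1 then w else 0.
Proof. by case: YW_mod => _ [_ [_ []]]. Qed.

Lemma vm_jacobi u v w l m n N S :
  (forall i : nat, (N <= i)%N -> Y u (l + i%:Z) v = 0) ->
  (forall i : nat, (S <= i)%N -> YW v (n + i%:Z) w = 0) ->
  (forall i : nat, (S <= i)%N -> YW u (m + i%:Z) w = 0) ->
  \sum_(i < N) binomz C m i *: YW (Y u (l + i%:Z) v) (m + n - i%:Z) w =
  \sum_(i < S) ((-1) ^+ i * binomz C l i) *:
       (YW u (m + l - i%:Z) (YW v (n + i%:Z) w)
        - (-1) ^ l *: YW v (n + l - i%:Z) (YW u (m + i%:Z) w)).
Proof.
move=> N0 S0 S0'; case: YW_mod => _ [_ [_ [_ /(_ u v w l m n)]]].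
rewrite (@fsum_nat _ _ N) => [|i Ni]; last first.
  by rewrite N0 // (lin0 (vm_linl _ _)) scaler0.
rewrite (@fsum_nat _ _ S) // => i Si.
by rewrite S0 // S0' // !(lin0 (vm_lin _ _)) scaler0 subr0 scaler0.
Qed.

(** The case m = 0 of the Jacobi identity, where only i = 0 survives on the left, as binom(0,i) = 0
    for i > 0. *)
Lemma vm_iterate u v w l n S :
  (forall i : nat, (S <= i)%N -> YW v (n + i%:Z) w = 0) ->
  (forall i : nat, (S <= i)%N -> YW u i%:Z w = 0) ->
  (exists N, forall i : nat, (N <= i)%N -> Y u (l + i%:Z) v = 0) ->
  YW (Y u l v) n w =
  \sum_(i < S) ((-1) ^+ i * binomz C l i) *:
       (YW u (l - i%:Z) (YW v (n + i%:Z) w)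
        - (-1) ^ l *: YW v (n + l - i%:Z) (YW u i%:Z w)).
Proof.
move=> S0 S0' [N N0].
have := @vm_jacobi u v w l 0 n N.+1 S.
rewrite big_ord_recl big1 => [|i _]; last by rewrite binomz_0S scale0r.
rewrite binomz_l0 scale1r subr0 !addr0 add0r => -> //.
- by apply: eq_bigr => i _; rewrite !add0r.
by move=> i Ni; apply: N0; lia.
Qed.

(** The case l = 0 of the Jacobi identity, where only i = 0 survives on the right. *)
Lemma vm_comm N u v w m n :
  (forall i : nat, (N <= i)%N -> Y u i%:Z v = 0) ->
  YW u m (YW v n w) = YW v n (YW u m w) +
    \sum_(i < N) binomz C m i *: YW (Y u i%:Z v) (m + n - i%:Z) w.
Proof.
move=> N0; have [S [Sv Su]] :=
  ev_witness (ev_and (vm_trunc_ev v w n) (vm_trunc_ev u w m)).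
have := @vm_jacobi u v w 0 m n N S.+1.
rewrite [in RHS]big_ord_recl [in RHS]big1 => [|i _]; last first.
  by rewrite lift0 binomz_0S mulr0 scale0r.
rewrite binomz_l0 expr0 mulr1 scale1r expr0z scale1r !addr0.
under eq_bigr do rewrite add0r.
move=> ->; first by rewrite addrC subrK.
- by move=> i Ni; rewrite add0r N0.
- by move=> i Si; apply: Sv; lia.
by move=> i Si; apply: Su; lia.
Qed.

(** In the Jacobi identity with [l = -2] and [n = 0] all modes of [vac] on the
    right-hand side have index different from [-1]. *)
Lemma vm_deriv u w n : (forall i : nat, (2 <= i)%N -> Y u (-2 + i%:Z) vac = 0) ->
  YW (Y u (-2) vac) n w = - n%:~R *: YW (Y u (-1) vac) (n - 1) w.
Proof.
move=> u0; have [S Su] := ev_witness (vm_trunc_ev u w n).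
have vac0 k x : k != -1 -> YW vac k x = 0 by move=> k1; rewrite vm_vac (negPf k1).
have vac0S (i : nat) : (S <= i)%N -> YW vac (0 + i%:Z) w = 0.
  by move=> _; apply: vac0; apply/eqP; lia.
have Su' (i : nat) : (S <= i)%N -> YW u (n + i%:Z) w = 0.
  by move=> Si; apply: Su; lia.
have := @vm_jacobi u vac w (-2) n 0 2 S u0.
rewrite [RHS]big1 => [|i _]; last first.
  by rewrite !vac0 ?(lin0 (vm_lin _ _)) ?scaler0 ?subr0 ?scaler0 //; apply/eqP; lia.
rewrite big_ord_recl big_ord1 binomz_l0 binomz_l1 scale1r /= !addr0.
move=> /(_ vac0S Su')/eqP.
by rewrite addr_eq0 scaleNr => /eqP.
Qed.

(** All modes of [u] on [v] beyond l vanish, so the left side of the Jacobi identity is a single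
    term. *)
Lemma vm_prod u v w l m n S :
  (forall i : nat, (1 <= i)%N -> Y u (l + i%:Z) v = 0) ->
  (forall i : nat, (S <= i)%N -> YW v (n + i%:Z) w = 0) ->
  (forall i : nat, (S <= i)%N -> YW u (m + i%:Z) w = 0) ->
  YW (Y u l v) (m + n) w =
  \sum_(i < S) ((-1) ^+ i * binomz C l i) *:
       (YW u (m + l - i%:Z) (YW v (n + i%:Z) w)
        - (-1) ^ l *: YW v (n + l - i%:Z) (YW u (m + i%:Z) w)).
Proof.
move=> N0 S0 S0'; rewrite -(@vm_jacobi _ _ _ _ _ _ 1) // big_ord1 binomz_l0 scale1r.
by rewrite !addr0.
Qed.

(** With u_l v = c 1 and m + n = -1 the left side becomes c w, because the mode -1 of the vacuum is
    the identity; the right side vanishes termwise. *)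
Lemma vm_prod_vac u v w l m n c :
  (forall i : nat, (1 <= i)%N -> Y u (l + i%:Z) v = 0) -> Y u l v = c *: vac ->
  m + n = -1 ->
  (forall i : nat, YW v (n + i%:Z) w = 0) ->
  (forall i : nat, YW u (m + i%:Z) w = 0) -> c *: w = 0.
Proof.
move=> N0 uv mn v0 u0; have := @vm_prod u v w l m n 0 N0 (fun i _ => v0 i) (fun i _ =>
  u0 i).
by rewrite big_ord0 uv mn (linZ (vm_linl _ _)) vm_vac eqxx.
Qed.

End VertexModules.

Section Delta.
Variables (C : numFieldType) (h : vectType C) (form : {symmetric h}).
Variables (U : lmodType C) (act : h -> int -> U -> U).
Hypothesis act_heis : heis form act.

(** The factor (-x)^(a(0)) becomes (-x)^c: it shifts the exponent by c, and its sign merges with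
    that of E^+(-a,-x). *)
Lemma Delta_scalar (a : h) (c k : int) w : (forall v, act a 0 v = c%:~R *: v) ->
  Delta act a k w = (-1) ^ k *: Eplus act (- a) (k - c) w.
Proof.
move=> ac; rewrite /Delta (fsum_one (i0 := c)); last first.
  by move=> m mc; rewrite (eigen_comp_scalar _ _ ac) (negPf mc) scaler0.
rewrite (eigen_comp_scalar _ _ ac) eqxx scalerA -expfzDr;
  last by rewrite oppr_eq0 oner_eq0.
by congr ((-1) ^ _ *: _); lia.
Qed.

End Delta.

Section LatticeVertexOperators.
Variables (C : numFieldType) (h : vectType C) (form : {symmetric h}).
Variables (L : zmodClosed h) (eps : lat L -> lat L -> C).
Variables (YM : M1 form -> int -> M1 form -> M1 form).
Variables (U : lmodType C) (act : h -> int -> U -> U) (YU : M1 form -> int -> U -> U).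
Hypothesis act_heis : heis form act.
Hypothesis YU_mod : is_M1_module_of YM act YU.
Variable lam : h.
Hypothesis act0E : forall u w, act u 0 w = form lam u *: w.
Hypothesis lam_dual : dual_lattice form L lam.
Hypothesis act_fin : forall (a : lat L) w, w \in Eplus_finite act (lat_val a).

Local Notation M1_act := (@M1_act C h form).

Let YU_va : is_va_module (M1_vac form) YM YU. Proof. by case: YU_mod. Qed.

Lemma lat_weight (a : lat L) : form lam (lat_val a) = (int_of (form lam (lat_val
  a)))%:~R.
Proof. by have [k] := lam_dual a; rewrite formC => ->; rewrite int_of_intr. Qed.

(** The term of [lat_coef] with [x^i] from [E^-(-a,x)], [x^(-j)] from
    [Delta(b,x) v] and [x^(<lam,a> - m)] from [Delta(a,-x) w]; the signs of the
    two factors coming from [Delta(a,-x)] cancel. *)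
Definition box_term (a b : lat L) v w (n : int) (i j m : nat) : U :=
  (-1) ^+ j *: Eminus act (- lat_val a) i
    (YU (Eplus M1_act (- lat_val b) (- j%:Z) v)
      (n + int_of (form (lat_val a) (lat_val b)) + int_of (form lam (lat_val a))
        + i%:Z - j%:Z - m%:Z)
      (Eplus act (- lat_val a) (- m%:Z) w)).

Definition box (a b : lat L) v w (n : int) (N : nat) : U :=
  \sum_(i < N) \sum_(j < N) \sum_(m < N) box_term a b v w n i j m.

(** Finiteness of E^+ leaves finitely many j and m, and for these the truncation of Y_U bounds i.
    The cutoff is uniform in n >= n0, since later arguments need one box for several modes. *)
Lemma box_term_eq0 a b v w (n0 : int) : ev (fun N => forall n : int, n0 <= n ->
  forall i j m : nat, (N <= i)%N || (N <= j)%N || (N <= m)%N -> box_term a b v w n i j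
    m = 0).
Proof.
have /asboolP[J Jv] := M1_Eplus_finite (lat_val b) v.
have /asboolP[M Mw] := act_fin a w.
pose p := int_of (form (lat_val a) (lat_val b)).
pose c := int_of (form lam (lat_val a)).
have /ev_witness[I IJM] : ev (fun I => forall j, (j < J)%N -> forall m, (m < M)%N ->
    forall n : int, I%:Z <= n ->
    YU (Eplus M1_act (- lat_val b) (- j%:Z) v) n (Eplus act (- lat_val a) (- m%:Z) w) =
      0).
  apply: ev_all_lt => j; apply: ev_all_lt => m.
  have := vm_trunc_ev YU_va (Eplus M1_act (- lat_val b) (- j%:Z) v)
            (Eplus act (- lat_val a) (- m%:Z) w) 0.
  by apply: ev_imp => N N0 n Nn; apply: N0; rewrite add0r.
(* With j < J and m < M, an index i beyond this bound pushes the mode of Y_U above I. *)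
exists (I + J + M + `|(n0 + p + c)%R|)%N => N NI n n0n i j m; rewrite /box_term -/p -/c.
have [Jj _|jJ] := leqP J j.
  rewrite Jv // (lin0 (vm_linl YU_va _ _)) (lin0 (Eminus_lin act_heis _ _)).
  exact: scaler0.
have [Mm _|mM ijm] := leqP M m.
  by rewrite Mw // (lin0 (vm_lin YU_va _ _)) (lin0 (Eminus_lin act_heis _ _)) scaler0.
rewrite IJM ?(lin0 (Eminus_lin act_heis _ _)) ?scaler0 //; lia.
Qed.

Lemma lat_coef_term a b v w (n i j m : int) :
  let l : int := - n - 1 - int_of (form (lat_val a) (lat_val b)) - i - j - m in
  Eminus act (- lat_val a) i
      (YU (Delta M1_act (lat_val b) j v) (- l - 1)
          ((-1) ^ m *: Delta act (lat_val a) m w)) =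
  if [&& 0 <= i, j <= 0 & m <= int_of (form lam (lat_val a))] then
    box_term a b v w n `|i| `|j| `|int_of (form lam (lat_val a)) - m| else 0.
Proof.
move=> l; set c := int_of (form lam (lat_val a)).
rewrite (Delta_scalar (c := 0)); last by move=> x; rewrite M1_act0 scale0r.
rewrite subr0 (Delta_scalar (c := c)); last first.
  by move=> x; rewrite act0E {1}lat_weight.
rewrite (scalerA ((-1) ^ m)) exprz_sign scale1r (linZ (vm_linl YU_va _ _)).
rewrite (linZ (Eminus_lin act_heis _ _)).
have [i0|i0] := boolP (0 <= i); last first.
  by rewrite Eminus_lt0 ?scaler0 //; lia.
have [j0|j0] := boolP (j <= 0); last first.
  rewrite Eplus_gt0 ?(lin0 (vm_linl YU_va _ _)); last by lia.
  by rewrite (lin0 (Eminus_lin act_heis _ _)) scaler0.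
have [m0|m0] := boolP (m <= c); last first.
  rewrite (Eplus_gt0 act) ?(lin0 (vm_lin YU_va _ _)); last by lia.
  by rewrite (lin0 (Eminus_lin act_heis _ _)) scaler0.
rewrite /box_term -/c /=.
have -> : (-1) ^+ `|j| = (-1) ^ j :> C.
  have -> : j = - `|j|%N%:Z by lia.
  by rewrite -exprz_inv invrN1 abszN.
have -> : `|i|%N%:Z = i by lia.
have jE : `|j|%N%:Z = - j by lia.
have mE : `|c - m|%N%:Z = c - m by rewrite gez0_abs // subr_ge0.
rewrite jE mE opprK [- (c - m)]opprB; congr (_ *: Eminus _ _ _ (YU _ _ _)).
rewrite /l; set p := int_of (form (lat_val a) _); lia.
Qed.

(** The nonzero summands lie in the image of the box under (i, j, m) |-> (i, -j, c - m), which is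
    [g] below. *)
Lemma lat_coef_box a b v w (n0 : int) : ev (fun N => forall n : int, n0 <= n ->
  lat_coef act YU a b v w (- n - 1) = box a b v w n N).
Proof.
apply: ev_imp (box_term_eq0 a b v w n0) => N N0 n n0n.
set c := int_of (form lam (lat_val a)).
pose g (q : 'I_N * 'I_N * 'I_N) : int * int * int :=
  (q.1.1%:Z, - q.1.2%:Z, c - q.2%:Z).
rewrite /lat_coef (@fsum_seq _ _ [seq g q | q <- enum {: 'I_N * 'I_N * 'I_N}]).
- rewrite big_map big_enum /= /box.
  under [RHS]eq_bigr do rewrite pair_bigA /=.
  rewrite pair_bigA /=.
  rewrite (reindex (fun q : 'I_N * ('I_N * 'I_N) => (q.1, q.2.1, q.2.2))) /=;
    last first.
    by exists (fun q => (q.1.1, (q.1.2, q.2))) => [[i [j m]]|[[i j] m]].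
  apply: eq_bigr => -[i [j m]] _ /=; rewrite lat_coef_term -/c.
  rewrite ifT; last by apply/and3P; split; lia.
  by congr box_term; lia.
- rewrite map_inj_uniq ?enum_uniq // => -[[i j] m] [[i' j'] m'] [ii' jj' mm'].
  congr (_, _, _); apply: val_inj => /=; lia.
move=> [[i j] m] /negP ijm; rewrite lat_coef_term -/c.
case: ifP => // /and3P[i0 j0 m0]; apply: N0 => //.
apply: contraT; rewrite !negb_or -!ltnNge => /andP[/andP[iN jN] mN].
exfalso; apply: ijm; apply/mapP.
exists (Ordinal iN, Ordinal jN, Ordinal mN); first by rewrite mem_enum.
by rewrite /g /=; congr (_, _, _); lia.
Qed.

Lemma box_term_linr (a b : lat L) v n i j m : linear (fun w =>
  box_term a b v w n i j m).
Proof.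
move=> x y z; rewrite /box_term (Eplus_lin act_heis) (vm_lin YU_va) (Eminus_lin
  act_heis).
by rewrite scalerDr !scalerA mulrC.
Qed.

Lemma box_term_linl (a b : lat L) w n i j m : linear (fun v =>
  box_term a b v w n i j m).
Proof.
move=> x y z; rewrite /box_term (Eplus_lin (M1_heis form)) (vm_linl YU_va) (Eminus_lin
  act_heis).
by rewrite scalerDr !scalerA mulrC.
Qed.

Lemma box_linr (a b : lat L) v n N : linear (fun w => box a b v w n N).
Proof.
move=> x y z; rewrite /box scaler_sumr -big_split /=; apply: eq_bigr => i _.
rewrite scaler_sumr -big_split /=; apply: eq_bigr => j _.
rewrite scaler_sumr -big_split /=; apply: eq_bigr => m _.
exact: box_term_linr.
Qed.

Lemma box_linl (a b : lat L) w n N : linear (fun v => box a b v w n N).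
Proof.
move=> x y z; rewrite /box scaler_sumr -big_split /=; apply: eq_bigr => i _.
rewrite scaler_sumr -big_split /=; apply: eq_bigr => j _.
rewrite scaler_sumr -big_split /=; apply: eq_bigr => m _.
exact: box_term_linl.
Qed.

Lemma lat_coef_linr (a b : lat L) v k : linear (fun w => lat_coef act YU a b v w k).
Proof.
move=> x y z; have [N [[N1 N2] N3]] := ev_witness
  (ev_and (ev_and (lat_coef_box a b v (x *: y + z) (- k - 1))
                  (lat_coef_box a b v y (- k - 1)))
          (lat_coef_box a b v z (- k - 1))).
have -> : k = - (- k - 1) - 1 by lia.
by rewrite N1 // N2 // N3 // box_linr.
Qed.

Lemma lat_coef_linl (a b : lat L) w k : linear (fun v => lat_coef act YU a b v w k).
Proof.
move=> x y z; have [N [[N1 N2] N3]] := ev_witness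
  (ev_and (ev_and (lat_coef_box a b (x *: y + z) w (- k - 1))
                  (lat_coef_box a b y w (- k - 1)))
          (lat_coef_box a b z w (- k - 1))).
have -> : k = - (- k - 1) - 1 by lia.
by rewrite N1 // N2 // N3 // box_linl.
Qed.

(** [latY] is curried into two universal lifts, whence its bilinearity and its value on [single]
    elements. *)
Let latY2 (n : int) (g : latV L U) (a : lat L) (v : M1 form) : latV L U :=
  ffs_lift (fun b w => single (a + b) (eps a b *: lat_coef act YU a b v w (- n - 1))) g.

Let latY2_linr n a v b : linear (fun w =>
  single (a + b) (eps a b *: lat_coef act YU a b v w (- n - 1)) : latV L U).
Proof.
move=> x y z; rewrite lat_coef_linr scalerDr scalerA [_ * x]mulrC -scalerA.
exact: single_lin.
Qed.

Let latY2_seq n (g : latV L U) a v (r : seq (lat L)) :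
  uniq r -> (forall b, b \notin r -> g b = 0) -> latY2 n g a v =
  \sum_(b <- r) single (a + b) (eps a b *: lat_coef act YU a b v (g b) (- n - 1)).
Proof. exact: (ffs_lift_seq (latY2_linr n a v)). Qed.

Let latY2_linl n (g : latV L U) a : linear (latY2 n g a).
Proof.
move=> x y z; have [r [r_uniq g0]] := ffs_supp g.
rewrite (latY2_seq n a (x *: y + z) r_uniq g0) (latY2_seq n a y r_uniq g0).
rewrite (latY2_seq n a z r_uniq g0) scaler_sumr -big_split /=.
apply: eq_bigr => b _; rewrite lat_coef_linl scalerDr scalerA [_ * x]mulrC -scalerA.
exact: single_lin.
Qed.

Let latYE (f : latV L (M1 form)) n (g : latV L U) : latY eps act YU f n g = ffs_lift
  (latY2 n g) f.
Proof.
have [r [r_uniq f0]] := ffs_supp f; have [r' [r'_uniq g0]] := ffs_supp g.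
rewrite (ffs_lift_seq (latY2_linl n g) r_uniq f0).
rewrite (eq_bigr _ (fun a _ => latY2_seq n a (f a) r'_uniq g0)).
rewrite /latY (@fsum_seq _ _ [seq (a, b) | a <- r, b <- r']).
- by rewrite big_allpairs.
- by apply: allpairs_uniq => // -[a b] [a' b'] _ _ [-> ->].
move=> [a b] /= abr; have [ar|/f0 ->] := boolP (a \in r); last first.
  by rewrite (lin0 (lat_coef_linl _ _ _ _)) scaler0 single0.
have [br|/g0 ->] := boolP (b \in r'); last first.
  by rewrite (lin0 (lat_coef_linr _ _ _ _)) scaler0 single0.
by move/negP: abr; case; apply/allpairsP; exists (a, b).
Qed.

Lemma latY_single a v n b w : latY eps act YU (single a v) n (single b w) =
  single (a + b) (eps a b *: lat_coef act YU a b v w (- n - 1)).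
Proof.
rewrite latYE (ffs_lift_single (latY2_linl n _)) /latY2.
by rewrite (ffs_lift_single (latY2_linr n _ _)).
Qed.

Lemma latY_linl n g : linear (fun f => latY eps act YU f n g).
Proof. by move=> x y z; rewrite !latYE (ffs_lift_lin (latY2_linl n g)). Qed.

Lemma latY_linr f n : linear (latY eps act YU f n).
Proof.
move=> x y z; rewrite !latYE; elim/ffs_ind: f => [|f g IHf IHg|a v].
- have l0 g : ffs_lift (latY2 n g) 0 = 0 by apply: lin0 (ffs_lift_lin (latY2_linl n g)).
  by rewrite !l0 scaler0 addr0.
- have lD g' : ffs_lift (latY2 n g') (f + g) = ffs_lift (latY2 n g') f + ffs_lift
  (latY2 n g') g.
    exact: linD (ffs_lift_lin (latY2_linl n g')) _ _.
  by rewrite !lD IHf IHg scalerDr addrACA.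
rewrite !(ffs_lift_single (latY2_linl n _)).
exact: (ffs_lift_lin (latY2_linr n a v)).
Qed.

End LatticeVertexOperators.

(** * Modes of h and of e^a on a module for the lattice vertex algebra *)

Section LatticeModules.
#[local] Opaque single M1_act M1_pi latY Eminus Eplus.
Variables (C : numFieldType) (h : vectType C) (form : {symmetric h}).
Variables (L : zmodClosed h) (eps : lat L -> lat L -> C).
Variables (YM : M1 form -> int -> M1 form -> M1 form).
Variables (W : lmodType C) (YW : latV L (M1 form) -> int -> W -> W).
Hypothesis L_even : even_lattice form L.
Hypothesis eps_cocycle : is_cocycle form eps.
Hypothesis YM_va : is_M1_va YM.
Hypothesis W_mod : is_lat_module eps YM YW.

Local Notation M1_act := (@M1_act C h form).
Local Notation vac := (M1_vac form).
Local Notation Vvac := (latV_vac form L).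
Local Notation latYM := (latY eps M1_act YM).
Local Notation "a ~> x" := (single a x : latV L (M1 form)) (at level 40).

Definition pairing (a b : lat L) : int := int_of (form (lat_val a) (lat_val b)).

(** Polarization: 2 <a,b> is a combination of norms, all of which are even. *)
Lemma pairingE a b : form (lat_val a) (lat_val b) = (pairing a b)%:~R.
Proof.
have [k kE] := L_even a; have [l lE] := L_even b; have [m mE] := L_even (a + b).
suff [n nE] : exists n : int, form (lat_val a) (lat_val b) = n%:~R.
  by rewrite /pairing nE int_of_intr.
exists (m - k - l); apply: (mulfI (x := 2%:~R)); first by rewrite intr_eq0.
rewrite -intrM.
have -> : 2%:~R * form (lat_val a) (lat_val b) =
    form (lat_val (a + b)) (lat_val (a + b)) - form (lat_val a) (lat_val a)
      - form (lat_val b) (lat_val b).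
  rewrite [lat_val (a + b)]/(lat_val a + lat_val b) !(formDl, formDr).
  by rewrite (formC _ (lat_val b) (lat_val a)); ring.
by rewrite mE kE lE -!intrB; congr (_%:~R); lia.
Qed.

Lemma lat_val0 : lat_val (0 : lat L) = 0. Proof. by []. Qed.

Lemma lat_valD (a b : lat L) : lat_val (a + b) = lat_val a + lat_val b.
Proof. by []. Qed.

Lemma YM_module : is_M1_module_of YM M1_act YM.
Proof. by case: YM_va => [[]]. Qed.

Let M1_act0E u x : M1_act u 0 x = form 0 u *: x.
Proof. by rewrite M1_act0 form0l scale0r. Qed.

Let dual0 : dual_lattice form L 0.
Proof. by move=> a; exists 0; rewrite form0r. Qed.

Let M1_fin (a : lat L) x : x \in Eplus_finite M1_act (lat_val a).
Proof. exact: M1_Eplus_finite. Qed.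

Lemma latYM_single a v n b w : latYM (a ~> v) n (b ~> w) =
  (a + b) ~> (eps a b *: lat_coef M1_act YM a b v w (- n - 1)).
Proof. exact: (latY_single _ (M1_heis form) YM_module M1_act0E dual0 M1_fin). Qed.

Let M1_box (a b : lat L) v w (n0 : int) : ev (fun N => forall n : int, n0 <= n ->
  lat_coef M1_act YM a b v w (- n - 1) = box M1_act YM 0 a b v w n N).
Proof. exact: (lat_coef_box (M1_heis form) YM_module M1_act0E dual0 M1_fin). Qed.

Let YM_vac n x : YM vac n x = if n == -1 then x else 0.
Proof. by case: YM_module => /vm_vac. Qed.

(** For a = 0 both E^-(-a,x) and Delta(a,-x) are the identity, and only Delta(b,x) acts, on [v]. *)
Lemma lat_coef0l (b : lat L) v w n : ev (fun N => lat_coef M1_act YM 0 b v w (- n - 1) =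
  \sum_(j < N.+1) (-1) ^+ j *:
     YM (Eplus M1_act (- lat_val b) (- j%:Z) v) (n - j%:Z) w).
Proof.
have [N NE] := M1_box 0 b v w n; exists N => M NM.
rewrite (NE M.+1) ?(leqW NM) // /box /box_term lat_val0 big_ord_recl [X in _ + X]big1
  ?addr0; last first.
  move=> i _; apply: big1 => j _; apply: big1 => m _.
  by rewrite (Eminus_eq0 (M1_heis form)) /= scaler0.
apply: eq_bigr => j _; rewrite big_ord_recl big1 ?addr0; last first.
  move=> m _; rewrite [X in YM _ _ X](Eplus_vac (M1_heis form)) /=; last first.
    by move=> i _; rewrite (act0l (M1_heis form)).
  by rewrite (lin0 (vm_lin (proj1 YM_module) _ _)) (lin0 (Eminus_lin (M1_heis form) _
    _)) scaler0.
rewrite (Eminus_eq0 (M1_heis form)) /= form0l form0r int_of0 !addr0.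
by rewrite [X in YM _ _ X](Eplus_vac (M1_heis form)) // => i _;
  rewrite (act0l (M1_heis form)).
Qed.

(** Delta(b,x) sends u(-1)1 to u(-1)1 + <u,b> x^(-1) 1, hence the extra weight <u,b> of u(0) on the
    summand of e^b. *)
Lemma latYM_heis u n b x : latYM (latV_of form L u) n (b ~> x) =
  b ~> (M1_act u n x + (if n == 0 then form u (lat_val b) else 0) *: x).
Proof.
rewrite /latV_of latYM_single add0r; have [_ [/(_ b)[_ ->] _]] := eps_cocycle.
rewrite scale1r; congr single.
have [[|N] [-> //]] := ev_witness (ev_and (lat_coef0l b (M1_of form u) x n) (ev_ge 1)).
move=> _.
have Ev j : Eplus M1_act (- lat_val b) (- j%:Z) vac = if j == 0%N then vac else 0.
  by rewrite (Eplus_vac (M1_heis form)) => [|i _]; rewrite ?M1_act_vac ?oppr_eq0.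
have EplusM j : Eplus M1_act (- lat_val b) (- j%:Z) (M1_of form u) =
    (if j == 0%N then M1_of form u else 0) -
    (if j == 1%N then form u (lat_val b) else 0) *: vac.
  have /= := Eplus_act (M1_heis form) (lat_val b) (- j%:Z) u vac (ltn0Sn 0).
  rewrite Ev => /esym/(canRL (addrK _)); rewrite /M1_of => ->.
  congr (_ - _); first by case: eqP => // _; rewrite (act0 (M1_heis form)).
  case: j => [|[|j]] /=; last have -> : - j.+2%:Z + 1 = - j.+1%:Z by lia.
  - by rewrite Eplus_gt0 // scaler0 scale0r.
  - by congr (_ *: _); apply: Eplus0.
  by rewrite Ev scaler0 scale0r.
rewrite big_ord_recl big_ord_recl big1 => [|j _]; last first.
  rewrite EplusM /= scale0r subr0 (lin0 (vm_linl (proj1 YM_module) _ _)).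
  exact: scaler0.
rewrite !EplusM /= scale0r !subr0 sub0r expr0 scale1r expr1 addr0.
rewrite (proj2 YM_module); congr (_ + _).
rewrite (linN (vm_linl (proj1 YM_module) _ _)) scaleN1r opprK.
rewrite (linZ (vm_linl (proj1 YM_module) _ _)) YM_vac.
rewrite (_ : (n - 1 == -1) = (n == 0)); last by apply/eqP/eqP; lia.
by case: eqP; rewrite ?scaler0 ?scale0r.
Qed.

Lemma latYM_M1 u n v : latYM (0 ~> u) n (0 ~> v) = 0 ~> YM u n v.
Proof.
rewrite latYM_single addr0; have [_ [/(_ 0)[-> _] _]] := eps_cocycle.
rewrite scale1r; congr single.
have [N ->] := ev_witness (lat_coef0l 0 u v n).
have E0 j : Eplus M1_act (- lat_val (0 : lat L)) (- j%:Z) u = if j == 0%N then u else 0.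
  rewrite (Eplus_vac (M1_heis form)) ?oppr_eq0 // => i _.
  exact: (act0l (M1_heis form)).
rewrite big_ord_recl big1 => [|j _]; last first.
  by rewrite E0 /= (lin0 (vm_linl (proj1 YM_module) _ _)) scaler0.
by rewrite E0 /= subr0 addr0 scale1r.
Qed.

(** Annihilation operators act trivially on the vacuum, which leaves eps(a,b) x^<a,b> E^-(-a,x) 1.
    This series starts at x^<a,b>, so e^a_n e^b = 0 for n >= -<a,b>. *)
Lemma latYM_vac a n b : latYM (a ~> vac) n (b ~> vac) =
  (a + b) ~> (eps a b *: Eminus M1_act (- lat_val a) (- n - 1 - pairing a b) vac).
Proof.
rewrite latYM_single; congr (single _ (_ *: _)).
have E0 (c : lat L) j : Eplus M1_act (- lat_val c) (- j%:Z) vac = if j == 0%N then vac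
  else 0.
  by rewrite (Eplus_vac (M1_heis form)) => [|i _]; rewrite ?M1_act_vac ?oppr_eq0.
have [[|N] [/(_ n)/(_ (lexx _))-> //]] :=
  ev_witness (ev_and (M1_box a b vac vac n) (ev_ge `|(n + 1 + pairing a b)%R|.+2)).
move=> nN; have termE i : \sum_(j < N.+1) \sum_(m < N.+1)
      box_term M1_act YM 0 a b vac vac n i j m =
    if i%:Z == - n - 1 - pairing a b then Eminus M1_act (- lat_val a) i vac else 0.
  rewrite big_ord_recl [X in _ + X]big1 ?addr0 => [|j _]; last first.
    apply: big1 => m _; rewrite /box_term E0 /= (lin0 (vm_linl (proj1 YM_module) _ _)).
    by rewrite (lin0 (Eminus_lin (M1_heis form) _ _)) scaler0.
  rewrite big_ord_recl big1 ?addr0 => [|m _]; last first.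
    rewrite /box_term (E0 a) /= (lin0 (vm_lin (proj1 YM_module) _ _)).
    by rewrite (lin0 (Eminus_lin (M1_heis form) _ _)) scaler0.
  rewrite /box_term !E0 /= form0l int_of0 YM_vac scale1r -/(pairing a b).
  rewrite (_ : (_ == -1) = (i%:Z == - n - 1 - pairing a b)); last by apply/eqP/eqP; lia.
  by case: eqP => // _; rewrite (lin0 (Eminus_lin (M1_heis form) _ _)).
rewrite /box; under eq_bigr do rewrite termE.
have [k0|k0] := leP 0 (- n - 1 - pairing a b); last first.
  rewrite Eminus_lt0 // big1 // => i _; case: eqP => // ik; lia.
have kN : (`|(- n - 1 - pairing a b)%R| < N.+1)%N by lia.
rewrite (bigD1 (Ordinal kN)) //= big1 ?addr0 => [|i /negP ik].
  by rewrite ifT gez0_abs.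
by case: eqP => // iE; case: ik; apply/eqP/val_inj => /=; lia.
Qed.

Definition hW (u : h) (n : int) (w : W) : W := YW (latV_of form L u) n w.
Definition eW (a : lat L) (n : int) (w : W) : W := YW (a ~> vac) n w.

Lemma hW_lin u n : linear (hW u n). Proof. exact: vm_lin W_mod _ _. Qed.
Lemma eW_lin a n : linear (eW a n). Proof. exact: vm_lin W_mod _ _. Qed.

Lemma hW_heis : heis form hW.
Proof.
split=> [||u v m n w]; first exact: hW_lin.
  move=> n w x u v; rewrite /hW -(vm_linl W_mod); congr YW.
  rewrite /latV_of /M1_of -single_lin; congr single.
  by case: (M1_heis form) => _ ->.
have prodE (i : nat) : latYM (latV_of form L u) i (latV_of form L v) =
    0 ~> (if i == 1%N then form u v *: vac else 0).
  rewrite latYM_heis lat_val0 form0r if_same scale0r addr0; congr single.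
  rewrite /M1_of (actC (M1_heis form)) M1_act_vac // (act0 (M1_heis form)) add0r.
  rewrite (_ : (i%:Z + -1 == 0) = (i == 1%N)); last by apply/eqP/eqP; lia.
  by case: eqP => [->|]; rewrite ?mul1r ?scale0r.
have prod0 (i : nat) : (2 <= i)%N ->
    latYM (latV_of form L u) i (latV_of form L v) = 0.
  by move=> i2; rewrite prodE ifF ?single0 //; apply/negbTE/eqP; lia.
apply: (etrans (vm_comm W_mod w m n prod0)); congr (_ + _).
rewrite big_ord_recl big_ord1 !prodE /= single0 (lin0 (vm_linl W_mod _ _)).
rewrite scaler0 add0r binomz_l1 (linZ (single_lin _)) (linZ (vm_linl W_mod _ _)).
rewrite -/latV_vac (vm_vac W_mod) scalerA.
rewrite (_ : (m + n - 1 == -1) = (m + n == 0)); last by apply/eqP/eqP; lia.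
by case: eqP => // _; rewrite scaler0 scale0r.
Qed.

(** Among the products u_i e^a with i >= 0 only u_0 e^a = <u,a> e^a can be nonzero. *)
Lemma hW_eW u (a : lat L) m n w : hW u m (eW a n w) =
  eW a n (hW u m w) + form u (lat_val a) *: eW a (m + n) w.
Proof.
have prod0 (i : nat) : (1 <= i)%N -> latYM (latV_of form L u) i (a ~> vac) = 0.
  by case: i => // i _; rewrite latYM_heis M1_act_vac //= scale0r addr0 single0.
apply: (etrans (vm_comm W_mod w m n prod0)); congr (_ + _).
rewrite big_ord1 latYM_heis M1_act_vac //= add0r binomz_l0 scale1r subr0.
by rewrite (linZ (single_lin _)) (linZ (vm_linl W_mod _ _)).
Qed.

Lemma hW_trunc_ev u w : ev (fun N => forall n : int, N%:Z <= n -> hW u n w = 0).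
Proof.
by apply: ev_imp (vm_trunc_ev W_mod (latV_of form L u) w 0) => N N0 n Nn; apply: N0;
  lia.
Qed.

Lemma YW_act_neg (u : h) (q : nat) (a : lat L) x n w S : (0 < q)%N ->
  (forall i : nat, (S <= i)%N -> YW (a ~> x) (n + i%:Z) w = 0) ->
  (forall i : nat, (S <= i)%N -> hW u i w = 0) ->
  YW (a ~> M1_act u (- q%:Z) x) n w =
  \sum_(i < S) ((-1) ^+ i * binomz C (- q%:Z) i) *:
     (hW u (- q%:Z - i%:Z) (YW (a ~> x) (n + i%:Z) w) -
      (-1) ^ (- q%:Z) *: YW (a ~> x) (n - q%:Z - i%:Z) (hW u i w)).
Proof.
move=> q0 Sx Sh.
have <- : latYM (latV_of form L u) (- q%:Z) (a ~> x) = a ~> M1_act u (- q%:Z) x.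
  by rewrite latYM_heis ifF ?scale0r ?addr0 //; apply/negbTE/eqP; lia.
apply: (vm_iterate W_mod Sx Sh).
have [N Nx] := ev_witness (vm_trunc_ev (proj1 YM_module) (M1_of form u) x 0).
exists (N + q).+1 => i Ni; rewrite latYM_heis ifF; last by apply/negbTE/eqP; lia.
by rewrite scale0r addr0 -(proj2 YM_module) Nx ?single0 //; lia.
Qed.

(** The vector e^a_(-2) 1 = a(-1) e^a is evaluated in two ways: by [vm_deriv] as a derivative, and
    by the iterate formula as a normally ordered product. *)
Lemma eW_deriv (a : lat L) n w S :
  (forall i : nat, (S <= i)%N -> eW a (n + i%:Z) w = 0) ->
  (forall i : nat, (S <= i)%N -> hW (lat_val a) i w = 0) ->
  - n%:~R *: eW a (n - 1) w =
  \sum_(i < S) (hW (lat_val a) (-1 - i%:Z) (eW a (n + i%:Z) w) +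
                eW a (n - 1 - i%:Z) (hW (lat_val a) i w)).
Proof.
move=> Se Sh.
have := YW_act_neg (ltn0Sn 0) Se Sh.
rewrite (eq_bigr (fun i : 'I_S => hW (lat_val a) (-1 - i%:Z) (eW a (n + i%:Z) w) +
                eW a (n - 1 - i%:Z) (hW (lat_val a) i w))) => [<-|i _]; last first.
  (* At q = 1 the sign (-1)^i of the iterate formula cancels against binom(-1,i) = (-1)^i. *)
  by rewrite -[- 1%:Z]/(-1) binomzN1 -expr2 sqrr_sign scale1r exprN1 invrN1 scaleN1r
    opprK.
rewrite -[- 1%:Z]/(-1).
have prodE k : latYM (a ~> vac) k Vvac =
    a ~> Eminus M1_act (- lat_val a) (- k - 1) vac.
  rewrite latYM_vac addr0; have [_ [/(_ a)[-> _] _]] := eps_cocycle.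
  by rewrite scale1r /pairing form0r int_of0 subr0.
have <- : latYM (a ~> vac) (-2) Vvac = a ~> M1_act (lat_val a) (-1) vac.
  rewrite prodE; congr single.
  have := Eminus_euler (M1_heis form) (lat_val a) 1 vac.
  by rewrite scale1r big_nat1 Eminus0.
have prod0 (i : nat) : (2 <= i)%N -> latYM (a ~> vac) (-2 + i%:Z) Vvac = 0.
  by move=> i2; rewrite prodE Eminus_lt0 ?single0 //; lia.
rewrite (vm_deriv W_mod _ _ prod0) prodE [Eminus _ _ _ _]Eminus0.
by [].
Qed.

(** At the last nonvanishing mode the product of e^a and e^(-a) is a nonzero multiple of the vacuum,
    so e^a can kill only w = 0. *)
Lemma eW_inj (a : lat L) w : (forall n, eW a n w = 0) -> w = 0.
Proof.
move=> ew0; have [eps0 _] := eps_cocycle.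
have paN : pairing a (- a) = pairing (- a) a by rewrite /pairing formC.
have prodE (i : nat) : latYM (a ~> vac) (- pairing a (- a) - 1 + i%:Z) (- a ~> vac) =
    (if i == 0%N then eps a (- a) else 0) *: Vvac.
  rewrite latYM_vac addrN.
  have -> : - (- pairing a (- a) - 1 + i%:Z) - 1 - pairing a (- a) = - i%:Z by lia.
  case: i => [|i]; first by rewrite Eminus0 (linZ (single_lin _)).
  by rewrite Eminus_lt0 ?scaler0 ?single0 ?scale0r //; lia.
have prod0 (i : nat) : (1 <= i)%N ->
    latYM (a ~> vac) (- pairing a (- a) - 1 + i%:Z) (- a ~> vac) = 0.
  by case: i => // i _; rewrite prodE scale0r.
have [T Te] := ev_witness (vm_trunc_ev W_mod (- a ~> vac) w 0).
have eNa0 (n : int) : T%:Z <= n -> YW (- a ~> vac) n w = 0 by move=> Tn; apply: Te;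
  rewrite add0r.
have prodV : latYM (a ~> vac) (- pairing a (- a) - 1) (- a ~> vac) = eps a (- a) *:
  Vvac.
  by have := prodE 0%N; rewrite addr0.
have /eqP : eps a (- a) *: w = 0.
  (* From [T] on, the modes of e^(-a) vanish on [w]; then m is fixed by m + n = -1, and the modes of
     e^a vanish by assumption. *)
  apply: (vm_prod_vac W_mod prod0 prodV (m := - 1 - T%:Z) (n := T)) => [|i|i].
  - by rewrite subrK.
  - by apply: eNa0; lia.
  exact: ew0.
by rewrite scaler_eq0 (negPf (eps0 _ _)) => /eqP.
Qed.

Lemma eW_prod (a b : lat L) m n w S :
  (forall i : nat, (S <= i)%N -> eW b (n + i%:Z) w = 0) ->
  (forall i : nat, (S <= i)%N -> eW a (m + i%:Z) w = 0) ->
  let l : int := - pairing a b - 1 in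
  eps a b *: eW (a + b) (m + n) w =
  \sum_(i < S) ((-1) ^+ i * binomz C l i) *:
       (eW a (m + l - i%:Z) (eW b (n + i%:Z) w)
        - (-1) ^ l *: eW b (n + l - i%:Z) (eW a (m + i%:Z) w)).
Proof.
move=> Sb Sa l.
have prodE (i : nat) : latYM (a ~> vac) (l + i%:Z) (b ~> vac) =
    (if i == 0%N then eps a b else 0) *: ((a + b) ~> vac).
  rewrite latYM_vac.
  have -> : - (l + i%:Z) - 1 - pairing a b = - i%:Z by rewrite /l; lia.
  case: i => [|i]; first by rewrite Eminus0 (linZ (single_lin _)).
  by rewrite Eminus_lt0 ?scaler0 ?single0 ?scale0r //; lia.
have prod0 (i : nat) : (1 <= i)%N -> latYM (a ~> vac) (l + i%:Z) (b ~> vac) = 0.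
  by case: i => // i _; rewrite prodE scale0r.
apply: (etrans _ (vm_prod W_mod prod0 Sb Sa)).
by rewrite -[l]addr0 prodE (linZ (vm_linl W_mod _ _)).
Qed.

Lemma eW0 n w : eW 0 n w = if n == -1 then w else 0.
Proof. exact: (vm_vac W_mod). Qed.

Lemma YW_act_neg_ev (u : h) (q : nat) (a : lat L) x n w : (0 < q)%N ->
  ev (fun S => YW (a ~> M1_act u (- q%:Z) x) n w =
  \sum_(i < S) ((-1) ^+ i * binomz C (- q%:Z) i) *:
     (hW u (- q%:Z - i%:Z) (YW (a ~> x) (n + i%:Z) w) -
      (-1) ^ (- q%:Z) *: YW (a ~> x) (n - q%:Z - i%:Z) (hW u i w))).
Proof.
move=> q0; have [S0 S0E] := ev_and (vm_trunc_ev W_mod (a ~> x) w n) (hW_trunc_ev u w).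
exists S0 => S /S0E[Sx Sh]; apply: YW_act_neg => // i Si; first by apply: Sx; lia.
by apply: Sh; lia.
Qed.

(** Induction on [x] in M(1): the iterate formula expresses the modes of e^a (x) u(-q)y through
    those of u and of e^a (x) y. *)
Lemma YW_single_closed (S : {pred W}) (a : lat L) : submod_closed S ->
  (forall u n w, w \in S -> hW u n w \in S) ->
  (forall n w, w \in S -> eW a n w \in S) ->
  forall x n w, w \in S -> YW (a ~> x) n w \in S.
Proof.
move=> S_sub Sh Se x.
pose T : {pred M1 form} := fun x => `[< forall n w, w \in S -> YW (a ~> x) n w \in S >].
suff /asboolP : x \in T by [].
apply: M1_ind => [||u n y n0 /asboolP yT].
- split=> [|c y z /asboolP yT /asboolP zT]; apply/asboolP=> n w wS.
    by rewrite single0 (lin0 (vm_linl W_mod _ _)); apply: smc0.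
  rewrite (single_lin a c) (vm_linl W_mod).
  by apply: smcD; rewrite ?zT //; apply: smcZ; rewrite ?yT.
- by apply/asboolP; apply: Se.
apply/asboolP => k w wS; have -> : n = - `|n|%N%:Z by lia.
have [N ->] := ev_witness (@YW_act_neg_ev u `|n|%N a y k w ltac:(lia)).
apply: smc_sum => // i _; apply: smcZ => //; apply: smcB => //.
  by apply: Sh; apply: yT.
by apply: smcZ => //; apply: yT; apply: Sh.
Qed.

Lemma YW_closed (S : {pred W}) : submod_closed S ->
  (forall u n w, w \in S -> hW u n w \in S) ->
  (forall a n w, w \in S -> eW a n w \in S) ->
  forall v n w, w \in S -> YW v n w \in S.
Proof.
move=> S_sub Sh Se v n w wS; elim/ffs_ind: v => [|v v' vS v'S|a x].
- by rewrite (lin0 (vm_linl W_mod _ _)); apply: smc0.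
- by rewrite (linD (vm_linl W_mod _ _)); apply: smcD.
by apply: YW_single_closed => // k; apply: Se.
Qed.

End LatticeModules.

(** * Vacuum vectors of lattice modules *)

Section LatticeRepresentations.
Variables (C : numFieldType) (h : vectType C) (form : {symmetric h}).
Variables (L : zmodClosed h) (eps : lat L -> lat L -> C).
Variables (W : lmodType C) (H : h -> int -> W -> W) (e : lat L -> int -> W -> W).

Local Notation pair := (pairing form).

(** What the modes [H u n] of [Y(u(-1)1, x)] and [e a n] of [Y(e^a, x)] satisfy
    on a module for the lattice vertex algebra. *)
Record lat_rep : Prop := LatRep {
  lr_heis : heis form H;
  lr_lin : forall a n, linear (e a n);
  lr_H_trunc : forall u w, ev (fun N => forall n : int, N%:Z <= n -> H u n w = 0);
  lr_e_trunc : forall a w, ev (fun N => forall n : int, N%:Z <= n -> e a n w = 0);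
  lr_comm : forall u a m n w,
    H u m (e a n w) = e a n (H u m w) + form u (lat_val a) *: e a (m + n) w;
  lr_deriv : forall (a : lat L) n w S,
    (forall i : nat, (S <= i)%N -> e a (n + i%:Z) w = 0) ->
    (forall i : nat, (S <= i)%N -> H (lat_val a) i w = 0) ->
    - n%:~R *: e a (n - 1) w =
    \sum_(i < S) (H (lat_val a) (-1 - i%:Z) (e a (n + i%:Z) w) +
                  e a (n - 1 - i%:Z) (H (lat_val a) i w));
  lr_inj : forall a w, (forall n, e a n w = 0) -> w = 0;
  lr_prod : forall (a b : lat L) m n w S,
    (forall i : nat, (S <= i)%N -> e b (n + i%:Z) w = 0) ->
    (forall i : nat, (S <= i)%N -> e a (m + i%:Z) w = 0) ->
    let l : int := - pair a b - 1 in
    eps a b *: e (a + b) (m + n) w =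
    \sum_(i < S) ((-1) ^+ i * binomz C l i) *:
       (e a (m + l - i%:Z) (e b (n + i%:Z) w)
        - (-1) ^ l *: e b (n + l - i%:Z) (e a (m + i%:Z) w));
  lr_e0 : forall n w, e 0 n w = if n == -1 then w else 0
}.

Hypothesis R : lat_rep.
Hypothesis pairE : forall a b : lat L,
  form (lat_val a) (lat_val b) = (pair a b)%:~R.

Let HH := lr_heis R.

(** Some mode is nonzero by [lr_inj], the truncation bounds such modes above, and K is the least
    bound. *)
Lemma top_mode a w : w != 0 ->
  exists K : int, e a (K - 1) w != 0 /\ forall n, K <= n -> e a n w = 0.
Proof.
move=> w0; have [j ej] : exists j, e a j w != 0.
  apply: contrapT => ne; case/eqP: w0; apply: (lr_inj R (a := a)) => n.
  by apply: contrapT => /eqP en; apply: ne; exists n.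
have [T Te] := ev_witness (lr_e_trunc R a w).
pose P N := `[< forall n : int, j + N%:Z <= n -> e a n w = 0 >].
have exP : exists N, P N.
  by exists `|(T%:Z - j)%R|%N; apply/asboolP => n jn; apply: Te; lia.
case: (ex_minnP exP) => N /asboolP NP Nmin.
exists (j + N%:Z); split; last by [].
case: N => [|N] in NP Nmin *; first by rewrite NP ?eqxx ?addr0 in ej.
apply/eqP => eN; suff /Nmin : P N by rewrite ltnn.
apply/asboolP => n jn; have [->|nN] := eqVneq n (j + N.+1%:Z - 1); first by [].
by apply: NP; lia.
Qed.

Section TopMode.
Variables (a : lat L) (w : W) (K : int).
Hypothesis e_top : forall n, K <= n -> e a n w = 0.

Lemma top_H_pos u (n : nat) : (0 < n)%N -> H u n (e a (K - 1) w) = e a (K - 1) (H u n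
  w).
Proof. by move=> n0; rewrite (lr_comm R) e_top ?scaler0 ?addr0 //; lia. Qed.

Lemma top_H_zero u : H u 0 (e a (K - 1) w) =
  e a (K - 1) (H u 0 w) + form u (lat_val a) *: e a (K - 1) w.
Proof. by rewrite (lr_comm R) add0r. Qed.

(** In [lr_deriv] at n = K + N every term contains, directly or after commuting a(j), a mode of e^a
    on [w] at or above K; the exception is the term i = N, which is e_(K-1) a(N) w. *)
Lemma top_kill (N : nat) : (0 < N)%N ->
  (forall i : nat, (N < i)%N -> H (lat_val a) i w = 0) ->
  forall i : nat, (N <= i)%N -> H (lat_val a) i (e a (K - 1) w) = 0.
Proof.
move=> N0 Nw i Ni; rewrite top_H_pos; last by lia.
have [iN|iN] := eqVneq i N; last by rewrite Nw ?(lin0 (lr_lin R _ _)) //; lia.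
rewrite iN; have := lr_deriv R (a := a) (n := K + N%:Z) (w := w) (S := N.+1).
rewrite big_ord_recr big1 /= => [|j _]; last first.
  have jN := ltn_ord j; rewrite e_top; last by lia.
  have := lr_comm R (lat_val a) a j (K + N%:Z - 1 - j%:Z) w.
  rewrite e_top; last by lia.
  rewrite e_top; last by lia.
  by rewrite (act0 HH) scaler0 addr0 (act0 HH) add0r => <-.
rewrite e_top; last by lia.
rewrite e_top; last by lia.
rewrite (act0 HH) scaler0 !add0r (_ : K + N%:Z - 1 - N%:Z = K - 1); last by lia.
by move=> <- // j Nj; rewrite e_top //; lia.
Qed.

(** [lr_deriv] at n = K: on the right only the term with a(0) survives. *)
Lemma top_deriv : (forall i : nat, (0 < i)%N -> H (lat_val a) i w = 0) ->
  e a (K - 1) (H (lat_val a) 0 w) = - K%:~R *: e a (K - 1) w.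
Proof.
move=> aw; have := lr_deriv R (a := a) (n := K) (w := w) (S := 1).
rewrite big_ord1 /= !addr0 (e_top (lexx K)) (act0 HH) add0r => -> //.
by move=> i i1; rewrite e_top //; lia.
Qed.

End TopMode.

(** What passes from [w] to a vector obtained by successive top modes. Eigenvalues of u(0) may
    change, by <u,a> for each step with e^a. *)
Definition refines (w w' : W) : Prop :=
  [/\ w' != 0, forall u (n : nat), (0 < n)%N -> H u n w = 0 -> H u n w' = 0 &
      forall u c, H u 0 w = c *: w -> exists c', H u 0 w' = c' *: w'].

Lemma refines_trans w1 w2 w3 : refines w1 w2 -> refines w2 w3 -> refines w1 w3.
Proof.
move=> [_ p12 q12] [w30 p23 q23]; split=> // [u n n0 uw|u c /q12[c' /q23]//].
by apply: p23 => //; apply: p12.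
Qed.

Lemma refines_top a w K : e a (K - 1) w != 0 -> (forall n, K <= n -> e a n w = 0) ->
  refines w (e a (K - 1) w).
Proof.
move=> eK Kw; split=> // [u n n0 uw|u c uw].
  by rewrite top_H_pos // uw (lin0 (lr_lin R _ _)).
by rewrite top_H_zero // uw (linZ (lr_lin R _ _)) -scalerDl; eexists.
Qed.

(** Induction on a bound N for the modes a(i) that are nonzero on [w]: taking a top mode lowers the
    bound by one. *)
Lemma refine_pos (a : lat L) w : w != 0 ->
  exists2 w', refines w w' & forall i : nat, (0 < i)%N -> H (lat_val a) i w' = 0.
Proof.
have [N] := ev_witness (lr_H_trunc R (lat_val a) w) => Na.
have {}Na (i : nat) : (N < i)%N -> H (lat_val a) i w = 0 by move=> Ni; apply: Na; lia.
elim: N => [|N IH] in w Na *; move=> w0.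
  by exists w => //; split=> // u c; exists c.
have [K [eK Kw]] := top_mode a w0.
have [i Ni|//|w' ww' w'0] := IH (e a (K - 1) w).
  exact: (top_kill Kw (N := N.+1)).
by exists w' => //; apply: refines_trans ww'; apply: refines_top.
Qed.

(** Once the a(i) with i >= 1 kill the vector, one further top mode makes it an eigenvector of
    a(0). *)
Lemma refine (a : lat L) w : w != 0 -> exists2 w', refines w w' &
  (forall i : nat, (0 < i)%N -> H (lat_val a) i w' = 0) /\
  exists c, H (lat_val a) 0 w' = c *: w'.
Proof.
move=> /refine_pos-/(_ a)[w' ww' aw']; have [w'0 _ _] := ww'.
have [K [eK Kw]] := top_mode a w'0; have w'K := refines_top eK Kw.
exists (e a (K - 1) w'); first exact: refines_trans w'K.
split=> [i i0|]; first by case: w'K => _ -> //; apply: aw'.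
by rewrite top_H_zero // top_deriv // -scalerDl; eexists.
Qed.

Lemma refine_seq (s : seq (lat L)) w : w != 0 -> exists2 w', refines w w' &
  forall a, a \in s ->
  (forall i : nat, (0 < i)%N -> H (lat_val a) i w' = 0) /\
  exists c, H (lat_val a) 0 w' = c *: w'.
Proof.
move=> w0; elim: s => [|a s [w' ww' sw']].
  by exists w => //; split=> // u c; exists c.
have [w'0 _ _] := ww'; have [w'' w'w'' aw''] := refine a w'0.
exists w''; first exact: refines_trans w'w''.
move=> b; rewrite inE => /predU1P[->//|/sw'[bw' [c bc]]].
have [_ p q] := w'w''; split=> [i i0|]; first by apply: p => //; apply: bw'.
exact: q bc.
Qed.

Lemma vacuum_weight_int (a : lat L) w c : w != 0 ->
  (forall i : nat, (0 < i)%N -> H (lat_val a) i w = 0) ->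
  H (lat_val a) 0 w = c *: w -> exists k : int, c = k%:~R.
Proof.
move=> w0 aw ac; have [K [eK Kw]] := top_mode a w0.
have := top_deriv Kw aw; rewrite ac (linZ (lr_lin R _ _)) => /eqP.
rewrite -subr_eq0 -scalerBl scaler_eq0 (negPf eK) orbF subr_eq0 => /eqP->.
by exists (- K); rewrite intrN.
Qed.

Section VacuumVector.
Variables (a : lat L) (w : W) (c : int).
Hypothesis aw : forall i : nat, (0 < i)%N -> H (lat_val a) i w = 0.
Hypothesis ac : H (lat_val a) 0 w = c%:~R *: w.

(** On a vacuum vector only a(0) = c remains of the annihilation part, and it joins the derivative
    to give the factor n + c. *)
Let deriv n S : (forall i : nat, (S <= i)%N -> e a (n + i%:Z) w = 0) ->
  - (n + c)%:~R *: e a (n - 1) w =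
  \sum_(i < S) H (lat_val a) (-1 - i%:Z) (e a (n + i%:Z) w).
Proof.
move=> Sw; have := lr_deriv R (a := a) (n := n) (w := w) (S := S.+1).
have -> : \sum_(i < S.+1) (H (lat_val a) (-1 - i%:Z) (e a (n + i%:Z) w) +
      e a (n - 1 - i%:Z) (H (lat_val a) i w)) =
    \sum_(i < S) H (lat_val a) (-1 - i%:Z) (e a (n + i%:Z) w) + c%:~R *: e a (n - 1) w.
  rewrite big_split /= big_ord_recr /= Sw // (act0 HH) addr0; congr (_ + _).
  rewrite big_ord_recl big1 => [|i _]; last by rewrite aw // (lin0 (lr_lin R _ _)).
  by rewrite /= !addr0 ac (linZ (lr_lin R _ _)).
move=> E; rewrite intrD opprD scalerDl E ?scaleNr ?addrK // => i Si.
  by apply: Sw; lia.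
by apply: aw; lia.
Qed.

(** Descent from the truncation bound: at n = k + 1 the sum is empty, and the factor k + 1 + c is
    nonzero for k >= -c. *)
Lemma vacuum_mode_gt n : - c <= n -> e a n w = 0.
Proof.
have [T Te] := ev_witness (lr_e_trunc R a w).
suff Hd d k : - c <= k -> T%:Z - d%:Z <= k -> e a k w = 0.
  by move=> cn; apply: (Hd `|(T%:Z - n)%R|%N) => //; lia.
elim: d k => [|d IH] k ck dk; first by apply: Te; lia.
have k0 (i : nat) : (0 <= i)%N -> e a (k + 1 + i%:Z) w = 0.
  by move=> _; apply: IH; lia.
have := deriv k0; rewrite big_ord0 addrK => /eqP.
by rewrite scaler_eq0 oppr_eq0 intr_eq0 => /orP[/eqP|/eqP//]; lia.
Qed.

(** The recursion that [lr_deriv] gives for [e a (- c - 1 - N) w] is that of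
    [Eminus_euler]. *)
Lemma vacuum_mode n :
  e a n w = Eminus H (- lat_val a) (- c - 1 - n) (e a (- c - 1) w).
Proof.
have [cn|cn] := leP (- c) n; first by rewrite vacuum_mode_gt // Eminus_lt0 //; lia.
have -> : n = - c - 1 - `|(- c - 1 - n)%R|%N%:Z by lia.
move: `|_|%N => N {cn n}.
rewrite (_ : - c - 1 - (- c - 1 - N%:Z) = N%:Z); last by lia.
elim/ltn_ind: N => -[|N] IH; first by rewrite subr0 Eminus0.
apply: (scalerI (a := N.+1%:R)); first by rewrite pnatr_eq0.
rewrite (Eminus_euler HH) big_add1 /= big_mkord.
have := @deriv (- c - N.+1%:Z) N.+1.
rewrite (_ : - c - N.+1%:Z + c = - N.+1%:Z); last by lia.
rewrite intrN opprK (_ : - c - N.+1%:Z - 1 = - c - 1 - N.+1%:Z); last by lia.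
move=> -> => [|i Ni]; last by apply: vacuum_mode_gt; lia.
apply: eq_bigr => i _; rewrite subSS -IH; last by lia.
congr (H _ _ (e _ _ _)); have := ltn_ord i; lia.
Qed.

End VacuumVector.

End LatticeRepresentations.

(** * Dual bases, the vacuum space and the operators Z_a *)

Section AdaptedBases.
Variables (C : numFieldType) (h : vectType C) (form : {symmetric h}).
Variables (L : zmodClosed h) (r s : nat) (al be : r.-tuple h) (us vs : s.-tuple h).
Hypothesis bases : adapted_bases form L al be us vs.

Lemma al_lat i : exists a : lat L, lat_val a = tnth al i.
Proof.
case: bases => /allP alL _ _ _; have iL := alL _ (mem_tnth i al).
by exists (Lat iL).
Qed.

Lemma form_al_be i j : form (tnth al i) (tnth be j) = (i == j)%:R.
Proof. by case: bases => _ _ _ []. Qed.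
Lemma form_al_vs i j : form (tnth al i) (tnth vs j) = 0.
Proof. by case: bases => _ _ _ []. Qed.
Lemma form_us_be i j : form (tnth us i) (tnth be j) = 0.
Proof. by case: bases => _ _ _ []. Qed.
Lemma form_us_vs i j : form (tnth us i) (tnth vs j) = (i == j)%:R.
Proof. by case: bases => _ _ _ []. Qed.

Lemma linear_al_us (V : lmodType C) (f : h -> V) : linear f ->
  (forall i, f (tnth al i) = 0) -> (forall j, f (tnth us j) = 0) ->
  forall u, f u = 0.
Proof.
move=> f_lin fal fus u; have [_ _ ab _] := bases.
have /coord_span -> : u \in <<[tuple of al ++ us]>>%VS.
  by rewrite (span_basis ab) memvf.
rewrite (lin_sum f_lin) big1 // => i _; rewrite (linZ f_lin).
have /= : (al ++ us)`_i \in al ++ us by rewrite mem_nth // size_tuple.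
by rewrite mem_cat => /orP[/tnthP[j ->]|/tnthP[j ->]]; rewrite ?fal ?fus scaler0.
Qed.

Lemma lat_vs (a : lat L) j : form (lat_val a) (tnth vs j) = 0.
Proof.
have [_ /(_ a) aal _ _] := bases.
rewrite (coord_span aal) (lin_sum (form_linl form _)) big1 // => i _.
by rewrite formZl -tnth_nth form_al_vs mulr0.
Qed.

Lemma expand_al_us u : u = \sum_(i < r) form u (tnth be i) *: tnth al i +
  \sum_(j < s) form u (tnth vs j) *: tnth us j.
Proof.
apply/eqP; rewrite -subr_eq0; apply/eqP.
pose g u := \sum_(i < r) form u (tnth be i) *: tnth al i +
  \sum_(j < s) form u (tnth vs j) *: tnth us j.
pose f u := u - g u.
have g_lin : linear g.
  move=> c {}u v; rewrite /g scalerDr !scaler_sumr addrACA -!big_split /=.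
  by congr (_ + _); apply: eq_bigr => i _; rewrite formDl formZl scalerDl scalerA.
apply: (linear_al_us (f := f)) => {u} [c u v|i|j].
- by rewrite /f g_lin scalerBr opprD addrACA.
- rewrite /f /g (bigD1 i) //= form_al_be eqxx scale1r big1 ?addr0 => [|k ki].
    by rewrite big1 ?addr0 ?subrr // => j _; rewrite form_al_vs scale0r.
  by rewrite form_al_be eq_sym (negPf ki) scale0r.
rewrite /f /g [X in _ - X]addrC (bigD1 j) //= form_us_vs eqxx scale1r big1 ?addr0 =>
  [|k kj].
  by rewrite big1 ?addr0 ?subrr // => i _; rewrite form_us_be scale0r.
by rewrite form_us_vs eq_sym (negPf kj) scale0r.
Qed.

Lemma form_eq0 (form_nondeg : nondegenerate form) u : (forall v, form v u = 0) -> u = 0.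
Proof.
move=> u0; apply/eqP; rewrite -memv0.
move: form_nondeg; rewrite /nondegenerate => /eqP <-.
by apply/mem_orthovP => v _; rewrite formC.
Qed.

(** By nondegeneracy it suffices to pair the difference of the two sides with the basis
    [al ++ us]. *)
Lemma expand_be_vs (form_nondeg : nondegenerate form) u : u = \sum_(i < r) form u (tnth
  al i) *: tnth be i +
  \sum_(j < s) form u (tnth us j) *: tnth vs j.
Proof.
apply/eqP; rewrite -subr_eq0; apply/eqP; apply: (form_eq0 form_nondeg).
have formB x y v : form v (x - y) = form v x - form v y by rewrite formDr formNr.
have formZr c x v : form v (c *: x) = c * form v x by rewrite formC formZl formC.
have form_sumr n (F : 'I_n -> h) v : form v (\sum_(i < n) F i) = \sum_(i < n) form v (F
  i).
  by rewrite formC (lin_sum (form_linl form v)); apply: eq_bigr => i _; rewrite formC.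
apply: (linear_al_us (V := C^o)) => [|i|j]; first exact: form_linl.
- rewrite formB formDr !form_sumr (bigD1 i) //= formZr form_al_be eqxx mulr1.
  rewrite big1 ?addr0 => [|k ki]; last first.
    by rewrite formZr form_al_be eq_sym (negPf ki) mulr0.
  by rewrite big1 ?addr0 => [|k _]; rewrite ?formZr ?form_al_vs ?mulr0 // formC subrr.
rewrite formB formDr !form_sumr [X in _ - X]addrC (bigD1 j) //= formZr form_us_vs eqxx
  mulr1.
rewrite big1 ?addr0 => [|k kj]; last first.
  by rewrite formZr form_us_vs eq_sym (negPf kj) mulr0.
by rewrite big1 ?addr0 => [|k _]; rewrite ?formZr ?form_us_be ?mulr0 // formC subrr.
Qed.

Section VacuumSpace.
Variables (eps : lat L -> lat L -> C).
Hypothesis eps_cocycle : is_cocycle form eps.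
Variables (W : lmodType C) (H : h -> int -> W -> W) (e : lat L -> int -> W -> W).
Hypothesis R : lat_rep form eps H e.
Hypothesis pairE : forall a b : lat L,
  form (lat_val a) (lat_val b) = (pairing form a b)%:~R.

Let HH := lr_heis R.

Lemma H_expand_al_us u n w : H u n w =
  \sum_(i < r) form u (tnth be i) *: H (tnth al i) n w +
  \sum_(j < s) form u (tnth vs j) *: H (tnth us j) n w.
Proof.
have l := act_linl HH n w; rewrite {1}(expand_al_us u) (linD l) !(lin_sum l).
by congr (_ + _); apply: eq_bigr => i _; rewrite (linZ l).
Qed.

Lemma H_expand_be_vs (form_nondeg : nondegenerate form) u n w : H u n w =
  \sum_(i < r) form u (tnth al i) *: H (tnth be i) n w +
  \sum_(j < s) form u (tnth us j) *: H (tnth vs j) n w.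
Proof.
have l := act_linl HH n w; rewrite {1}(expand_be_vs form_nondeg u) (linD l) !(lin_sum
  l).
by congr (_ + _); apply: eq_bigr => i _; rewrite (linZ l).
Qed.

Definition vacuum_space (mu : h) : {pred W} := fun w =>
  `[< (forall i (n : nat), (0 < n)%N -> H (tnth al i) n w = 0) /\
      (forall u, H u 0 w = form mu u *: w) >].

Lemma vacuum_space_submod mu : submod_closed (vacuum_space mu).
Proof.
split=> [|c v w /asboolP[v1 v2] /asboolP[w1 w2]]; apply/asboolP.
  by split=> [i n _|u]; rewrite (act0 HH) // scaler0.
split=> [i n n0|u]; first by rewrite (act_lin HH) v1 // w1 // scaler0 addr0.
by rewrite (act_lin HH) v2 w2 scalerDr !scalerA mulrC.
Qed.

Lemma vacuum_space_act mu u n w : (forall i, form (tnth al i) u = 0) ->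
  w \in vacuum_space mu -> H u n w \in vacuum_space mu.
Proof.
move=> alu /asboolP[w1 w2]; apply/asboolP; split=> [i k k0|v].
  by rewrite (actC HH) w1 // (act0 HH) alu mulr0 if_same scale0r addr0.
by rewrite (actC HH) w2 (linZ (act_lin HH _ _)) mul0r if_same scale0r addr0.
Qed.

Lemma vacuum_space_lat mu (a : lat L) w (n : nat) : (0 < n)%N ->
  w \in vacuum_space mu -> H (lat_val a) n w = 0.
Proof.
move=> n0 /asboolP[w1 _]; rewrite H_expand_al_us !big1 ?addr0 // => i _.
  by rewrite lat_vs scale0r.
by rewrite w1 // scaler0.
Qed.

(** Semisimplicity provides a common eigenvector of the u_j(0), and [refine_seq] makes it a vacuum
    vector for all al_i while it stays a common eigenvector. *)
Lemma vacuum_space_nonzero : (exists w : W, w != 0) ->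
  acts_semisimply (fun (j : 'I_s) w => H (tnth us j) 0 w) ->
  exists lam, dual_lattice form L lam /\ exists2 w, w \in vacuum_space lam & w != 0.
Proof.
move=> [w0 w0n] ss; have [n [f [w0E fE]]] := ss w0.
have [k fk] : exists k, f k != 0.
  apply: contrapT => nf; case/eqP: w0n; rewrite w0E big1 // => k _.
  by apply: contrapT => /eqP fk; apply: nf; exists k.
have [chi chiE] := fE k.
have [la laE] := choice al_lat.
have [w [wn0 _ fw] law] := refine_seq R [seq la i | i <- enum 'I_r] fk.
have {}law i : (forall n : nat, (0 < n)%N -> H (tnth al i) n w = 0) /\
    exists c, H (tnth al i) 0 w = c *: w.
  by rewrite -laE; apply: law; rewrite map_f // mem_enum.
have [c cE] := choice (fun i => proj2 (law i)).
have [d dE] := choice (fun j => fw _ _ (chiE j)).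
(* By duality of the bases <lam,al_i> = c_i and <lam,u_j> = d_j. *)
pose lam := \sum_(i < r) c i *: tnth be i + \sum_(j < s) d j *: tnth vs j.
have lamE u : form lam u = \sum_(i < r) form u (tnth be i) * c i +
    \sum_(j < s) form u (tnth vs j) * d j.
  rewrite /lam formDl !(lin_sum (form_linl form u)); congr (_ + _);
    by apply: eq_bigr => i _; rewrite formZl mulrC formC.
have wV : w \in vacuum_space lam.
  apply/asboolP; split=> [i|u]; first by case: (law i).
  rewrite H_expand_al_us lamE scalerDl !scaler_suml.
  by congr (_ + _); apply: eq_bigr => i _; rewrite ?cE ?dE scalerA.
exists lam; split; last by exists w.
move=> a; rewrite formC; apply: (vacuum_weight_int R wn0) => [i i0|].
  exact: vacuum_space_lat wV.
by move/asboolP: wV => [_ ->].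
Qed.

Lemma dual_latticeD mu (a : lat L) : dual_lattice form L mu -> dual_lattice form L (mu
  + lat_val a).
Proof.
move=> muL b; have [k kE] := muL b; exists (k + pairing form b a).
by rewrite formDr kE pairE intrD.
Qed.

Definition wt (mu : h) (a : lat L) : int := int_of (form mu (lat_val a)).

(** The coefficient of x^<mu,a> in Y(e^a,x) w; no lower power occurs when [w] is a vacuum vector of
    weight [mu]. *)
Definition Z (mu : h) (a : lat L) (w : W) : W := e a (- wt mu a - 1) w.

Lemma Z_lin mu a : linear (Z mu a). Proof. exact: lr_lin R _ _. Qed.

Section Weight.
Variable mu : h.
Hypothesis mu_dual : dual_lattice form L mu.

Lemma wtE a : form mu (lat_val a) = (wt mu a)%:~R.
Proof. exact: lat_weight. Qed.

Lemma wtD a b : wt (mu + lat_val b) a = wt mu a + pairing form a b.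
Proof.
rewrite /wt formDl wtE (formC _ (lat_val b)) pairE -intrD.
by rewrite !int_of_intr.
Qed.

Lemma wt_add a b : wt mu (a + b) = wt mu a + wt mu b.
Proof. by rewrite {1}/wt lat_valD formDr !wtE -intrD int_of_intr. Qed.

Lemma vacuum_space_weight a w : w \in vacuum_space mu ->
  H (lat_val a) 0 w = (wt mu a)%:~R *: w.
Proof. by move/asboolP => [_ ->]; rewrite wtE. Qed.

Lemma vacuum_space_mode a n w : w \in vacuum_space mu ->
  e a n w = Eminus H (- lat_val a) (- wt mu a - 1 - n) (Z mu a w).
Proof.
move=> wV; apply: (vacuum_mode R) => [i i0|]; last exact: vacuum_space_weight.
exact: vacuum_space_lat wV.
Qed.

Lemma vacuum_space_mode_gt a n w : w \in vacuum_space mu -> - wt mu a <= n -> e a n w =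
  0.
Proof. by move=> wV cn; rewrite vacuum_space_mode // Eminus_lt0 //; lia. Qed.

Lemma Z_vacuum a w : w \in vacuum_space mu ->
  Z mu a w \in vacuum_space (mu + lat_val a).
Proof.
move=> wV; have /asboolP[w1 w2] := wV; apply/asboolP; split=> [i n n0|u].
  rewrite (lr_comm R) w1 // (lin0 (lr_lin R _ _)) add0r.
  by rewrite (vacuum_space_mode_gt wV) ?scaler0 //; lia.
rewrite (lr_comm R) w2 add0r (linZ (lr_lin R _ _)) -scalerDl.
by rewrite formDl (formC _ u).
Qed.

(** With [m = - <mu,a>] and [n = - <mu,b> - 1] a single term of [lr_prod]
    survives. *)
Lemma ZZ a b w : w \in vacuum_space mu ->
  Z (mu + lat_val b) a (Z mu b w) = eps a b *: Z mu (a + b) w.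
Proof.
move=> wV; have aw (i : nat) : (1 <= i)%N -> e a (- wt mu a + i%:Z) w = 0.
  by move=> _; apply: vacuum_space_mode_gt => //; lia.
have bw (i : nat) : (1 <= i)%N -> e b (- wt mu b - 1 + i%:Z) w = 0.
  by move=> i1; apply: vacuum_space_mode_gt => //; lia.
have := lr_prod R bw aw; cbv zeta; rewrite big_ord1 binomz_l0 expr0 mulr1 scale1r.
have aw0 : e a (- wt mu a + 0%N%:Z) w = 0 by apply: vacuum_space_mode_gt => //; lia.
rewrite [nat_of_ord _]/= aw0 (lin0 (lr_lin R _ _)) scaler0 subr0 !addr0 => E.
rewrite /Z wtD; apply: etrans (etrans _ (esym E)) _; first by congr e; lia.
congr (_ *: e _ _ _); rewrite wt_add; lia.
Qed.

Lemma Z0 w : Z mu 0 w = w.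
Proof. by rewrite /Z (lr_e0 R) /wt lat_val0 form0r int_of0. Qed.

(** Z_(-a) Z_a is the nonzero scalar eps(-a,a) on vacuum vectors. *)
Lemma Z_inj a w : w \in vacuum_space mu -> Z mu a w = 0 -> w = 0.
Proof.
move=> wV aw0; have /eqP := ZZ (- a) a wV.
rewrite aw0 (lin0 (Z_lin _ _)) addNr Z0 eq_sym scaler_eq0.
by have [/(_ (- a) a)/negPf-> _] := eps_cocycle => /eqP.
Qed.

End Weight.

Lemma Z_act mu a u n w : form u (lat_val a) = 0 -> H u n (Z mu a w) = Z mu a (H u n w).
Proof. by move=> ua; rewrite (lr_comm R) ua scale0r addr0. Qed.

End VacuumSpace.
End AdaptedBases.

(** * The Fock space decomposition *)

Section PolynomialCoefficients.
Variables (C : numFieldType) (r : nat) (U1 : lmodType C).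
Local Notation var := ('I_r * nat)%type.
Local Notation mon := {mset var}%mset.
Local Notation mono := (@single C mon U1).
Implicit Types (x : var) (m : mon) (f : M1lam r U1) (w : U1).

Lemma var_mulE x f m : var_mul x f m = if x \in m then f (m `\ x)%mset else 0.
Proof.
have [S [_ f0]] := ffs_supp f.
rewrite /var_mul (@mk_ffsE _ _ _ _ (map (fun m => x +` m)%mset S)) // => m' m'S.
case: ifP => // xm'; apply: f0; apply: contraNN m'S => m'S.
by apply/mapP; exists (m' `\ x)%mset; rewrite ?msetB1K.
Qed.

Lemma var_derivE x f m : var_deriv x f m = f (x +` m)%mset *+ (m x).+1.
Proof.
have [S [_ f0]] := ffs_supp f.
rewrite /var_deriv (@mk_ffsE _ _ _ _ (map (fun m => m `\ x)%mset S)) // => m' m'S.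
rewrite f0 ?mul0rn //; apply: contraNN m'S => m'S.
by apply/mapP; exists (x +` m')%mset; rewrite ?msetD1K.
Qed.

Lemma on_coefsE (t : U1 -> U1) f m : t 0 = 0 -> on_coefs t f m = t (f m).
Proof.
move=> t0; have [S [_ f0]] := ffs_supp f.
by rewrite /on_coefs (@mk_ffsE _ _ _ _ S) // => m' /f0 ->.
Qed.

#[local] Opaque single var_mul var_deriv on_coefs.

Lemma var_mul_lin x : linear (@var_mul C r U1 x).
Proof.
move=> c f g; apply: ffs_ext => m; rewrite ffsDE ffsZE !var_mulE.
by case: ifP => _; rewrite ?ffsDE ?ffsZE // scaler0 addr0.
Qed.

Lemma var_deriv_lin x : linear (@var_deriv C r U1 x).
Proof.
move=> c f g; apply: ffs_ext => m; rewrite ffsDE ffsZE !var_derivE.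
by rewrite ffsDE ffsZE mulrnDl scalerMnr.
Qed.

Lemma on_coefs_lin (t : U1 -> U1) : linear t -> linear (@on_coefs C r U1 t).
Proof.
move=> t_lin c f g; have t0 := lin0 t_lin.
by apply: ffs_ext => m; rewrite ffsDE ffsZE !on_coefsE // ffsDE ffsZE t_lin.
Qed.

Let monoE m w m' : mono m w m' = if m' == m then w else 0.
Proof. exact: singleE. Qed.

Lemma var_mul_single x m w :
  var_mul x (mono m w) = mono (x +` m)%mset w.
Proof.
apply: ffs_ext => m'; apply: etrans (var_mulE _ _ _) (etrans _ (esym (monoE _ _ _))).
rewrite [X in if _ then X else _]monoE; case: ifPn => [xm'|xm'].
  suff -> : (m' `\ x == m)%mset = (m' == x +` m)%mset by [].
  by apply/eqP/eqP => [<-|->]; rewrite ?msetB1K ?msetD1K.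
by case: eqP => // m'E; rewrite m'E mset1D1 in xm'.
Qed.

Lemma var_deriv_single x m w :
  var_deriv x (mono m w) = mono (m `\ x)%mset w *+ m x.
Proof.
apply: ffs_ext => m'; apply: etrans (var_derivE _ _ _) (etrans _ (esym (ffsMnE _ _ _))).
rewrite [X in X *+ _ = _]monoE [X in _ = X *+ _]monoE.
case: (eqVneq (x +` m')%mset m) => [<-|ne].
  by rewrite msetD1K eqxx mset1DE eqxx add1n.
rewrite mul0rn; case: (eqVneq m' (m `\ x)%mset) => [m'E|]; last by rewrite mul0rn.
have [xm|xm] := boolP (x \in m); last by rewrite (mset_eq0P xm).
by rewrite m'E msetB1K ?eqxx in ne.
Qed.

Lemma on_coefs_single (t : U1 -> U1) m w : t 0 = 0 ->
  on_coefs t (mono m w) = mono m (t w).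
Proof.
move=> t0; apply: ffs_ext => m'.
apply: etrans (on_coefsE _ _ t0) (etrans _ (esym (monoE _ _ _))).
by rewrite [X in t X]monoE; case: eqP.
Qed.

Lemma M1lam_ind (P : M1lam r U1 -> Prop) f :
  P 0 -> (forall f g, P f -> P g -> P (f + g)) ->
  (forall w, P (mono mset0 w)) -> (forall x f, P f -> P (var_mul x f)) -> P f.
Proof.
move=> P0 PD P1 Px; apply: (ffs_ind (P := P) f P0 PD) => m w.
rewrite -(seq_mset_id m); elim: (enum_mset m) => [|x t IH].
  suff -> : seq_mset [::] = mset0 :> mon by exact: P1.
  by apply/msetP => x; rewrite mset_seqE mset0E.
have -> : seq_mset (x :: t) = (x +` seq_mset t)%mset :> mon.
  by apply/msetP => y; rewrite mset1DE !mset_seqE /= eq_sym.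
apply: (eq_ind _ P (Px x _ IH)); exact: var_mul_single.
Qed.

End PolynomialCoefficients.

Section FockDecomposition.
Variables (C : numFieldType) (h : vectType C) (form : {symmetric h}).
Variables (L : zmodClosed h) (r s : nat) (al be : r.-tuple h) (us vs : s.-tuple h).
Hypothesis form_nondeg : nondegenerate form.
Hypothesis bases : adapted_bases form L al be us vs.
Variables (eps : lat L -> lat L -> C).
Hypothesis eps_cocycle : is_cocycle form eps.
Variables (W : lmodType C) (H : h -> int -> W -> W) (e : lat L -> int -> W -> W).
Hypothesis R : lat_rep form eps H e.
Hypothesis pairE : forall a b : lat L,
  form (lat_val a) (lat_val b) = (pairing form a b)%:~R.
Variable lam : h.
Hypothesis lam_dual : dual_lattice form L lam.
Variables (U1 : lmodType C) (iota : U1 -> W) (opu opv : 'I_s -> nat -> U1 -> U1).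
Local Notation V := (vacuum_space form al H).
Hypothesis iota_lin : linear iota.
Hypothesis iota_inj : forall w, iota w = 0 -> w = 0.
Hypothesis iota_vac : forall w, iota w \in V lam.
Hypothesis iota_opu : forall j n w, iota (opu j n w) = H (tnth us j) n%:Z (iota w).
Hypothesis iota_opv : forall j n w, iota (opv j n w) = H (tnth vs j) (- n%:Z) (iota w).

Local Notation var := ('I_r * nat)%type.
Local Notation mon := {mset var}%mset.
Local Notation mono := (@single C mon U1).
Local Notation Fock := (M1lam r U1).
Local Notation Z := (Z form e lam).
Local Notation act := (M1lam_act form al be us vs lam opu opv).

Let HH := lr_heis R.
Let H_lin u n : linear (H u n). Proof. exact: (act_lin HH). Qed.

Lemma iota_inj2 u w : iota u = iota w -> u = w.
Proof. by move=> E; apply/eqP; rewrite -subr_eq0; apply/eqP/iota_inj;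
  rewrite (linB iota_lin) E subrr. Qed.

(** Operators on U_1 are known only through [iota], so even their linearity is read off in W. *)
Lemma op_lin (t : U1 -> U1) u n : (forall w, iota (t w) = H u n (iota w)) -> linear t.
Proof. by move=> tE c v w; apply: iota_inj2; rewrite tE !iota_lin H_lin !tE. Qed.

Lemma opu_lin j n : linear (opu j n). Proof. exact: op_lin (iota_opu j n). Qed.
Lemma opv_lin j n : linear (opv j n). Proof. exact: op_lin (iota_opv j n). Qed.

Definition create (x : var) (w : W) : W := H (tnth be x.1) (- x.2.+1%:Z) w.
(** Creation operators commute ([createC]), so the order in which a multiset is enumerated is
    immaterial. *)
Definition creates (t : seq var) (w : W) : W := foldr create w t.

Lemma create_lin x : linear (create x). Proof. exact: H_lin. Qed.

Lemma creates_lin t : linear (creates t).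
Proof. by elim: t => // x t IH c v w /=; rewrite IH create_lin. Qed.

Lemma createC x y w : create x (create y w) = create y (create x w).
Proof. by rewrite /create (actC0 HH) //; apply/eqP; lia. Qed.

Lemma creates_rem x t w : x \in t -> creates t w = create x (creates (rem x t) w).
Proof.
elim: t => //= y t IH; rewrite inE; rewrite [y == x]eq_sym; case: eqVneq =>
  [->//|xy] /= /IH ->.
by rewrite createC.
Qed.

Lemma creates_perm t t' w : perm_eq t t' -> creates t w = creates t' w.
Proof.
elim: t t' => [|x t IH] t' tt'.
  by have := perm_size tt'; case: t' tt'.
have xt' : x \in t' by rewrite -(perm_mem tt') mem_head.
rewrite (creates_rem _ xt') /= (IH (rem x t')) //.
by rewrite -(perm_cons x) (perm_trans tt') // perm_to_rem.
Qed.

Lemma creates_comm u n t w : (forall x : var, x \in t ->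
    n - x.2.+1%:Z = 0 -> form u (tnth be x.1) = 0) ->
  H u n (creates t w) = creates t (H u n w).
Proof.
elim: t => //= x t IH xt; rewrite {1}/create (actC HH) IH => [|y yt].
  case: eqP => [/xt ->|]; rewrite ?mem_head ?mulr0 //= scale0r addr0 //.
by apply: xt; rewrite inE yt orbT.
Qed.

(** al_i(p+1) has commutator p+1 with be_i(-p-1), commutes with the other creation operators and
    kills [w]; hence it acts as p+1 times a partial derivative. *)
Lemma creates_al i (p : nat) t w mu : w \in V mu ->
  H (tnth al i) p.+1 (creates t w) =
  (p.+1 * count_mem (i, p) t)%:R *: creates (rem (i, p) t) w.
Proof.
move=> wV; elim: t => /= [|x t IH].
  by rewrite muln0 scale0r; case/asboolP: wV => -> .
rewrite {1}/create (actC HH) IH -/(create x _) (linZ (create_lin x)) (form_al_be bases).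
rewrite (_ : (p.+1%:Z - x.2.+1%:Z == 0) = (x.2 == p)); last by apply/eqP/eqP; lia.
case: x => j q /=; rewrite xpair_eqE; have [->|_] /= := eqVneq q p; last first.
  by rewrite andbF add0n scale0r addr0.
rewrite andbT eq_sym; have [->|ji] /= := eqVneq j i; last first.
  by rewrite mulr0 scale0r addr0.
rewrite mulr1 mulnDr muln1 natrD scalerDl addrC; congr (_ + _).
have [it|it] := boolP ((i, p) \in t); first by rewrite -creates_rem.
by rewrite (count_memPn it) muln0 !scale0r.
Qed.

Lemma perm_mset1D (x : var) (m : mon) :
  perm_eq (enum_mset (x +` m)%mset) (x :: enum_mset m).
Proof.
apply/eq_seq_msetP; rewrite seq_mset_id; apply/msetP => y.
by rewrite mset1DE mset_seqE /= count_mem_mset eq_sym.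
Qed.

Let fock_gen a (m : mon) (w : U1) : W := creates (enum_mset m) (Z a (iota w)).

Let fock_gen_lin a m : linear (fock_gen a m).
Proof. by move=> c u w; rewrite /fock_gen iota_lin (Z_lin R) creates_lin. Qed.

Definition fock (a : lat L) : Fock -> W := ffs_lift (fock_gen a).

Lemma fock_lin a : linear (fock a).
Proof. exact: ffs_lift_lin (fock_gen_lin a). Qed.

Lemma fock_single a m w : fock a (mono m w) = creates (enum_mset m) (Z a (iota w)).
Proof. exact: (ffs_lift_single (fock_gen_lin a)). Qed.

Lemma Z_iota_vacuum a w : Z a (iota w) \in V (lam + lat_val a).
Proof. exact: (Z_vacuum bases R lam_dual). Qed.

Lemma fock_var_mul a x F : fock a (var_mul x F) = create x (fock a F).
Proof.
move: F; apply: (@ffs_lin_ext C mon U1 W) => [c u v|c u v|m w].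
- by rewrite var_mul_lin fock_lin.
- by rewrite fock_lin create_lin.
apply: etrans (congr1 (fock a) (var_mul_single x m w)) _.
apply: etrans (fock_single _ _ _) (etrans _ (congr1 (create x) (esym (fock_single _ _
  _)))).
exact: creates_perm (perm_mset1D x m).
Qed.

Lemma fock_var_deriv a i p F :
  fock a (var_deriv (i, p) F *+ p.+1) = H (tnth al i) p.+1 (fock a F).
Proof.
rewrite (linMn (fock_lin a)); move: F; apply: (@ffs_lin_ext C mon U1 W) =>
  [c u v|c u v|m w].
- by rewrite var_deriv_lin fock_lin mulrnDl scalerMnr.
- by rewrite fock_lin H_lin.
have E1 : fock a (var_deriv (i, p) (mono m w)) =
    creates (enum_mset (m `\ (i, p))%mset) (Z a (iota w)) *+ m (i, p).
  apply: etrans (congr1 (fock a) (var_deriv_single (i, p) m w)) _.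
  apply: etrans (linMn (fock_lin a) _ _) _.
  exact: (congr1 (fun x => x *+ _) (fock_single _ _ _)).
have E2 : H (tnth al i) p.+1 (fock a (mono m w)) =
    (p.+1 * count_mem (i, p) (enum_mset m))%:R *:
      creates (rem (i, p) (enum_mset m)) (Z a (iota w)).
  apply: etrans (congr1 (H _ _) (fock_single a m w)) _.
  exact: (creates_al _ _ _ (Z_iota_vacuum a w)).
apply: etrans (congr1 (fun x => x *+ p.+1) E1) (etrans _ (esym E2)).
rewrite -mulrnA scaler_nat mulnC -count_mem_mset.
have [xm|xm] := boolP ((i, p) \in enum_mset m); last first.
  by rewrite (count_memPn xm) !muln0 !mulr0n.
congr (_ *+ _); apply: creates_perm.
rewrite -(perm_cons (i, p)) -(permPr (perm_to_rem xm)).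
by rewrite -(permPl (perm_mset1D _ _)) msetB1K.
Qed.

(** Covers u_j(n) and v_j(-n) together: either alternative in the last hypothesis makes [H u n]
    commute with the creation operators. *)
Lemma fock_on_coefs a (t : U1 -> U1) u n F : (forall w, iota (t w) = H u n (iota w)) ->
  (forall w, H u n (Z a (iota w)) = Z a (H u n (iota w))) ->
  (forall i, form u (tnth be i) = 0 \/ n <= 0) ->
  fock a (on_coefs t F) = H u n (fock a F).
Proof.
move=> tE uZ ube; have t_lin := op_lin tE; move: F.
apply: (@ffs_lin_ext C mon U1 W) => [c u' v|c u' v|m w].
- by rewrite on_coefs_lin // fock_lin.
- by rewrite fock_lin H_lin.
apply: etrans (congr1 (fock a) (on_coefs_single m w (lin0 t_lin))) _.
apply: etrans (fock_single _ _ _) (etrans _ (congr1 (H u n) (esym (fock_single a m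
  w)))).
rewrite tE creates_comm => [|x _ nx]; first by rewrite uZ.
by case: (ube x.1) => //; lia.
Qed.

Lemma fock_opu a j (n : nat) F : (0 < n)%N ->
  fock a (on_coefs (opu j n) F) = H (tnth us j) n%:Z (fock a F).
Proof.
move=> n0; apply: fock_on_coefs => [w|w|i]; first exact: iota_opu.
  rewrite /Z (lr_comm R) (vacuum_space_mode_gt bases R lam_dual (iota_vac w)) ?scaler0
    ?addr0 //.
  by lia.
by left; exact: (form_us_be bases).
Qed.

Lemma fock_opv a j (n : nat) F :
  fock a (on_coefs (opv j n) F) = H (tnth vs j) (- n%:Z) (fock a F).
Proof.
apply: fock_on_coefs => [w|w|i]; first exact: iota_opv.
  by rewrite (Z_act R) // formC (lat_vs bases).
by right; lia.
Qed.

(** The mode n = 0 is excluded because the weight on the summand of e^a is lam + a, whereas [act]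
    uses lam. *)
Lemma fock_act a u n F : n != 0 -> fock a (act u n F) = H u n (fock a F).
Proof.
case: n => [[|p]|p] // _.
  rewrite (H_expand_al_us bases R) /= (linD (fock_lin a)) !(lin_sum (fock_lin a)).
  congr (_ + _); apply: eq_bigr => i _; rewrite (linZ (fock_lin a)).
    by rewrite fock_var_deriv.
  by rewrite fock_opu.
rewrite (H_expand_be_vs bases R form_nondeg) /= (linD (fock_lin a)) !(lin_sum (fock_lin
  a)).
congr (_ + _); apply: eq_bigr => i _; rewrite (linZ (fock_lin a)).
  by rewrite fock_var_mul /create NegzE.
by rewrite fock_opv NegzE.
Qed.

Lemma fock_weight a u F : H u 0 (fock a F) = form (lam + lat_val a) u *: fock a F.
Proof.
move: F; apply: (@ffs_lin_ext C mon U1 W) => [c v w|c v w|m w].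
- by rewrite fock_lin H_lin.
- by rewrite fock_lin scalerDr !scalerA mulrC.
rewrite fock_single creates_comm => [|x _]; last by lia.
have /asboolP[_ ->] := Z_iota_vacuum a w.
by rewrite (linZ (creates_lin _)).
Qed.

(** Induction on a bound for the degree. Derivatives of F are again killed and have lower degree,
    hence vanish; in characteristic zero so do the top coefficients of F. On constants Z_a and
    [iota] are injective. *)
Lemma fock_inj a F : fock a F = 0 -> F = 0.
Proof.
have [S [S_uniq F0]] := ffs_supp F.
have {}F0 : forall m : mon, (\max_(m <- S) size (enum_mset m) < size (enum_mset m))%N
  -> F m = 0.
  move=> m mS; apply: F0; apply: contraL mS => mS; rewrite -leqNgt.
  exact: (leq_bigmax_seq _ mS).
move: (\max_(m <- S) _) F0 => d; elim: d F {S S_uniq} => [|d IH] F Fd F0.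
  have Fm (m : mon) : m != mset0 -> F m = 0.
    move=> m0; apply: Fd; rewrite lt0n size_eq0; apply: contraNneq m0 => mE.
    by rewrite -(seq_mset_id m) mE; apply/eqP/msetP => y; rewrite mset_seqE mset0E.
  have FE : F = mono mset0 (F mset0).
    apply: ffs_ext => m; apply: etrans _ (esym (singleE _ _ _)).
    by case: eqVneq => [->//|/Fm].
  suff Fm0 : F mset0 = 0 by rewrite FE Fm0; apply: single0.
  have := F0; rewrite {1}FE fock_single enum_mset0 /= => Z0F.
  apply: iota_inj.
  exact: (Z_inj bases eps_cocycle R pairE lam_dual (iota_vac _) Z0F).
have dF0 x : var_deriv x F = 0.
  case: x => i p; apply: IH => [m md|].
    rewrite var_derivE Fd ?mul0rn //.
    by rewrite (perm_size (perm_mset1D _ _)).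
  have := fock_var_deriv a i p F; rewrite F0 (act0 HH) (linMn (fock_lin a)).
  by move/eqP; rewrite -scaler_nat scaler_eq0 pnatr_eq0 => /eqP.
apply: IH => // m md.
have [x xm] : exists x, x \in enum_mset m.
  by case: (enum_mset m) md => // x t _; exists x; rewrite mem_head.
have := congr1 (fun G : ffs mon U1 => G (m `\ x)%mset) (dF0 x).
rewrite var_derivE msetB1K // ffs0E => /eqP.
by rewrite -scaler_nat scaler_eq0 pnatr_eq0 => /eqP.
Qed.

Definition fockL : latV L Fock -> W := ffs_lift fock.

Lemma fockL_lin : linear fockL.
Proof. exact: ffs_lift_lin fock_lin. Qed.

Lemma fockL_single a F : fockL (single a F) = fock a F.
Proof. exact: (ffs_lift_single fock_lin). Qed.

(** Independence of eigenvectors: applying H u 0 minus its eigenvalue on the first vector shortens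
    the relation, with u chosen by nondegeneracy to separate two weights. *)
Lemma weight_indep (S : seq (lat L)) (w : lat L -> W) : uniq S ->
  (forall a u, H u 0 (w a) = form (lam + lat_val a) u *: w a) ->
  \sum_(a <- S) w a = 0 -> forall a, a \in S -> w a = 0.
Proof.
elim: S w => // a S IH w /= /andP[aS S_uniq] wH; rewrite big_cons => w0.
have wS b : b \in S -> w b = 0.
  move=> bS; have ab : lat_val b - lat_val a != 0.
    by rewrite subr_eq0; apply: contraNneq aS => /val_inj <-.
  have [u uab] : exists u, form (lat_val b - lat_val a) u != 0.
    apply: contrapT => nu; case/eqP: ab; apply: (form_eq0 form_nondeg) => v.
    by rewrite formC; apply: contrapT => /eqP vab; apply: nu; exists v.
  have := IH (fun b => form (lat_val b - lat_val a) u *: w b) S_uniq.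
  move=> /(_ _ _ _ bS)/eqP; rewrite scaler_eq0 (negPf uab) => /(_ _ _)/eqP; apply.
    by move=> c v; rewrite (linZ (H_lin _ _)) wH !scalerA mulrC.
  have := congr1 (fun x => H u 0 x - form (lam + lat_val a) u *: x) w0.
  rewrite (act0 HH) scaler0 subr0 (linD (H_lin _ _)) wH scalerDr opprD addrACA subrr
    add0r.
  rewrite (lin_sum (H_lin _ _)) scaler_sumr -sumrB => E; apply: etrans E;
    apply: eq_bigr => c _.
  by rewrite wH -scalerBl -(formNl form (lam + _)) -formDl; congr (form _ _ *: _);
    rewrite opprD addrACA subrr add0r.
move=> b; rewrite inE => /predU1P[->|/wS//].
by move: w0; rewrite big_seq big1 ?addr0.
Qed.

Lemma fockL_inj F : fockL F = 0 -> F = 0.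
Proof.
have [S [S_uniq F0]] := ffs_supp F.
rewrite /fockL (ffs_lift_seq fock_lin S_uniq F0) => SF.
apply: ffs_ext => a; have [aS|/F0//] := boolP (a \in S).
apply: (@fock_inj a); apply: (@weight_indep S (fun a => fock a (F a))) => // b u.
exact: fock_weight.
Qed.

(** Commuting e^a past be_i(-q) costs a multiple of another mode of e^a on the shorter product, so
    induction on [t] reduces to Z_b w, where e^a gives E^-(-a,x) Z_(a+b) w up to the cocycle. *)
Lemma e_creates_closed (S : {pred W}) : submod_closed S ->
  (forall u n w, n < 0 -> w \in S -> H u n w \in S) ->
  forall a n t b w, Z (a + b) (iota w) \in S -> e a n (creates t (Z b (iota w))) \in S.
Proof.
move=> S_sub SH a n t b w ZS; elim: t n => /= [|x t IH] n.
  rewrite (vacuum_space_mode bases R (dual_latticeD pairE b lam_dual) _ _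
    (Z_iota_vacuum b w)).
  rewrite (ZZ bases R pairE lam_dual) // (linZ (Eminus_lin HH _ _)).
  apply: smcZ => //; apply: (Eminus_closed _ S_sub) => // m v m0; exact: SH.
have := lr_comm R (tnth be x.1) a (- x.2.+1%:Z) n (creates t (Z b (iota w))).
move=> /esym/(canRL (addrK _)) E; rewrite {1}/create E; apply: smcB => //.
  by apply: SH => //; lia.
exact: smcZ.
Qed.

Section SubL1.
Variable P : {pred U1}.
Hypothesis P_sub : submod_closed P.
Hypothesis P_opu : forall j n w, (0 < n)%N -> w \in P -> opu j n w \in P.
Hypothesis P_opv : forall j n w, (0 < n)%N -> w \in P -> opv j n w \in P.

(** The image of C[L] (x) M_0(1) (x) P for an L_1-submodule P of U_1. Taking P to be everything
    gives surjectivity, taking P arbitrary gives irreducibility of U_1. *)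
Definition fock_span : {pred W} := fun w =>
  `[< exists F : latV L Fock, (forall a m, F a m \in P) /\ fockL F = w >].

Lemma fock_span_submod : submod_closed fock_span.
Proof.
split=> [|c u v /asboolP[F [FP <-]] /asboolP[G [GP <-]]]; apply/asboolP.
  by exists 0; split=> [a m|]; [exact: smc0|exact: lin0 fockL_lin].
exists (c *: F + G); split=> [a m|]; last exact: fockL_lin.
exact: (smcD P_sub (smcZ P_sub c (FP a m)) (GP a m)).
Qed.

Lemma creates_in_span a t w : w \in P -> creates t (Z a (iota w)) \in fock_span.
Proof.
move=> wP; apply/asboolP; exists (single a (mono (seq_mset t) w)); split=> [b m|].
  rewrite singleE; case: eqP => _; last exact: smc0.
  have -> : mono (seq_mset t) w m = if m == seq_mset t then w else 0 by exact: singleE.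
  by case: eqP => _ //; apply: smc0.
by rewrite fockL_single fock_single (creates_perm _ (perm_eq_seq_mset t)).
Qed.

Lemma fock_span_closed (t : W -> W) : linear t ->
  (forall a l w, w \in P -> t (creates l (Z a (iota w))) \in fock_span) ->
  forall w, w \in fock_span -> t w \in fock_span.
Proof.
move=> t_lin tP w /asboolP[F [FP <-]].
have S_sub := fock_span_submod.
pose Q (G : latV L Fock) := t (fockL G) \in fock_span.
apply: (ffs_ind_coef (P := Q)) => [|G G' QG QG'|a].
- by rewrite /Q (lin0 fockL_lin) (lin0 t_lin); apply: smc0.
- by rewrite /Q (linD fockL_lin) (linD t_lin); apply: smcD.
rewrite /Q fockL_single.
pose Q' (G : Fock) := t (fock a G) \in fock_span.
apply: (ffs_ind_coef (P := Q')) => [|G G' QG QG'|m].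
- by rewrite /Q' (lin0 (fock_lin a)) (lin0 t_lin); apply: smc0.
- by rewrite /Q' (linD (fock_lin a)) (linD t_lin); apply: smcD.
by rewrite /Q' fock_single; apply: tP.
Qed.

Lemma fock_span_H u n w : w \in fock_span -> H u n w \in fock_span.
Proof.
have S_sub := fock_span_submod.
move: w; apply: fock_span_closed => [|a l w wP]; first exact: H_lin.
have := fock_single a (seq_mset l) w.
rewrite (creates_perm _ (perm_eq_seq_mset l)) => <-.
case: n => [[|p]|p].
- rewrite fock_weight; apply: smcZ => //.
  by rewrite fock_single; apply: creates_in_span.
- rewrite (H_expand_al_us bases R); apply: smcD => //; apply: smc_sum => // i _;
  apply: smcZ => //.
    rewrite fock_single (creates_al _ _ _ (Z_iota_vacuum a w)).
    by apply: smcZ => //; apply: creates_in_span.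
  rewrite -fock_opu // on_coefs_single ?(lin0 (opu_lin _ _)) // fock_single.
  by apply: creates_in_span; apply: P_opu.
rewrite (H_expand_be_vs bases R form_nondeg); apply: smcD => //; apply: smc_sum =>
  // i _; apply: smcZ => //.
  rewrite fock_single NegzE -[H _ _ _]/(creates ((i, p) :: _) _).
  exact: creates_in_span.
rewrite NegzE -fock_opv on_coefs_single ?(lin0 (opv_lin _ _)) // fock_single.
by apply: creates_in_span; apply: P_opv.
Qed.

Lemma fock_span_e a n w : w \in fock_span -> e a n w \in fock_span.
Proof.
have S_sub := fock_span_submod.
move: w; apply: fock_span_closed => [|b l w wP]; first exact: (lr_lin R).
apply: e_creates_closed => // [u k v _|]; first exact: fock_span_H.
exact: (creates_in_span _ [::]).
Qed.

Hypothesis W_irr : forall S : {pred W}, submod_closed S ->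
  (forall u n w, w \in S -> H u n w \in S) ->
  (forall a n w, w \in S -> e a n w \in S) -> S =i pred1 0 \/ S =i predT.

(** If the image of P is all of W, then [iota w] comes from an element with coefficients in P; by
    injectivity that element is the constant w, so w lies in P. *)
Lemma fock_span_irr : P =i pred1 0 \/ P =i predT.
Proof.
have [X0|XT] := W_irr fock_span_submod fock_span_H fock_span_e; [left|right] => w.
  rewrite inE; apply/idP/eqP => [wP|->]; last exact: smc0.
  have := creates_in_span 0 [::] wP; rewrite X0 inE /= => /eqP Zw.
  by apply: iota_inj; rewrite -(Z0 R lam (iota w)).
have := XT (iota w); rewrite [RHS]inE => /asboolP[F [FP Fw]].
have E : fockL (single 0 (mono mset0 w)) = iota w.
  by rewrite fockL_single fock_single enum_mset0 /= (Z0 R).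
have FG : F = single 0 (mono mset0 w).
  apply/eqP; rewrite -subr_eq0; apply/eqP/fockL_inj.
  by rewrite (linB fockL_lin) Fw E subrr.
have := FP 0 mset0; rewrite FG singleE eqxx.
by have -> : mono mset0 w mset0 = w by apply: etrans (singleE _ _ _) _; rewrite eqxx.
Qed.

Lemma fockL_surj w0 : w0 \in P -> w0 != 0 -> forall w, exists F, fockL F = w.
Proof.
move=> w0P w00 w; have [X0|XT] := W_irr fock_span_submod fock_span_H fock_span_e.
  have := creates_in_span 0 [::] w0P; rewrite X0 inE /= (Z0 R) => /eqP/iota_inj w0E.
  by rewrite w0E eqxx in w00.
by have := XT w; rewrite [RHS]inE => /asboolP[F [_ Fw]]; exists F.
Qed.

End SubL1.

End FockDecomposition.

(** * Intertwining *)

Section LatticeCoefficients.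
Variables (C : numFieldType) (h : vectType C) (form : {symmetric h}).
Variables (L : zmodClosed h).
Variables (YM : M1 form -> int -> M1 form -> M1 form).
Variables (U : lmodType C) (act : h -> int -> U -> U) (YU : M1 form -> int -> U -> U).
Hypothesis YM_va : is_M1_va YM.
Hypothesis act_heis : heis form act.
Hypothesis YU_mod : is_M1_module_of YM act YU.
Variable lam : h.
Hypothesis act0E : forall u w, act u 0 w = form lam u *: w.
Hypothesis lam_dual : dual_lattice form L lam.
Hypothesis act_fin : forall (a : lat L) w, w \in Eplus_finite act (lat_val a).

Local Notation M1_act := (@M1_act C h form).
Local Notation vac := (M1_vac form).
Local Notation lc a b v w n := (lat_coef act YU a b v w (- n - 1)).
Local Notation bt := (box_term act YU lam).
Local Notation bx := (box act YU lam).
Implicit Types (a b : lat L).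

Let YU_va : is_va_module vac YM YU. Proof. by case: YU_mod. Qed.

Lemma act_trunc_ev u w : ev (fun N => forall n : int, N%:Z <= n -> act u n w = 0).
Proof.
apply: ev_imp (vm_trunc_ev YU_va (M1_of form u) w 0) => N N0 n Nn.
by rewrite -(proj2 YU_mod) N0 //; lia.
Qed.

Lemma YU_act_neg_ev u (q : nat) v n w : (0 < q)%N ->
  ev (fun S => YU (M1_act u (- q%:Z) v) n w =
  \sum_(i < S) ((-1) ^+ i * binomz C (- q%:Z) i) *:
     (act u (- q%:Z - i%:Z) (YU v (n + i%:Z) w) -
      (-1) ^ (- q%:Z) *: YU v (n - q%:Z - i%:Z) (act u i w))).
Proof.
move=> q0; have YM_mod : is_va_module vac YM YM by case: YM_va => [[]].
have [S0 S0E] := ev_and (vm_trunc_ev YU_va v w n) (act_trunc_ev u w).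
exists S0 => S /S0E[Sx Sh].
have Sx' (i : nat) : (S <= i)%N -> YU v (n + i%:Z) w = 0 by move=> Si; apply: Sx; lia.
have Su (i : nat) : (S <= i)%N -> YU (M1_of form u) i w = 0.
  by move=> Si; rewrite (proj2 YU_mod); apply: Sh; lia.
rewrite -(proj2 YM_va); apply: etrans (vm_iterate YU_va Sx' Su _) _.
  have [N Nx] := ev_witness (vm_trunc_ev YM_mod (M1_of form u) v (- q%:Z)).
  by exists N => i Ni; apply: Nx; lia.
by apply: eq_bigr => i _; rewrite !(proj2 YU_mod).
Qed.

Let sum3 (F : nat -> nat -> nat -> U) (N : nat) : U :=
  \sum_(i < N) \sum_(j < N) \sum_(m < N) F i j m.

Let sum3_sub (F G : nat -> nat -> nat -> U) N :
  sum3 (fun i j m => F i j m - G i j m) N = sum3 F N - sum3 G N.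
Proof.
rewrite /sum3 -sumrB; apply: eq_bigr => i _; rewrite -sumrB; apply: eq_bigr => j _.
by rewrite -sumrB.
Qed.

Let sum3_lin (t : U -> U) (F : nat -> nat -> nat -> U) N : linear t ->
  t (sum3 F N) = sum3 (fun i j m => t (F i j m)) N.
Proof.
move=> t_lin; rewrite /sum3 (lin_sum t_lin); apply: eq_bigr => i _.
by rewrite (lin_sum t_lin); apply: eq_bigr => j _; rewrite (lin_sum t_lin).
Qed.

Let sum3_exchange (F : nat -> nat -> nat -> nat -> U) N S :
  sum3 (fun i j m => \sum_(s < S) F s i j m) N = \sum_(s < S) sum3 (F s) N.
Proof.
rewrite /sum3 [RHS]exchange_big /=; apply: eq_bigr => i _.
rewrite [RHS]exchange_big /=; apply: eq_bigr => j _.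
by rewrite [RHS]exchange_big.
Qed.

Let sum3_eq (F G : nat -> nat -> nat -> U) N :
  (forall i j m, (i < N)%N -> (j < N)%N -> (m < N)%N -> F i j m = G i j m) ->
  sum3 F N = sum3 G N.
Proof.
move=> FG; apply: eq_bigr => i _; apply: eq_bigr => j _; apply: eq_bigr => m _.
exact: FG.
Qed.

Let shift_sum (F : nat -> U) q N : (forall j, (N - q <= j)%N -> F j = 0) ->
  \sum_(j < N) (if (q <= j)%N then F (j - q)%N else 0) = \sum_(j < N) F j.
Proof.
move=> F0; have [qN|Nq] := leqP q N; last first.
  rewrite !big1 // => j _; first by apply: F0; lia.
  by rewrite ifF //; have := ltn_ord j; lia.
rewrite -(big_mkord xpredT (fun j => if (q <= j)%N then F (j - q)%N else 0)).
rewrite (big_cat_nat (n := q)) //= big_nat big1 ?add0r => [|j /andP[_ jq]]; last first.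
  by rewrite ifF //; lia.
rewrite -{1}[q]add0n big_addn (sum_ord_widen (N := N - q)) // ?leq_subr //.
by rewrite big_mkord; apply: eq_bigr => j _; rewrite leq_addl addnK.
Qed.

(** Creation operators commute with [E^-(-a,x)] and annihilation operators with
    [Delta(a,-x)], so that the normally ordered product passes through; the extra
    term at [i = 0] comes from commuting [u(-q)] with [Delta(b,x)]. *)
Lemma lat_coef_iterate u (q : nat) a b v w n : (0 < q)%N ->
  ev (fun S => lc a b (M1_act u (- q%:Z) v) w n =
  \sum_(i < S) ((-1) ^+ i * binomz C (- q%:Z) i) *:
     (act u (- q%:Z - i%:Z) (lc a b v w (n + i%:Z)) -
      (-1) ^ (- q%:Z) *: lc a b v
        (act u i w + (if i == 0%N :> nat then form u (lat_val b) else 0) *: w)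
        (n - q%:Z - i%:Z))).
Proof.
move=> q0; set p := int_of (form (lat_val a) (lat_val b)).
set c := int_of (form lam (lat_val a)).
have [S1 S1u] := ev_witness (act_trunc_ev u w).
have box_ev v' w' n0 := lat_coef_box act_heis YU_mod act0E lam_dual act_fin a b v' w'
  n0.
(* One box for all the modes involved: the left side, the modes n + i, the mode n - q, the finitely
   many u(s) w that can be nonzero, and the vanishing needed to shift j by q. *)
have [N [[[[N1 N2] N3] N4] N5]] := ev_witness
  (ev_and (ev_and (ev_and (ev_and
    (box_ev (M1_act u (- q%:Z) v) w n) (box_ev v w n)) (box_ev v w (n - q%:Z)))
    (ev_all_lt S1 (fun s => box_ev v (act u s w) (n - q%:Z - s%:Z))))
    (ev_shift q (box_term_eq0 act_heis YU_mod lam act_fin a b v w (n - q%:Z)))).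
pose Q j := Eplus M1_act (- lat_val b) (- j%:Z) v.
pose P (m : nat) := Eplus act (- lat_val a) (- m%:Z) w.
pose t (i j m : nat) : int := n + p + c + i%:Z - j%:Z - m%:Z.
have [S0 S0P] := (ev_and (ev_all_lt N (fun i => ev_all_lt N (fun j =>
   ev_all_lt N (fun m => YU_act_neg_ev u (Q j) (t i j m) (P m) q0)))) (ev_ge S1.+1)).
exists S0 => S /S0P[SS S1S].
pose cf (i : nat) : C := (-1) ^+ i * binomz C (- q%:Z) i.
pose T1 (i j m : nat) := (-1) ^+ j *: Eminus act (- lat_val a) i
  (YU (M1_act u (- q%:Z) (Q j)) (t i j m) (P m)).
pose T2 (i j m : nat) := form u (lat_val b) *: ((-1) ^+ j *: Eminus act (- lat_val a) i
  (YU (Eplus M1_act (- lat_val b) (- j%:Z + q%:Z) v) (t i j m) (P m))).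
have btE (i j m : nat) : bt a b (M1_act u (- q%:Z) v) w n i j m = T1 i j m - T2 i j m.
  rewrite /box_term -/p -/c -/(P m) -/(t i j m).
  have /esym/(canRL (addrK _)) -> :=
    Eplus_act (M1_heis form) (lat_val b) (- j%:Z) u v q0.
  rewrite (linB (vm_linl YU_va _ _)) (linZ (vm_linl YU_va _ _)) (linB (Eminus_lin
    act_heis _ _)).
  by rewrite (linZ (Eminus_lin act_heis _ _)) scalerBr /T1 /T2 /Q !scalerA [form _ _ *
    _]mulrC.
have T1E (i j m : nat) : (i < N)%N -> (j < N)%N -> (m < N)%N -> T1 i j m =
    \sum_(k < S) cf k *: (act u (- q%:Z - k%:Z) (bt a b v w (n + k%:Z) i j m) -
       (-1) ^ (- q%:Z) *: bt a b v (act u k w) (n - q%:Z - k%:Z) i j m).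
  move=> iN jN mN; rewrite /T1 (SS i iN j jN m mN).
  rewrite (lin_sum (Eminus_lin act_heis _ _)) scaler_sumr; apply: eq_bigr => k _.
  rewrite (linZ (Eminus_lin act_heis _ _)) scalerA mulrC -scalerA; congr (_ *: _).
  rewrite (linB (Eminus_lin act_heis _ _)) (linZ (Eminus_lin act_heis _ _)).
  rewrite /box_term -(Eminus_act_le0 act_heis); last by lia.
  rewrite (Eplus_act_ge0 act_heis) // scalerBr -(linZ (act_lin act_heis _ _)).
  rewrite [(-1) ^+ j *: (_ *: _)]scalerA [(-1) ^+ j * _]mulrC -scalerA.
  rewrite -/p -/c.
  have -> : n + k%:Z + p + c + i%:Z - j%:Z - m%:Z = t i j m + k%:Z by rewrite /t; lia.
  by have -> : n - q%:Z - k%:Z + p + c + i%:Z - j%:Z - m%:Z = t i j m - q%:Z - k%:Z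
    by rewrite /t; lia.
(* Reindexing j as j - q: the terms with j < q vanish since E^+ has no positive powers, and [N5]
   disposes of the top q values. *)
have T2E : sum3 T2 N =
    (-1) ^ (- q%:Z) *: (form u (lat_val b) *: lc a b v w (n - q%:Z)).
  pose t2 (x : U) := (-1) ^ (- q%:Z) *: (form u (lat_val b) *: x).
  have t2_lin : linear t2.
    by move=> k x y; rewrite /t2 !scalerDr !scalerA; congr (_ *: _ + _); ring.
  rewrite N3 // -[RHS]/(t2 (bx _ _ _ _ _ _)) (sum3_lin _ _ t2_lin).
  apply: eq_bigr => i _; rewrite [LHS]exchange_big [RHS]exchange_big /=.
  apply: eq_bigr => m _.
  have F0 j : (N - q <= j)%N -> t2 (bt a b v w (n - q%:Z) i j m) = 0.
    by move=> Nj; rewrite N5 ?(lin0 t2_lin) // Nj orbT.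
  apply: etrans _ (shift_sum F0).
  apply: eq_bigr => j _; case: ifPn => [qj|]; last first.
    rewrite -ltnNge => jq; rewrite /T2 Eplus_gt0; last by lia.
    by rewrite (lin0 (vm_linl YU_va _ _)) (lin0 (Eminus_lin act_heis _ _)) !scaler0.
  rewrite /T2 /t2 /box_term !scalerA [_ * form _ _]mulrC -!mulrA; congr (_ * _ *: _).
    rewrite -exprz_inv invrN1 -{1}(subnKC qj) exprD; congr (_ * _).
  rewrite -/p -/c (_ : - (j - q)%N%:Z = - j%:Z + q%:Z); last by lia.
  by have -> : n - q%:Z + p + c + i%:Z + (- j%:Z + q%:Z) - m%:Z = t i j m by rewrite
    /t; lia.
have scale_lin (x : C) : linear (fun y : U => x *: y).
  by move=> z y y'; rewrite scalerDr !scalerA mulrC.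
have E1 (k : nat) : sum3 (fun i j m =>
    cf k *: (act u (- q%:Z - k%:Z) (bt a b v w (n + k%:Z) i j m) -
       (-1) ^ (- q%:Z) *: bt a b v (act u k w) (n - q%:Z - k%:Z) i j m)) N =
    cf k *: (act u (- q%:Z - k%:Z) (bx a b v w (n + k%:Z) N) -
       (-1) ^ (- q%:Z) *: bx a b v (act u k w) (n - q%:Z - k%:Z) N).
  rewrite -(sum3_lin _ _ (scale_lin (cf k))) sum3_sub -(sum3_lin _ _ (act_lin act_heis
    _ _)).
  by rewrite -(sum3_lin _ _ (scale_lin _)).
have lc_lin k := lat_coef_linr act_heis YU_mod act0E lam_dual act_fin a b v k.
rewrite N1 //; apply: etrans (sum3_eq (fun i j m _ _ _ => btE i j m)) _.
pose F k i j m :=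
  cf k *: (act u (- q%:Z - k%:Z) (bt a b v w (n + k%:Z) i j m) -
    (-1) ^ (- q%:Z) *: bt a b v (act u k w) (n - q%:Z - k%:Z) i j m).
have T1S : sum3 T1 N = \sum_(k < S) sum3 (F k) N.
  apply: etrans (sum3_eq T1E) _; exact: (sum3_exchange F).
rewrite sum3_sub T2E T1S; under eq_bigr do rewrite E1.
(* This correction is exactly the i = 0 term of the stated sum, as binom(-q,0) = 1. *)
have -> : (-1) ^ (- q%:Z) *: (form u (lat_val b) *: lc a b v w (n - q%:Z)) =
    \sum_(k < S) cf k *: ((-1) ^ (- q%:Z) *:
      ((if k == 0%N :> nat then form u (lat_val b) else 0) *: lc a b v w (n - q%:Z -
        k%:Z))).
  have [S' ->] : exists S', S = S'.+1 by exists S.-1; lia.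
  rewrite big_ord_recl big1 => [|k _]; last by rewrite scale0r !scaler0.
  by rewrite /cf binomz_l0 mulr1 scale1r subr0 addr0.
rewrite -sumrB; apply: eq_bigr => k _ /=.
rewrite (linD (lc_lin _)) (linZ (lc_lin _)) (N2 (n + k%:Z)) ?lerDl // -scalerBr;
  congr (_ *: _).
rewrite [in RHS]scalerDr [in RHS]opprD [RHS]addrA; congr (_ - _ *: _ - _).
have [kS1|S1k] := ltnP k S1; first by rewrite (N4 k kS1) // lexx.
rewrite S1u ?lez_nat // (lin0 (lc_lin _));
  apply: lin0 (box_linr act_heis YU_mod _ _ _ _ _ _).
Qed.

Local Notation p a b := (pairing form a b).
Local Notation c a := (wt form lam a).

(** On v = 1 only the mode -1 of Y_U survives, which fixes i in terms of m. *)
Lemma lat_coef_vac a b w n : ev (fun N => lc a b vac w n =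
  \sum_(m < N) Eminus act (- lat_val a) (m%:Z - n - p a b - c a - 1)
     (Eplus act (- lat_val a) (- m%:Z) w)).
Proof.
have /asboolP[M Mw] := act_fin a w.
have [N0 N0P] := ev_and (lat_coef_box act_heis YU_mod act0E lam_dual act_fin a b vac w
  n)
  (ev_ge (M + `|(n + p a b + c a + 1)%R|).+1).
exists N0 => -[|N] /N0P[/(_ n (lexx _)) -> // MN].
pose k0 : int := n + p a b + c a + 1.
have btE i m : \sum_(j < N.+1) bt a b vac w n i j m =
    if i%:Z == m%:Z - k0 then
      Eminus act (- lat_val a) i (Eplus act (- lat_val a) (- m%:Z) w) else 0.
  have vacE (j : nat) : Eplus M1_act (- lat_val b) (- j%:Z) vac = if j == 0%N then vac
    else 0.
    by rewrite (Eplus_vac (M1_heis form)) => [|l _]; rewrite ?M1_act_vac ?oppr_eq0.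
  rewrite big_ord_recl big1 ?addr0 => [|j _]; last first.
    rewrite /box_term vacE /= (lin0 (vm_linl YU_va _ _)) (lin0 (Eminus_lin act_heis _
      _)).
    exact: scaler0.
  rewrite /box_term vacE /= scale1r (vm_vac YU_va) -/(p a b) -/(c a).
  rewrite (_ : (_ == -1) = (i%:Z == m%:Z - k0)); last by apply/eqP/eqP; rewrite /k0;
    lia.
  by case: eqP => // _; apply: lin0 (Eminus_lin act_heis _ _).
rewrite /box; under eq_bigr do rewrite exchange_big /=; rewrite exchange_big /=.
apply: eq_bigr => m _; under eq_bigr do rewrite btE.
rewrite (_ : m%:Z - n - p a b - c a - 1 = m%:Z - k0); last by rewrite /k0; lia.
have [Mm|mM] := leqP M m.
  rewrite Mw // !(lin0 (Eminus_lin act_heis _ _)) big1 // => i _.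
  by rewrite (lin0 (Eminus_lin act_heis _ _)) if_same.
have [k_ge0|k_lt0] := leP 0 (m%:Z - k0); last first.
  by rewrite Eminus_lt0 // big1 // => i _; case: eqP => // ik; lia.
have kN : (`|(m%:Z - k0)%R| < N.+1)%N by rewrite /k0 in k_ge0 *; lia.
rewrite (bigD1 (Ordinal kN)) //= big1 ?addr0 => [|i /negP ik].
  by rewrite ifT gez0_abs.
by case: eqP => // iE; case: ik; apply/eqP/val_inj => /=; lia.
Qed.

(** The counterpart of [lr_comm] for the explicit formula: E^-(-a,x) commutes with u(-q), and
    E^+(-a,x) contributes the shifted mode. *)
Lemma lat_coef_vac_act a b u (q : nat) w n : (0 < q)%N ->
  lc a b vac (act u (- q%:Z) w) n =
  act u (- q%:Z) (lc a b vac w n) - form u (lat_val a) *: lc a b vac w (n - q%:Z).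
Proof.
move=> q0; have /asboolP[M Mw] := act_fin a w.
have [N [[[-> ->] ->] N0]] := ev_witness (ev_and (ev_and (ev_and
  (lat_coef_vac a b (act u (- q%:Z) w) n) (lat_coef_vac a b w n))
  (lat_coef_vac a b w (n - q%:Z))) (ev_ge (M + q))).
pose F (m : nat) := form u (lat_val a) *: Eminus act (- lat_val a)
  (m%:Z - (n - q%:Z) - p a b - c a - 1) (Eplus act (- lat_val a) (- m%:Z) w).
have F0 m : (N - q <= m)%N -> F m = 0.
  by move=> Nm; rewrite /F Mw ?(lin0 (Eminus_lin act_heis _ _)) ?scaler0 //; lia.
rewrite (lin_sum (act_lin act_heis _ _)) scaler_sumr -[X in _ - X](shift_sum F0) -sumrB.
apply: eq_bigr => m _.
have /esym/(canRL (addrK _)) -> := Eplus_act act_heis (lat_val a) (- m%:Z) u w q0.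
rewrite (linB (Eminus_lin act_heis _ _)) (linZ (Eminus_lin act_heis _ _)).
rewrite -(Eminus_act_le0 act_heis); last by lia.
congr (_ - _); rewrite /F; case: ifPn => [qm|]; last first.
  rewrite -ltnNge => mq; rewrite Eplus_gt0; last by lia.
  by rewrite (lin0 (Eminus_lin act_heis _ _)) scaler0.
rewrite (_ : - (m - q)%N%:Z = - m%:Z + q%:Z); last by lia.
by congr (_ *: Eminus _ _ _ _); lia.
Qed.

Lemma lat_coef_vac_vac a b w n : (forall i : nat,
  (0 < i)%N -> act (lat_val a) i w = 0) ->
  lc a b vac w n = Eminus act (- lat_val a) (- n - p a b - c a - 1) w.
Proof.
move=> aw; have vE (m : nat) : Eplus act (- lat_val a) (- m%:Z) w = if m == 0%N then w
  else 0.
  by rewrite (Eplus_vac act_heis) ?oppr_eq0.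
have [[|N] [-> // _]] := ev_witness (ev_and (lat_coef_vac a b w n) (ev_ge 1)).
rewrite big_ord_recl big1 => [|m _];
  last by rewrite vE /= (lin0 (Eminus_lin act_heis _ _)).
by rewrite vE /= sub0r addr0.
Qed.

End LatticeCoefficients.

(** * Submodules as types, and linear maps through infinite sums *)

Section SubmodulesAndSums.
Variables (C : fieldType) (W : lmodType C).

(** The predicate is [S] itself; the closure proof is an argument so that the instances below can
    recover it. *)
Definition submod_pred (S : {pred W}) (S_sub : submod_closed S) : {pred W} := S.

HB.instance Definition _ (S : {pred W}) (S_sub : submod_closed S) :=
  GRing.isSubmodClosed.Build C W (submod_pred S_sub) S_sub.

Record submod (S : {pred W}) (S_sub : submod_closed S) :=
  Submod { submod_val :> W; _ : submod_val \in submod_pred S_sub }.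

HB.instance Definition _ (S : {pred W}) (S_sub : submod_closed S) :=
  [isSub for @submod_val S S_sub].
HB.instance Definition _ (S : {pred W}) (S_sub : submod_closed S) :=
  [Choice of submod S_sub by <:].
HB.instance Definition _ (S : {pred W}) (S_sub : submod_closed S) :=
  [SubChoice_isSubLmodule of submod S_sub by <:].

Lemma submod_lmodType (S : {pred W}) : submod_closed S ->
  exists (U : lmodType C) (iota : U -> W),
    [/\ linear iota, forall u, iota u = 0 -> u = 0, forall u, iota u \in S &
        forall w, w \in S -> exists u, iota u = w].
Proof.
move=> S_sub; exists (submod S_sub : lmodType C), (@submod_val S S_sub); split=> //.
- by move=> u u0; apply: val_inj.
- exact: valP.
by move=> w wS; exists (Submod (wS : w \in submod_pred S_sub)).
Qed.

Local Open Scope classical_set_scope.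

(** Injectivity gives both families the same support, so when this is infinite both sums take the
    default value 0. *)
Lemma fsum_linear (U : lmodType C) (f : U -> W) (I : choiceType) (F : I -> U) :
  linear f -> (forall u, f u = 0 -> u = 0) ->
  f (\sum_(i \in [set: I]) F i) = \sum_(i \in [set: I]) f (F i).
Proof.
move=> f_lin f_inj; have f0 i : f (F i) = 0 <-> F i = 0.
  by split=> [/f_inj//|->]; apply: lin0.
have suppE : [set i | f (F i) <> 0] = [set i | F i <> 0].
  by apply/seteqP; split=> i /=; rewrite f0.
have [/finite_fsetP[X XE]|infF] := pselect (finite_set [set i | F i <> 0]).
  have FX i : i \notin enum_fset X -> F i = 0.
    move=> iX; apply: contrapT => Fi; have : [set i | F i <> 0] i by [].
    by rewrite XE /= => iX'; rewrite iX' in iX.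
  rewrite !(@fsum_seq _ _ (enum_fset X)) ?fset_uniq //; first exact: lin_sum.
  by move=> i /FX/f0.
rewrite !fsbig_dflt ?setTI ?(lin0 f_lin) //; first by rewrite /preimage /= suppE.
Qed.

End SubmodulesAndSums.

(** * Pulling back structure from W, and the isomorphism *)

Section Intertwining.
#[local] Opaque single latY M1_act M1_pi Eminus Eplus lat_coef.
Variables (C : numFieldType) (h : vectType C) (form : {symmetric h}).
Variables (L : zmodClosed h) (eps : lat L -> lat L -> C).
Variables (YM : M1 form -> int -> M1 form -> M1 form).
Variables (W : lmodType C) (YW : latV L (M1 form) -> int -> W -> W).
Hypothesis L_even : even_lattice form L.
Hypothesis eps_cocycle : is_cocycle form eps.
Hypothesis YM_va : is_M1_va YM.
Hypothesis W_mod : is_lat_module eps YM YW.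

Local Notation H := (hW YW).
Local Notation e := (eW YW).

Lemma lat_module_rep : lat_rep form eps H e.
Proof.
split.
- exact: (hW_heis eps_cocycle YM_va W_mod).
- exact: (eW_lin W_mod).
- exact: (hW_trunc_ev W_mod).
- move=> a w; apply: ev_imp (vm_trunc_ev W_mod (single a (M1_vac form)) w 0).
  by move=> N N0 n Nn; apply: N0; rewrite add0r.
- exact: (hW_eW eps_cocycle YM_va W_mod).
- exact: (eW_deriv eps_cocycle YM_va W_mod).
- exact: (eW_inj eps_cocycle YM_va W_mod).
- exact: (eW_prod YM_va W_mod).
exact: (eW0 W_mod).
Qed.

Variables (r s : nat) (al be : r.-tuple h) (us vs : s.-tuple h).
Hypothesis form_nondeg : nondegenerate form.
Hypothesis bases : adapted_bases form L al be us vs.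
Variable lam : h.
Hypothesis lam_dual : dual_lattice form L lam.
Variables (U1 : lmodType C) (iota : U1 -> W) (opu opv : 'I_s -> nat -> U1 -> U1).
Local Notation V := (vacuum_space form al H).
Hypothesis iota_lin : linear iota.
Hypothesis iota_inj : forall w, iota w = 0 -> w = 0.
Hypothesis iota_vac : forall w, iota w \in V lam.
Hypothesis iota_opu : forall j n w, iota (opu j n w) = H (tnth us j) n%:Z (iota w).
Hypothesis iota_opv : forall j n w, iota (opv j n w) = H (tnth vs j) (- n%:Z) (iota w).

Local Notation Fock := (M1lam r U1).
Local Notation act := (M1lam_act form al be us vs lam opu opv).
Local Notation fk := (fock form be H e lam iota : lat L -> Fock -> W).
Local Notation mono := (@single C ({mset 'I_r * nat}%mset) U1).

Let R := lat_module_rep.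
Let pairE := pairingE L_even.

Let fk_lin a : linear (fk a).
Proof. exact: (fock_lin be R lam iota_lin). Qed.

Let fk_inj a F : fk a F = 0 -> F = 0.
Proof.
exact: (fock_inj form_nondeg bases eps_cocycle R pairE lam_dual iota_lin iota_inj
  iota_vac).
Qed.

Let fk_inj2 a F G : fk a F = fk a G -> F = G.
Proof.
move=> FG; apply/eqP; rewrite -subr_eq0; apply/eqP; apply: (@fk_inj a).
by rewrite (linB (fk_lin a)) FG subrr.
Qed.

Let fk_actN0 a u n F : n != 0 -> fk a (act u n F) = H u n (fk a F).
Proof.
exact: (fock_act form_nondeg bases R lam_dual iota_lin iota_inj iota_vac iota_opu
  iota_opv).
Qed.

Let fk_weight a u F : H u 0 (fk a F) = form (lam + lat_val a) u *: fk a F.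
Proof. exact: (fock_weight form_nondeg bases R lam_dual iota_lin iota_vac). Qed.

(** The correction at n = 0 is the shift of weight by a; the same term occurs at i = 0 in
    [lat_coef_iterate]. *)
Let fk_act a u n F :
  fk a (act u n F + (if n == 0 then form u (lat_val a) else 0) *: F) = H u n (fk a F).
Proof.
have [->|n0] := eqVneq n 0; last by rewrite scale0r addr0 fk_actN0.
rewrite fk_weight /= -scalerDl (linZ (fk_lin a)) formDl.
by rewrite (formC _ (lat_val a)).
Qed.

Let fk0_act u n F : fk 0 (act u n F) = H u n (fk 0 F).
Proof. by rewrite -fk_act lat_val0 form0r if_same scale0r addr0. Qed.

(** [fk 0] is injective and intertwines all modes, so the relations hold because they hold in W. *)
Lemma fock_act_heis : heis form act.
Proof.
have HH := lr_heis R; split=> [u n|n F|u v m n F].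
- by move=> c F G; apply: (@fk_inj2 0); rewrite fk_lin !fk0_act fk_lin (act_lin HH).
- by move=> c u v; apply: (@fk_inj2 0); rewrite fk_lin !fk0_act (act_linl HH).
apply: (@fk_inj2 0); rewrite (linD (fk_lin 0)) (linZ (fk_lin 0)) !fk0_act.
exact: (actC HH).
Qed.

Let act0E u F : act u 0 F = form lam u *: F. Proof. by []. Qed.

Let var_mul_act x F : var_mul x F = act (tnth be x.1) (- x.2.+1%:Z) F.
Proof.
apply: (@fk_inj2 0); rewrite fk0_act.
exact: (fock_var_mul be R lam iota_lin).
Qed.

Let fk_vac a w : fk a (mono mset0 w) = Z form e lam a (iota w).
Proof. by apply: etrans (fock_single be R lam iota_lin a _ w) _;
  rewrite enum_mset0. Qed.

Let act_vac (a : lat L) (i : nat) w : (0 < i)%N -> act (lat_val a) i (mono mset0 w) = 0.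
Proof.
move=> i0; apply: (@fk_inj 0); rewrite fk0_act fk_vac (Z0 R).
exact: (vacuum_space_lat bases R a i0 (iota_vac w)).
Qed.

Let act_fin (a : lat L) F : F \in Eplus_finite act (lat_val a).
Proof.
have sub := Eplus_finite_submod fock_act_heis (lat_val a).
pose P (G : Fock) := is_true (G \in Eplus_finite act (lat_val a)).
apply: (M1lam_ind (P := P)) => [|f g fP gP|w|x f fP]; rewrite /P.
- exact: smc0.
- exact: smcD.
- apply/asboolP; exists 1%N => j j1; rewrite (Eplus_vac fock_act_heis) => [|i i0].
    by rewrite ifF //; apply/negbTE/eqP; lia.
  exact: act_vac.
by rewrite var_mul_act; apply: (Eplus_finite_act fock_act_heis).
Qed.

(** The image of [fk 0] is stable under the Heisenberg modes, and e^0 is the vacuum, so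
    [YW_single_closed] applies with a = 0. *)
Let YU_exists v n F : exists G, fk 0 G = YW (single 0 v) n (fk 0 F).
Proof.
pose S : {pred W} := fun w => `[< exists G, fk 0 G = w >].
suff /asboolP : YW (single 0 v) n (fk 0 F) \in S by [].
apply: (YW_single_closed eps_cocycle YM_va W_mod).
- split=> [|c x y /asboolP[F1 <-] /asboolP[F2 <-]]; apply/asboolP.
    by exists 0; apply: lin0 (fk_lin 0).
  by exists (c *: F1 + F2); apply: fk_lin.
- move=> u k x /asboolP[F1 <-]; apply/asboolP.
  by exists (act u k F1); apply: fk0_act.
- move=> k x xS; rewrite (eW0 W_mod); case: eqP => // _; apply/asboolP.
  by exists 0; apply: lin0 (fk_lin 0).
by apply/asboolP; exists F.
Qed.

Definition fock_YU (v : M1 form) (n : int) (F : Fock) : Fock :=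
  projT1 (cid (YU_exists v n F)).

Let YUE v n F : fk 0 (fock_YU v n F) = YW (single 0 v) n (fk 0 F).
Proof. exact: projT2 (cid (YU_exists v n F)). Qed.

(** Each axiom is pulled back along [fk 0]. For the Jacobi identity [fsum_linear] moves the map
    inside the infinite sums, and [latYM_M1] identifies products in M(1) with products in V. *)
Lemma fock_YU_module : is_M1_module_of YM act fock_YU.
Proof.
split; last first.
  by move=> u n F; apply: (@fk_inj2 0); rewrite YUE fk0_act.
split; [|split; [|split; [|split]]].
- by move=> v n c F G; apply: (@fk_inj2 0); rewrite fk_lin !YUE fk_lin (vm_lin W_mod).
- move=> n F c u v; apply: (@fk_inj2 0); apply: etrans (YUE _ _ _) _.
  apply: etrans (congr1 (fun x => YW x n (fk 0 F)) (single_lin 0 c u v)) _.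
  apply: etrans (vm_linl W_mod n (fk 0 F) c _ _) _;
    apply: etrans _ (esym (fk_lin 0 c _ _)).
  by congr (_ *: _ + _); apply: esym; apply: YUE.
- move=> v F; have [N N0] := vm_trunc W_mod (single 0 v) (fk 0 F).
  by exists N => n Nn; apply: (@fk_inj 0); rewrite YUE N0.
- move=> n F; apply: (@fk_inj2 0); rewrite YUE.
  apply: etrans (vm_vac W_mod n (fk 0 F)) _.
  by case: eqP => // _; rewrite (lin0 (fk_lin 0)).
move=> u v F l m n; apply: (@fk_inj2 0).
apply: etrans (fsum_linear _ (fk_lin 0) (@fk_inj 0)) _.
apply: etrans _ (esym (fsum_linear _ (fk_lin 0) (@fk_inj 0))).
case: W_mod => _ [_ [_ [_ /(_ (single 0 u) (single 0 v) (fk 0 F) l m n) J]]].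
apply: etrans (etrans _ J) _.
  apply: eq_fsbigr => i _; apply: etrans (linZ (fk_lin 0) _ _) _; congr (_ *: _).
  apply: etrans (YUE _ _ _) _; congr (YW _ _ _).
  exact: (esym (latYM_M1 eps_cocycle YM_va _ _ _)).
apply: eq_fsbigr => i _; apply: esym; apply: etrans (linZ (fk_lin 0) _ _) _;
  congr (_ *: _).
apply: etrans (linB (fk_lin 0) _ _) _; congr (_ - _).
  by apply: etrans (YUE _ _ _) _; congr (YW _ _ _); apply: YUE.
apply: etrans (linZ (fk_lin 0) _ _) _; congr (_ *: _).
by apply: etrans (YUE _ _ _) _; congr (YW _ _ _); apply: YUE.
Qed.

Local Notation lc a b v G n := (lat_coef act fock_YU a b v G (- n - 1)).

Let lc_linr (a b : lat L) v k : linear (fun G => lat_coef act fock_YU a b v G k).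
Proof. exact: (lat_coef_linr fock_act_heis fock_YU_module act0E lam_dual act_fin). Qed.

Let lc_linl (a b : lat L) G k : linear (fun v => lat_coef act fock_YU a b v G k).
Proof. exact: (lat_coef_linl fock_act_heis fock_YU_module act0E lam_dual act_fin). Qed.

Let tw (a b : lat L) (G : Fock) : W := eps a b *: fk (a + b) G.

Let tw_lin a b : linear (tw a b).
Proof. by move=> c F G; rewrite /tw fk_lin scalerDr !scalerA mulrC. Qed.

(** Both sides obey the same recursion in creation operators, by [lr_comm] in W and
    [lat_coef_vac_act] on polynomials; on constants both are eps(a,b) E^-(-a,x) Z_(a+b) w. *)
Lemma eW_fock a b n G : e a n (fk b G) = tw a b (lc a b (M1_vac form) G n).
Proof.
pose P (G : Fock) := forall n, e a n (fk b G) = tw a b (lc a b (M1_vac form) G n).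
apply: (M1lam_ind (P := P)) n => [|F F' FP F'P|w|x F FP] n.
- rewrite (lin0 (fk_lin b)) (lin0 (lr_lin R a n)).
  apply: esym; apply: etrans (congr1 (tw a b) (lin0 (lc_linr _ _ _ _))) _.
  exact: lin0 (tw_lin a b).
- rewrite (linD (fk_lin b)) (linD (lr_lin R a n)) FP F'P.
  apply: etrans (esym (linD (tw_lin a b) _ _)) _; congr (tw a b _).
  exact: (esym (linD (lc_linr _ _ _ _) _ _)).
- have aw (i : nat) (i0 : (0 < i)%N) := act_vac a w i0.
  rewrite (lat_coef_vac_vac fock_act_heis fock_YU_module act0E lam_dual act_fin b n aw).
  have Zw := Z_vacuum bases R lam_dual b (iota_vac w).
  rewrite fk_vac (vacuum_space_mode bases R (dual_latticeD pairE b lam_dual) a n Zw).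
  rewrite (ZZ bases R pairE lam_dual) // (wtD pairE lam_dual).
  rewrite (linZ (Eminus_lin (lr_heis R) _ _)) /tw; congr (_ *: _).
  rewrite (Eminus_intertwine (act' := H) _ _ (fk_lin (a + b))) => [|m v m0]; last first.
    by apply: fk_actN0; rewrite lt_eqF.
  by rewrite fk_vac; congr (Eminus _ _ _ _); lia.
rewrite var_mul_act fk_actN0; last by lia.
have /esym/(canRL (addrK _)) -> := lr_comm R (tnth be x.1) a (- x.2.+1%:Z) n (fk b F).
rewrite (lat_coef_vac_act fock_act_heis fock_YU_module act0E lam_dual act_fin) //.
rewrite (linB (tw_lin a b)) (linZ (tw_lin a b)) !FP; congr (_ - _ *: tw _ _ _).
  rewrite /tw (fk_actN0 (a + b)); last by lia.
  by rewrite (linZ (act_lin (lr_heis R) _ _)).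
by congr (lat_coef _ _ _ _ _ _); lia.
Qed.

(** [YW_act_neg_ev] and [lat_coef_iterate] are the same recursion in [v] on the two sides. *)
Lemma YW_fock a v n b G : YW (single a v) n (fk b G) = tw a b (lc a b v G n).
Proof.
pose S : {pred M1 form} := fun v =>
  `[< forall n G, YW (single a v) n (fk b G) = tw a b (lc a b v G n) >].
suff /asboolP : v \in S by [].
apply: M1_ind => [||u k x k0 /asboolP xS].
- split=> [|c x y /asboolP xS /asboolP yS]; apply/asboolP=> k F.
    apply: etrans (etrans (congr1 (fun x =>
      YW x k _) (single0 _ a)) (lin0 (vm_linl W_mod _ _))) _.
    apply: esym; apply: etrans (congr1 (tw a b) (lin0 (lc_linl _ _ _ _))) _.
    exact: lin0 (tw_lin a b).
  apply: etrans (congr1 (fun x => YW x k (fk b F)) (single_lin a c x y)) _.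
  apply: etrans (vm_linl W_mod k (fk b F) c (single a x) (single a y)) _.
  apply: etrans (congr2 (fun y z => c *: y + z) (xS k F) (yS k F)) _.
  apply: etrans (esym (tw_lin a b c _ _)) _; congr (tw a b _).
  exact: (esym (lc_linl _ _ _ _ c _ _)).
- by apply/asboolP => k F; apply: eW_fock.
apply/asboolP => m F; have -> : k = - `|k|%N%:Z by lia.
have k_gt0 : (0 < `|k|)%N by lia.
have [N [E1 E2]] := ev_witness (ev_and
  (YW_act_neg_ev eps_cocycle YM_va W_mod u a x m (fk b F) k_gt0)
  (lat_coef_iterate YM_va fock_act_heis fock_YU_module act0E lam_dual act_fin u a b x F
    m k_gt0)).
apply: etrans E1 _; apply: esym; apply: etrans (congr1 (tw a b) E2) _.
apply: etrans (lin_sum (tw_lin a b) _ _ _) _; apply: eq_bigr => i _.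
rewrite (linZ (tw_lin a b)) (linB (tw_lin a b)) (linZ (tw_lin a b)).
congr (_ *: (_ - _ *: _)).
  rewrite xS /tw (fk_actN0 (a + b)); last by lia.
  by rewrite (linZ (act_lin (lr_heis R) _ _)).
(* The weight correction in the annihilation term is absorbed by [fk_act]. *)
by rewrite -fk_act -xS.
Qed.

Local Notation fkL := (fockL form be H e lam iota : latV L Fock -> W).
Local Notation latYF := (latY eps act fock_YU).

Let fkL_lin : linear fkL. Proof. exact: (fockL_lin be R lam iota_lin). Qed.

Lemma fockL_intertwine v n F : fkL (latYF v n F) = YW v n (fkL F).
Proof.
have latl := latY_linl eps fock_act_heis fock_YU_module act0E lam_dual act_fin.
have latr := latY_linr eps fock_act_heis fock_YU_module act0E lam_dual act_fin.
have lats := latY_single eps fock_act_heis fock_YU_module act0E lam_dual act_fin.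
have fks := fockL_single be R lam iota_lin.
move: F; apply: ffs_lin_ext => [c F G|c F G|b G].
- by rewrite latr fkL_lin.
- by rewrite fkL_lin (vm_lin W_mod).
apply: esym; apply: etrans (congr1 (YW v n) (fks b G)) _; apply: esym.
move: v; apply: ffs_lin_ext => [c x y|c x y|a x].
- by rewrite latl fkL_lin.
- exact: vm_linl W_mod _ _ _ _ _.
apply: etrans (congr1 fkL (lats _ _ _ _ _)) _; apply: etrans (fks _ _) _.
apply: etrans (linZ (fk_lin _) _ _) _.
exact: esym (YW_fock _ _ _ _ _).
Qed.

Let iota_inj2 u w : iota u = iota w -> u = w.
Proof. exact: (iota_inj2 iota_lin iota_inj). Qed.

Lemma vacuum_L1_module : is_L1_module opu opv 1.
Proof.
have HH := lr_heis R.
split=> [j n n0|i j m n w m0 n0|i j m n w m0 n0|i j m n w m0 n0].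
- split; first exact: (opu_lin R iota_lin iota_inj iota_opu).
  exact: (opv_lin R iota_lin iota_inj iota_opv).
- by apply: iota_inj2; rewrite !iota_opu (actC0 HH) //; lia.
- by apply: iota_inj2; rewrite !iota_opv (actC0 HH) //; lia.
apply: iota_inj2; rewrite (linB iota_lin) (linZ iota_lin) !(iota_opu, iota_opv).
rewrite (actC HH) addrC addKr mulr1 (form_us_vs bases).
rewrite (_ : (m%:Z + - n%:Z == 0) = (m == n)); last by apply/eqP/eqP; lia.
by congr (_ *: _); case: (i == j); case: (m == n); rewrite ?mulr0 ?mulr1.
Qed.

Lemma vacuum_L1_restricted : L1_restricted opu.
Proof.
move=> w j; have [N NE] := ev_witness (lr_H_trunc R (tnth us j) (iota w)).
by exists N => n Nn; apply: iota_inj; rewrite iota_opu NE // lez_nat.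
Qed.

Hypothesis W_irr : va_module_irreducible YW.

Let W_irr' (S : {pred W}) : submod_closed S ->
  (forall u n w, w \in S -> H u n w \in S) ->
  (forall a n w, w \in S -> e a n w \in S) -> S =i pred1 0 \/ S =i predT.
Proof.
move=> S_sub SH Se; case: W_irr => _; apply=> // t [[v n] _ <-] w wS.
exact: (YW_closed eps_cocycle YM_va W_mod).
Qed.

Variable w0 : U1.
Hypothesis w0_neq0 : w0 != 0.

(** [fkL] maps the explicit module to W; the isomorphism asked for is its inverse, chosen pointwise
    by surjectivity. *)
Lemma fock_iso : va_module_iso YW latYF.
Proof.
have fkL_inj F : fkL F = 0 -> F = 0.
  exact: (fockL_inj form_nondeg bases eps_cocycle R pairE lam_dual iota_lin iota_inj
    iota_vac).
have fkL_inj2 F G : fkL F = fkL G -> F = G.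
  move=> FG; apply/eqP; rewrite -subr_eq0; apply/eqP/fkL_inj.
  by rewrite (linB fkL_lin) FG subrr.
have predT_sub : submod_closed (predT : {pred U1}) by split.
have surj := fockL_surj form_nondeg bases R pairE lam_dual iota_lin iota_inj iota_vac
  iota_opu iota_opv predT_sub (fun _ _ _ _ _ => isT) (fun _ _ _ _ _ => isT) W_irr'
  (isT : w0 \in predT) w0_neq0.
have [g gE] := choice surj.
exists g; split.
- by move=> c u v; apply: fkL_inj2; rewrite fkL_lin !gE.
- by exists fkL => [w|F]; [exact: gE|apply: fkL_inj2; rewrite gE].
by move=> v n w; apply: fkL_inj2; rewrite gE fockL_intertwine gE.
Qed.

Lemma vacuum_L1_irreducible : L1_irreducible opu opv.
Proof.
split=> [|P P_sub PT]; first by exists w0.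
apply: (fock_span_irr form_nondeg bases eps_cocycle R pairE lam_dual iota_lin iota_inj
  iota_vac iota_opu iota_opv P_sub _ _ W_irr') => j n w n0.
  by apply: PT; exists j, n; split=> //; left.
by apply: PT; exists j, n; split=> //; right.
Qed.

End Intertwining.

(** Stated over any [numFieldType], of which [R[i]] is an instance. U_1 is the full vacuum space of
    weight [lam], turned into a type by [submod_lmodType]. *)
Theorem lat_module_classification (C : numFieldType) (h : vectType C)
  (form : {symmetric h}) (form_nondeg : nondegenerate form)
  (L : zmodClosed h) (L_even : even_lattice form L)
  (eps : lat L -> lat L -> C) (eps_cocycle : is_cocycle form eps)
  (r s : nat) (al be : r.-tuple h) (us vs : s.-tuple h)
  (bases : adapted_bases form L al be us vs)
  (YM : M1 form -> int -> M1 form -> M1 form) (YM_va : is_M1_va YM)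
  (W : lmodType C) (YW : latV L (M1 form) -> int -> W -> W)
  (W_module : is_lat_module eps YM YW)
  (W_irr : va_module_irreducible YW)
  (W_ss : acts_semisimply
            (fun (j : 'I_s) (w : W) => YW (latV_of form L (tnth us j)) 0 w)) :
  exists (lam : h) (U1 : lmodType C) (opu opv : 'I_s -> nat -> U1 -> U1)
         (YU : M1 form -> int -> M1lam r U1 -> M1lam r U1),
    let act := M1lam_act form al be us vs lam opu opv in
    [/\ dual_lattice form L lam,
        is_L1_module opu opv 1 /\ L1_restricted opu /\ L1_irreducible opu opv,
        is_M1_module_of YM act YU &
        va_module_iso YW (latY eps act YU)].
Proof.
have R := lat_module_rep eps_cocycle YM_va W_module; have HH := lr_heis R.
have [lam [lam_dual [w wV w0]]] := vacuum_space_nonzero bases R (proj1 W_irr) W_ss.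
have [U1 [iota [iota_lin iota_inj iota_vac iota_surj]]] :=
  submod_lmodType (vacuum_space_submod al R lam).
have [w0' w0'E] := iota_surj w wV.
have w0'_neq0 : w0' != 0 by apply: contraNneq w0 => w0'0;
  rewrite -w0'E w0'0 (lin0 iota_lin).
(* The al_i need not be orthogonal to the u_j; the vacuum space is stable because al_i(k) with k > 0
   commutes with u_j(n) for n >= 0. *)
have opuP j n u : exists u', iota u' = hW YW (tnth us j) (n : nat)%:Z (iota u).
  apply: iota_surj; have /asboolP[v1 v2] := iota_vac u; apply/asboolP; split=>
    [i k k0|v].
    by rewrite (actC0 HH) ?v1 ?(act0 HH) //; lia.
  by rewrite (actC HH) v2 (linZ (act_lin HH _ _)) mul0r if_same scale0r addr0.
(* The v_j are orthogonal to all al_i, so all their modes preserve the vacuum space. *)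
have opvP j n u : exists u', iota u' = hW YW (tnth vs j) (- (n : nat)%:Z) (iota u).
  by apply: iota_surj; apply: (vacuum_space_act R) => // i; rewrite (form_al_vs bases).
pose opu j n u := projT1 (cid (opuP j n u)).
pose opv j n u := projT1 (cid (opvP j n u)).
have iota_opu j n u : iota (opu j n u) = hW YW (tnth us j) n%:Z (iota u).
  exact: projT2 (cid (opuP j n u)).
have iota_opv j n u : iota (opv j n u) = hW YW (tnth vs j) (- n%:Z) (iota u).
  exact: projT2 (cid (opvP j n u)).
exists lam, U1, opu, opv, (fock_YU eps_cocycle YM_va W_module form_nondeg bases lam_dual
  iota_lin iota_inj iota_vac iota_opu iota_opv); split=> //.
- split; first exact: (vacuum_L1_module eps_cocycle YM_va W_module bases
    iota_lin iota_inj iota_opu iota_opv).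
  split; first exact: (vacuum_L1_restricted eps_cocycle YM_va W_module iota_inj
    iota_opu).
  exact: (vacuum_L1_irreducible L_even eps_cocycle YM_va W_module form_nondeg bases
    lam_dual iota_lin iota_inj iota_vac iota_opu iota_opv W_irr w0'_neq0).
- exact: fock_YU_module.
exact: (fock_iso _ _ _ _ _ _ _ _ _ _ _ _ W_irr w0'_neq0).
Qed.

Theorem theorem3p10 (R : realType) (h : vectType R[i])
  (form : {symmetric h}) (form_nondeg : nondegenerate form)
  (L : zmodClosed h) (L_even : even_lattice form L)
  (eps : lat L -> lat L -> R[i]) (eps_cocycle : is_cocycle form eps)
  (r s : nat) (al be : r.-tuple h) (us vs : s.-tuple h)
  (bases : adapted_bases form L al be us vs)
  (YM : M1 form -> int -> M1 form -> M1 form) (YM_va : is_M1_va YM)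
  (W : lmodType R[i]) (YW : latV L (M1 form) -> int -> W -> W)
  (W_module : is_lat_module eps YM YW)
  (W_irr : va_module_irreducible YW)
  (W_ss : acts_semisimply
            (fun (j : 'I_s) (w : W) => YW (latV_of form L (tnth us j)) 0 w)) :
  exists (lam : h) (U1 : lmodType R[i]) (opu opv : 'I_s -> nat -> U1 -> U1)
         (YU : M1 form -> int -> M1lam r U1 -> M1lam r U1),
    let act := M1lam_act form al be us vs lam opu opv in
    [/\ dual_lattice form L lam,
        is_L1_module opu opv 1 /\ L1_restricted opu /\ L1_irreducible opu opv,
        is_M1_module_of YM act YU &
        va_module_iso YW (latY eps act YU)].
Proof.
exact: (@lat_module_classification R[i] h form form_nondeg L L_even eps eps_cocycle
  r s al be us vs bases YM YM_va W YW W_module W_irr W_ss).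
Qed.
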